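(* Let $M=(m_{j,k})_{j,k\ge1}$ be the random infinite Hermitian matrix given by $$m_{j,k} = \gamma_1 \delta_{j,k} + \sqrt{\gamma_2}\, G_{j,k} + \sum_{\ell \geq 1} x_\ell\left(\xi^{(\ell)}_j \overline{\xi^{(\ell)}_k} - \delta_{j,k}\right),$$ with $\gamma_1, \gamma_2, (x_\ell)_{\ell\ge1}, (G_{j,k})_{j,k\ge1}, (\xi^{(\ell)}_j)_{\ell,j\ge1}$ as specified in the context, and let $M_n=(m_{j,k})_{1\le j,k\le n}$. (1) For all $r\ge1$, the $r$-th largest (resp. smallest) eigenvalue of $M_n$ (counted with multiplicity), divided by $n$, converges almost surely as $n\to\infty$ to the $r$-th largest (resp. smallest) point of $\{x_\ell,\ \ell\ge1\}$ (counted with multiplicity) if this point is positive (resp. negative), and to zero if this point is negative (resp. positive) or does not exist. (2) Let $r \geq 1$ and assume that $(x_\ell)_{\ell\ge1}$ has a single $r$-th largest (resp. smallest) point $x_{\ell(r)}$ (i.e. the $r$-th largest, resp. smallest, point exists and has multiplicity one in the sequence), and that this point is positive (resp. negative). Let $V_n$ be an eigenvector corresponding to the $r$-th largest (resp. smallest) eigenvalue of $M_n$, normalized in such a way that $\|V_n\|=\sqrt{n}$ and the first non-zero coordinate of $V_n$ is real and positive. Then, for all $a\ge1$, the $a$-th coordinate of $V_n$ converges almost surely to $$\xi^{(\ell(r))}_a\,\frac{|\xi^{(\ell(r))}_1|}{\xi^{(\ell(r))}_1}$$ as $n\to\infty$.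
   Context: $\delta_{j,k}=1$ if $j=k$ and $0$ otherwise. $\gamma_1\in\mathbb{R}$ and $\gamma_2\in\mathbb{R}_+=[0,\infty)$ are deterministic; $(x_\ell)_{\ell\ge1}$ is a deterministic, finite (possibly empty) or infinite, square-summable sequence of non-zero real numbers, with possible repetitions; $(G_{j,k})_{j,k\ge1}$ is an infinite matrix following the Gaussian Unitary Ensemble (Hermitian, independent centered entries for $j\le k$ up to Hermitian symmetry, real Gaussian on the diagonal, rotationally invariant complex Gaussian off the diagonal), normalized so that $\mathbb{E}[G_{j,j}^2]=1$ (and $\mathbb{E}[|G_{j,k}|^2]=1$); $(\xi^{(\ell)}_j)_{\ell,j\ge1}$ is a family, independent of $G$, of i.i.d. complex Gaussian variables with $\mathbb{E}[\xi^{(\ell)}_j]=\mathbb{E}[(\xi^{(\ell)}_j)^2]=0$ and $\mathbb{E}[|\xi^{(\ell)}_j|^2]=1$. If $(x_\ell)$ is infinite, the sum over $\ell$ defining $m_{j,k}$ is the limit of its partial sums, which converges almost surely and in $L^2$. $\|\cdot\|$ is the Euclidean (Hermitian) norm on $\mathbb{C}^n$. Quantities are considered for $n$ large enough that they make sense ($n\ge r$, $n\ge a$). *)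

(* Defs.v *)
From HB Require Import structures.
From mathcomp Require Import all_boot all_order all_algebra.
From mathcomp Require Import complex.
From mathcomp Require Import all_classical all_reals all_analysis.

Set Implicit Arguments.
Unset Strict Implicit.
Unset Printing Implicit Defensive.

Import Order.TTheory GRing.Theory Num.Theory.
Import numFieldNormedType.Exports.

Local Open Scope classical_set_scope.
Local Open Scope ring_scope.

HB.instance Definition _ (R : realType) := NormedModule.copy R[i] R[i]^o.

(* Every index is 0-based: xi l j, G j k and the coordinates of vectors
   correspond to $\xi^{(l+1)}_{j+1}$, $G_{j+1,k+1}$, etc.  Ranks ("r-th
   largest") are 1-based. *)

Section complex_random_variables.
Context d (T : measurableType d) (R : realType) (P : probability T R).

(* R[i] carries no measurable structure in the libraries: measurability and
   laws of complex random variables go through R[i] = R * R. *)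
Definition reim (z : R[i]) : measurableTypeR R * measurableTypeR R :=
  (complex.Re z, complex.Im z).

Definition complex_rv (X : T -> R[i]) : Prop := measurable_fun setT (reim \o X).

Definition sigma_rv (X : T -> R[i]) : set_system T :=
  preimage_set_system setT (reim \o X) measurable.

Definition same_law (X Y : T -> R[i]) : Prop :=
  forall A, measurable A ->
    P ((reim \o X) @^-1` A) = P ((reim \o Y) @^-1` A).

Definition has_expectation (X : T -> R[i]) (z : R[i]) : Prop :=
  ('E_P[fun w => complex.Re (X w)] = (complex.Re z)%:E)%E /\
  ('E_P[fun w => complex.Im (X w)] = (complex.Im z)%:E)%E.

(* normal_prob m 0 is not the degenerate Gaussian law in the library (it is a
   dummy uniform law), hence the case distinction. *)
Definition gaussian_law (m s : R) (A : set (measurableTypeR R)) : \bar R :=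
  if s == 0 then \d_m A else normal_prob m s A.

Definition real_gaussian (X : T -> R) : Prop :=
  measurable_fun setT (X : T -> measurableTypeR R) /\
  exists m s : R, 0 <= s /\
    forall A : set (measurableTypeR R), measurable A ->
      P (X @^-1` A) = gaussian_law m s A.

(* (Re X, Im X) is a Gaussian vector of R^2 *)
Definition complex_gaussian (X : T -> R[i]) : Prop :=
  complex_rv X /\
  forall a b : R,
    real_gaussian (fun w => a * complex.Re (X w) + b * complex.Im (X w)).

Definition rotationally_invariant (X : T -> R[i]) : Prop :=
  forall u : R[i], `|u| = 1 -> same_law (fun w => u * X w) X.

Definition mutually_independent (I : eqType) (F : I -> set_system T) : Prop :=
  forall (s : seq I) (A : I -> set T), uniq s ->
    (forall i, i \in s -> F i (A i)) ->
    P (\bigcap_(i in [set` s]) A i) = (\prod_(i <- s) P (A i))%E.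

Definition independent_families (I J : Type)
    (X : I -> T -> R[i]) (Y : J -> T -> R[i]) : Prop :=
  forall A B, <<s \bigcup_i sigma_rv (X i) >> A ->
    <<s \bigcup_j sigma_rv (Y j) >> B ->
    P (A `&` B) = (P A * P B)%E.

Definition is_GUE (G : nat -> nat -> T -> R[i]) : Prop :=
  [/\ forall j k w, G k j w = conjc (G j k w),
      mutually_independent
        (fun jk : {jk : nat * nat | (jk.1 <= jk.2)%N} =>
           sigma_rv (G (val jk).1 (val jk).2)),
      forall j, [/\ real_gaussian (fun w => complex.Re (G j j w)),
                    has_expectation (G j j) 0
                  & has_expectation (fun w => G j j w ^+ 2) 1]
    & forall j k, (j < k)%N ->
        [/\ complex_gaussian (G j k), rotationally_invariant (G j k),
            has_expectation (G j k) 0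
          & has_expectation (fun w => `|G j k w| ^+ 2) 1]].

Definition iid_complex_gaussians (xi : nat -> nat -> T -> R[i]) : Prop :=
  [/\ mutually_independent (fun lj : nat * nat => sigma_rv (xi lj.1 lj.2)),
      forall l j l' j', same_law (xi l j) (xi l' j')
    & forall l j,
        [/\ complex_gaussian (xi l j),
            has_expectation (xi l j) 0,
            has_expectation (fun w => xi l j w ^+ 2) 0
          & has_expectation (fun w => `|xi l j w| ^+ 2) 1]].

End complex_random_variables.

(* A finite or infinite sequence (x_l) is a function x : nat -> R with a length
   N : option nat (None for an infinite sequence); values of x outside the index
   set are irrelevant. *)
Definition in_seq (N : option nat) (l : nat) : bool :=
  if N is Some m then (l < m)%N else true.

Definition square_summable (R : realType) (N : option nat) (x : nat -> R) :=
  cvgn (series (fun l => if in_seq N l then x l ^+ 2 else 0)).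

(* With le := >=%R (resp. <=%R): x l is the r-th largest (resp. smallest) point
   of the sequence, counted with multiplicity; rcons s l lists the indices of
   the first r points in the order le. *)
Definition is_rth_point (R : realType) (le : rel R) (N : option nat)
    (x : nat -> R) (r l : nat) : Prop :=
  exists s : seq nat, let t := rcons s l in
    [/\ size t = r, uniq t, all (in_seq N) t, sorted le [seq x i | i <- t]
      & forall i, in_seq N i -> i \notin t -> le (x l) (x i)].

Definition spiked_entry (R : realType) (T : Type) (gamma1 gamma2 : R)
    (N : option nat) (x : nat -> R) (G xi : nat -> nat -> T -> R[i])
    (j k : nat) (w : T) : R[i] :=
  (gamma1%:C)%C * (j == k)%:R + ((Num.sqrt gamma2)%:C)%C * G j k w +
  limn (series (fun l => if in_seq N l
    then ((x l)%:C)%C * (xi l j w * conjc (xi l k w) - (j == k)%:R) else 0)).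

Definition spiked_mx (R : realType) (T : Type) (gamma1 gamma2 : R)
    (N : option nat) (x : nat -> R) (G xi : nat -> nat -> T -> R[i])
    (n : nat) (w : T) : 'M[R[i]]_n :=
  \matrix_(j < n, k < n) spiked_entry gamma1 gamma2 N x G xi j k w.

(* the roots of the characteristic polynomial, with multiplicity *)
Definition eigenvalues (R : realType) n (A : 'M[R[i]]_n) : seq R[i] :=
  sval (closed_field_poly_normal (char_poly A)).

(* r-th largest (le := >=%R) or smallest (le := <=%R) eigenvalue of a Hermitian
   matrix; the default 0 is only used when r is not between 1 and n *)
Definition rth_eigenvalue (R : realType) (le : rel R) n (A : 'M[R[i]]_n)
    (r : nat) : R :=
  nth 0 (sort le [seq complex.Re z | z <- eigenvalues A]) r.-1.

Definition hnorm (R : realType) n (v : 'cV[R[i]]_n) : R[i] :=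
  sqrtC (\sum_(i < n) `|v i ord0| ^+ 2).

(* On R[i], 0 < z means that z is real and positive. *)
Definition normalized_eigenvector (R : realType) n (A : 'M[R[i]]_n)
    (lambda : R) (v : 'cV[R[i]]_n) : Prop :=
  [/\ v != 0, A *m v = (lambda%:C)%C *: v, hnorm v = sqrtC n%:R
    & forall i : 'I_n, v i ord0 != 0 ->
        (forall j : 'I_n, (j < i)%N -> v j ord0 = 0) -> 0 < v i ord0].

(* a-th coordinate for a : nat, with value 0 when n <= a *)
Definition nth_coord (R : realType) n (v : 'cV[R[i]]_n) (a : nat) : R[i] :=
  if insub a is Some i then v i ord0 else 0.

(* Main.v *)
(* Let y be x extended by zero, and let u_l be the first n coordinates of xi^(l)
   divided by sqrt n. By the law of large numbers the u_l are asymptotically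
   orthonormal. Moreover:
   - the operator norm of G_n is o(n), since its fourth power is at most
     ||G_n^2||_F^2, whose expectation is O(n^3);
   - the entries of the remainder of index l >= L of the series have variance
     O(sum_(l >= L) y_l^2), and only O(n^3) pairs of entries are correlated, so
     that its Frobenius norm is at most n times a constant which is small for
     large L.
   Hence M_n / n is within any prescribed epsilon, in operator norm, of a finite
   sum of the y_l u_l u_l^*, and the min-max principle gives the eigenvalues.
   When y_l is simple, the corresponding unit eigenvector v is asymptotically
   c u_l with |c| = 1. Row a of the equation M_n V_n = lambda V_n then identifies
   the a-th coordinate with c xi_a, because the averages of m_(a,k) xi^(l)_k over
   k <= n converge to y_l xi^(l)_a; the coordinate of index 0 determines the phase
   of c. The smallest eigenvalues are those of - M_n, up to sign. *)

Require Import Defs.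
From HB Require Import structures.
From mathcomp Require Import all_boot all_order all_algebra.
From mathcomp Require Import complex.
From mathcomp Require Import all_classical all_reals all_analysis.
From mathcomp Require Import measurable_realfun.
From mathcomp Require Import ring lra zify.
Import Order.TTheory GRing.Theory Num.Theory.
Import numFieldNormedType.Exports.
Local Open Scope classical_set_scope.
Local Open Scope ring_scope.

Set Implicit Arguments.
Unset Strict Implicit.
Unset Printing Implicit Defensive.

(** * Hermitian matrices and order statistics of eigenvalues *)

Section linear_algebra.
Context {R : realType}.
Local Notation C := R[i].

(** All randomness is condensed into the predicate [spiked_asymptotics], which holds almost surely;
    eigenvalues and eigenvectors are then studied at a fixed realization. Two obstacles shape the
    probabilistic half. The entries are almost sure limits of series in l, so moments are estimated
    for truncated series and carried to the limit by Fatou's lemma. Variances of averages decay only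
    like 1/n, which is not summable: bounds are summed along n = (q+1)^2, and the other n are
    reached by monotonicity, by zero extension, or by a crude bound on the block between two
    squares. The Frobenius bound on the remainder is too weak for a single row, which the
    eigenvectors require. Given column a of the xi, the entries (a, k), k <> a, of the remainder
    have as second moment the sum of y_l^2 |xi_a^(l)|^2 over l >= L; a law of large numbers along
    the row shows that their average squared modulus tends to this tail of a convergent series. *)

Definition absq (z : C) : R := complex.Re z ^+ 2 + complex.Im z ^+ 2.

Lemma absq_ge0 z : 0 <= absq z.
Proof. by rewrite addr_ge0 ?sqr_ge0. Qed.

Lemma absqE z : ((absq z)%:C)%C = conjc z * z.
Proof. by case: z => a b; rewrite /absq /=; simpc; congr (_ +i* _)%C; ring. Qed.

Lemma absqM y z : absq (y * z) = absq y * absq z.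
Proof. by case: y z => a b [c e]; rewrite /absq /=; ring. Qed.

Lemma absqJ z : absq (conjc z) = absq z.
Proof. by case: z => a b; rewrite /absq /=; ring. Qed.

Lemma absqN z : absq (- z) = absq z.
Proof. by case: z => a b; rewrite /absq /=; ring. Qed.

Lemma absq0 : absq 0 = 0.
Proof. by rewrite /absq /=; ring. Qed.

Lemma absqR (a : R) : absq (a%:C)%C = a ^+ 2.
Proof. by rewrite /absq /=; ring. Qed.

Lemma absq_eq0 z : (absq z == 0) = (z == 0).
Proof.
case: z => a b; rewrite /absq eq_complex /= paddr_eq0 ?sqr_ge0//.
by rewrite !sqrf_eq0.
Qed.

Lemma absqD_le y z : absq (y + z) <= 2 * absq y + 2 * absq z.
Proof.
case: y z => a b [c e]; rewrite /absq /= -subr_ge0.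
rewrite (_ : _ - _ = (a - c) ^+ 2 + (b - e) ^+ 2); last by ring.
by rewrite addr_ge0 ?sqr_ge0.
Qed.

(** The modulus of [R[i]] is itself [R[i]]-valued. Real-valued squared norms and forms keep the
    estimates in [R], within reach of [lra] and [nra]. [dotc] is antilinear in its first
    argument. *)
Definition nrm2 n (v : 'cV[C]_n) : R := \sum_i absq (v i ord0).
Definition dotc n (u v : 'cV[C]_n) : C := \sum_i conjc (u i ord0) * v i ord0.
Definition hform n (A : 'M[C]_n) (v : 'cV[C]_n) : R := complex.Re (dotc v (A *m v)).
Definition is_herm n (A : 'M[C]_n) := forall i j, A j i = conjc (A i j).

Lemma nrm2_ge0 n (v : 'cV[C]_n) : 0 <= nrm2 v.
Proof. by apply: sumr_ge0 => i _; apply: absq_ge0. Qed.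

Lemma nrm2E n (v : 'cV[C]_n) : ((nrm2 v)%:C)%C = dotc v v.
Proof. by rewrite /nrm2 rmorph_sum; apply: eq_bigr => i _; rewrite /= -absqE. Qed.

Lemma nrm2_eq0 n (v : 'cV[C]_n) : (nrm2 v == 0) = (v == 0).
Proof.
apply/idP/eqP => [|->]; last first.
  by rewrite /nrm2 big1// => i _; rewrite mxE absq0.
rewrite /nrm2 psumr_eq0 => [/allP h|i _]; last exact: absq_ge0.
apply/colP => i; rewrite [RHS]mxE; apply/eqP; rewrite -absq_eq0.
by apply: (implyP (h i _)); rewrite ?mem_index_enum.
Qed.

Lemma nrm2_gt0 n (v : 'cV[C]_n) : (0 < nrm2 v) = (v != 0).
Proof. by rewrite lt0r nrm2_eq0 nrm2_ge0 andbT. Qed.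

(** The dimension count of the min-max principle: subspaces are given by linear equations, and two
    of them are intersected by stacking their equations. *)
Lemma kernel_nontrivial (F : fieldType) m n (B : 'M[F]_(m, n)) :
  (m < n)%N -> exists2 v : 'cV[F]_n, v != 0 & B *m v = 0.
Proof.
move=> mn; have : kermx B^T != 0.
  rewrite -mxrank_eq0 mxrank_ker subn_eq0 -ltnNge.
  by apply: leq_ltn_trans mn; rewrite mxrank_tr; exact: rank_leq_row.
case/rowV0Pn => u /sub_kermxP uB u0; exists u^T.
  by apply: contra u0 => /eqP/(congr1 trmx); rewrite trmxK trmx0 => ->.
by apply: trmx_inj; rewrite trmx_mul trmxK uB trmx0.
Qed.

Lemma prod_XsubC_perm (F : fieldType) (s t : seq F) :
  \prod_(a <- s) ('X - a%:P) = \prod_(a <- t) ('X - a%:P) -> perm_eq s t.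
Proof.
elim: s t => [|a s IH] t.
  rewrite big_nil => h; have := congr1 (fun p : {poly F} => size p) h.
  by rewrite size_poly1 size_prod_XsubC; case: t {h}.
move=> h; have : a \in t.
  by rewrite -root_prod_XsubC -h root_prod_XsubC mem_head.
move=> at_; rewrite perm_sym; apply: perm_trans (perm_to_rem at_) _.
rewrite perm_sym perm_cons; apply: IH; move: h.
rewrite (perm_big _ (perm_to_rem at_)) /= !big_cons.
by apply: mulfI; rewrite polyXsubC_eq0.
Qed.

(** [eigenvalues] results from a choice of factorization; uniqueness of the roots with multiplicity
    determines it up to order, which sorting forgets. *)
Lemma eigenvaluesP n (A : 'M[C]_n) (s : seq C) :
  char_poly A = \prod_(a <- s) ('X - a%:P) -> perm_eq (eigenvalues A) s.
Proof.
move=> h; apply: prod_XsubC_perm; rewrite -h /eigenvalues.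
case: closed_field_poly_normal => r /= ->.
by rewrite (monicP (char_poly_monic A)) scale1r.
Qed.

(** Only Parseval's identity and the diagonal expression of [hform] are kept from the unitary
    diagonalization; they suffice for the min-max principle. *)
Lemma hermitian_spectral n (A : 'M[C]_n) : is_herm A ->
  exists (e : 'I_n -> R) (E : 'I_n -> 'cV[C]_n),
  [/\ perm_eq [seq complex.Re z | z <- eigenvalues A] (codom e),
      forall v, nrm2 v = \sum_i absq (dotc (E i) v) &
      forall v, hform A v = \sum_i e i * absq (dotc (E i) v)].
Proof.
move=> hA.
have Ah : A \is hermsymmx.
  apply/is_hermitianmxP; rewrite expr0 scale1r.
  by apply/matrixP => i j; rewrite !mxE hA.
have /hermitian_normalmx/orthomx_spectralP := Ah.
have := hermitian_spectral_diag_real Ah.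
have := spectral_unitarymx A; move: (spectralmx A) (spectral_diag A) => Q D.
move=> Qu /mxOverP Dr AE; rewrite (invmx_unitary Qu) in AE.
have De i : ((complex.Re (D ord0 i))%:C)%C = D ord0 i.
  by apply: RRe_real; exact: Dr.
(* With A = Q^* D Q, the eigenvectors are the conjugated rows of Q, so that [dotc (E i) v] is
   coordinate i of Q v. *)
pose E i : 'cV[C]_n := \col_j conjc (Q i j).
have dE i v : dotc (E i) v = (Q *m v) i ord0.
  by rewrite /dotc mxE; apply: eq_bigr => j _; rewrite mxE conjcK.
have nE (v : 'cV[C]_n) : nrm2 (Q *m v) = nrm2 v.
  apply: complexI; rewrite !nrm2E.
  have h (u : 'cV[C]_n) : dotc u u = ((u ^t* )%sesqui *m u) ord0 ord0.
    by rewrite mxE; apply: eq_bigr => j _; rewrite !mxE.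
  rewrite !h trmx_mul map_mxM mulmxA -(mulmxA _ _ Q).
  have -> : (Q ^t* )%sesqui *m Q = 1%:M.
    by move: Qu; rewrite -trmxC_unitary => /unitarymxP; rewrite trmxCK.
  by rewrite mulmx1.
exists (fun i => complex.Re (D ord0 i)), E; split.
- suff : perm_eq (eigenvalues A) (codom (fun i => D ord0 i)).
    move=> /(perm_map (@complex.Re R))/perm_trans; apply;
      by rewrite /codom /image_mem -map_comp.
  apply: eigenvaluesP; rewrite /codom /image_mem big_map.
  have -> : char_poly A = char_poly (diag_mx D).
    rewrite AE; have QQ : (Q^t* *m Q)%sesqui = 1%:M.
      by move: Qu; rewrite -trmxC_unitary => /unitarymxP; rewrite trmxCK.
    rewrite /char_poly /char_poly_mx.
    pose Q1 := map_mx polyC (Q^t*)%sesqui; pose Q2 := map_mx polyC Q.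
    have Q12 : Q1 *m Q2 = 1%:M by rewrite -map_mxM QQ map_mx1.
    rewrite !map_mxM -/Q1 -/Q2.
    have -> : 'X%:M - Q1 *m map_mx polyC (diag_mx D) *m Q2 =
              Q1 *m ('X%:M - map_mx polyC (diag_mx D)) *m Q2.
      rewrite mulmxBr mulmxBl; congr (_ - _).
      by rewrite mul_mx_scalar -scalemxAl Q12 scalemx1.
    rewrite !det_mulmx mulrAC mulrC; have := congr1 determinant Q12.
    by rewrite det_mulmx det1 => ->; rewrite mulr1.
  rewrite char_poly_trig ?diag_mx_is_trig// big_enum /=.
  by apply: eq_bigr => i _; rewrite mxE eqxx mulr1n.
- by move=> v; rewrite -nE; apply: eq_bigr => i _; rewrite dE.
- move=> v; rewrite /hform.
  have -> : dotc v (A *m v) = \sum_i D ord0 i * (conjc ((Q *m v) i ord0) * (Q *m v) i ord0).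
    have h (u w : 'cV[C]_n) : dotc u w = ((u ^t* )%sesqui *m w) ord0 ord0.
      by rewrite mxE; apply: eq_bigr => j _; rewrite !mxE.
    rewrite h AE -!mulmxA (mulmxA (v ^t* )%sesqui).
    have -> : (v ^t* *m Q ^t* = (Q *m v) ^t* )%sesqui by rewrite trmx_mul map_mxM.
    move: (Q *m v) => y; rewrite mxE.
    by apply: eq_bigr => i _; rewrite mul_diag_mx !mxE mulrCA.
  rewrite raddf_sum; apply: eq_bigr => i _ /=; rewrite dE -absqE -[D ord0 i in LHS]De.
  by rewrite -rmorphM.
Qed.

End linear_algebra.

(** * Ranks in sorted lists *)

Section order_statistics.
Context {R : realType}.

(** In a decreasing list an upward closed predicate holds on a prefix, which stops before [k] when
    the predicate fails there. Past the end, the count is at most the size anyway. *)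
Lemma count_sorted_nth (s : seq R) (p : pred R) (k : nat) :
  sorted >=%R s -> (forall a b : R, a <= b -> p a -> p b) ->
  ~~ p (nth 0 s k) -> (count p s <= k)%N.
Proof.
move=> ss pm pk; rewrite -(cat_take_drop k s) count_cat.
rewrite [X in (_ + X)%N](_ : _ = 0)%N ?addn0.
  by apply: leq_trans (count_size _ _) _; rewrite size_take_min geq_minl.
apply/eqP; rewrite -leqn0 leqNgt -has_count; apply/negP => /hasP[a].
move=> /(nthP 0) [j]; rewrite size_drop nth_drop => ik <-.
have sk : (k + j < size s)%N by rewrite -ltn_subRL.
apply/negP; apply: contra pk; apply: pm.
apply: (sorted_leq_nth ge_trans ge_refl 0 ss) => //; rewrite ?inE ?leq_addr//.
exact: leq_ltn_trans (leq_addr _ _) sk.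
Qed.

Lemma sort_ge_sorted (s : seq R) : sorted >=%R (sort >=%R s).
Proof. by apply: sort_sorted => a b; rewrite /Order.ge /= le_total. Qed.

Lemma nth_sort_ge_lower (s : seq R) (t : R) (r : nat) : (0 < r)%N ->
  (r <= count (fun a => (t <= a)%R) s)%N -> t <= nth 0 (sort >=%R s) r.-1.
Proof.
move=> r0 rs; rewrite leNgt; apply/negP => lt.
have pm (a b : R) : a <= b -> t <= a -> t <= b by move=> ab /le_trans; apply.
have := count_sorted_nth (sort_ge_sorted s) pm (_ : ~~ (t <= nth 0 _ r.-1)).
rewrite -ltNge count_sort => /(_ lt)/(leq_trans rs).
by case: (r) r0 => // k _; rewrite ltnn.
Qed.

(** The condition [r <= size s] keeps [nth] away from its default 0, which may exceed [t]. *)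
Lemma nth_sort_ge_upper (s : seq R) (t : R) (r : nat) : (0 < r <= size s)%N ->
  (count (fun a => (t < a)%R) s < r)%N -> nth 0 (sort >=%R s) r.-1 <= t.
Proof.
move=> /andP[r0 rs] h; rewrite leNgt; apply/negP => lt.
suff : (r <= count (fun a => (t < a)%R) s)%N by rewrite leqNgt h.
have -> : count (fun a => (t < a)%R) s = count (fun a => (t < a)%R) (sort >=%R s).
  by rewrite count_sort.
rewrite -(cat_take_drop r (sort _ _)) count_cat.
apply: leq_trans (leq_addr _ _).
have sz : size (take r (sort >=%R s)) = r by rewrite size_takel// size_sort.
suff : all (fun a => (t < a)%R) (take r (sort >=%R s)).
  by rewrite all_count sz => /eqP->.
apply/(all_nthP 0) => i.
rewrite sz => ir; rewrite nth_take//; apply: lt_le_trans lt _.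
apply: (sorted_leq_nth ge_trans ge_refl 0 (sort_ge_sorted s)) => //;
  rewrite ?inE ?size_sort ?prednK//.
- exact: leq_trans ir rs.
- by rewrite -ltnS prednK.
Qed.

End order_statistics.

(** * Min-max principle *)

Section minmax.
Context {R : realType}.
Local Notation C := R[i].

Lemma size_eigenvalues n (A : 'M[C]_n) : size (eigenvalues A) = n.
Proof.
rewrite /eigenvalues; case: closed_field_poly_normal => s /= h.
have := congr1 (fun p : {poly C} => size p) h.
rewrite size_char_poly (monicP (char_poly_monic A)) scale1r size_prod_XsubC.
by move=> [].
Qed.

Lemma count_codomE n (e : 'I_n -> R) (p : pred R) :
  count p (codom e) = #|[set i | p (e i)]%SET|.
Proof.
rewrite /codom /image_mem count_map -sum1_count -sum1_card big_enum_cond /=.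
by apply: eq_bigl => i; rewrite inE.
Qed.

(** Its kernel is the orthogonal complement of the [E i], i in [S], written as equations so that it
    can be stacked with others. *)
Definition ortho_mx n (E : 'I_n -> 'cV[C]_n) (S : {set 'I_n}) : 'M[C]_(#|S|, n) :=
  \matrix_(a, j) conjc (E (enum_val a) j ord0).

Lemma ortho_mxP n (E : 'I_n -> 'cV[C]_n) (S : {set 'I_n}) v :
  ortho_mx E S *m v = 0 -> forall i, i \in S -> dotc (E i) v = 0.
Proof.
move=> h i iS; move/matrixP/(_ (enum_rank_in iS i) ord0): h.
rewrite !mxE => <-; apply: eq_bigr => j _.
by rewrite mxE enum_rankK_in.
Qed.

(** If fewer than [r] eigenvalues were at least [t], the test space, image by [U] of the kernel of
    [B], would contain a nonzero vector orthogonal to their eigenvectors, where the form is below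
    [t]. Using both [U] and [B] covers orthogonal complements ([U] the identity) and spans ([B]
    without rows). *)
Lemma rth_eigenvalue_lower n p k (A : 'M[C]_n) (U : 'M[C]_(n, p))
    (B : 'M[C]_(k, p)) (t : R) (r : nat) :
  is_herm A -> (0 < r)%N -> (k + r <= p)%N ->
  (forall c, c != 0 -> B *m c = 0 ->
     U *m c != 0 /\ t * nrm2 (U *m c) <= hform A (U *m c)) ->
  t <= rth_eigenvalue >=%R A r.
Proof.
move=> /hermitian_spectral[e [E [pE nE fE]]] r0 kr h.
apply: nth_sort_ge_lower => //; rewrite (permP pE) count_codomE.
set S := [set _ | _]%SET; rewrite leqNgt; apply/negP => Sr.
have [|c c0 /eqP] := kernel_nontrivial (col_mx B (ortho_mx E S *m U)).
  by apply: leq_trans kr; rewrite ltn_add2l.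
rewrite mul_col_mx col_mx_eq0 => /andP[/eqP Bc /eqP]; rewrite -mulmxA => Oc.
have [v0 tv] := h c c0 Bc; move: (U *m c) Oc v0 tv => v /ortho_mxP vS v0.
rewrite leNgt => /negP; apply; rewrite nE fE mulr_sumr -subr_gt0 -sumrB.
have : 0 < \sum_i absq (dotc (E i) v) by rewrite -nE nrm2_gt0.
have pos i : 0 <= t * absq (dotc (E i) v) - e i * absq (dotc (E i) v).
  have [iS|] := boolP (i \in S); first by rewrite vS// absq0 !mulr0 subr0.
  by rewrite inE -ltNge => /ltW ti; rewrite -mulrBl mulr_ge0 ?absq_ge0// subr_ge0.
rewrite !lt0r !sumr_ge0 ?andbT => //[|i _]; last exact: absq_ge0.
rewrite !psumr_neq0 => [/hasP[i _ /= ai]|i _|i _]; rewrite ?absq_ge0//.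
apply/hasP; exists i; first by rewrite mem_index_enum.
rewrite /= -mulrBl mulr_gt0// subr_gt0 ltNge; apply/negP => ti.
by move: ai; rewrite vS ?absq0 ?ltxx// inE.
Qed.

(** If [r] eigenvalues exceeded [t], their eigenvectors would span a space of dimension larger than
    the number [k] of equations, hence meet the kernel of [B] outside 0. *)
Lemma rth_eigenvalue_upper n k (A : 'M[C]_n) (B : 'M[C]_(k, n)) (t : R) (r : nat) :
  is_herm A -> (k < r <= n)%N ->
  (forall v, B *m v = 0 -> hform A v <= t * nrm2 v) ->
  rth_eigenvalue >=%R A r <= t.
Proof.
move=> /hermitian_spectral[e [E [pE nE fE]]] /andP[kr rn] h.
apply: nth_sort_ge_upper.
  by rewrite size_map size_eigenvalues rn andbT (leq_trans _ kr).
rewrite (permP pE) count_codomE.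
set S := [set _ | _]%SET; rewrite ltnNge; apply/negP => rS.
have [|v v0 /eqP] := kernel_nontrivial (col_mx B (ortho_mx E (~: S)%SET)).
  rewrite cardsCs finset.setCK card_ord.
  have Sn : (#|S| <= n)%N by rewrite -[leqRHS]card_ord max_card.
  by move: rS kr Sn; move: #|S| => q; lia.
rewrite mul_col_mx col_mx_eq0 => /andP[/eqP /h tv /eqP/ortho_mxP vS].
move: tv; rewrite leNgt => /negP; apply; rewrite nE fE mulr_sumr -subr_gt0 -sumrB.
have : 0 < \sum_i absq (dotc (E i) v) by rewrite -nE nrm2_gt0.
have pos i : 0 <= e i * absq (dotc (E i) v) - t * absq (dotc (E i) v).
  have [iS|iS] := boolP (i \in S); last first.
    by rewrite vS ?finset.in_setC// absq0 !mulr0 subr0.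
  move: iS; rewrite inE => /ltW ti.
  by rewrite -mulrBl mulr_ge0 ?absq_ge0// subr_ge0.
rewrite !lt0r !sumr_ge0 ?andbT => //[|i _]; last exact: absq_ge0.
rewrite !psumr_neq0 => [/hasP[i _ /= ai]|i _|i _]; rewrite ?absq_ge0//.
apply/hasP; exists i; first by rewrite mem_index_enum.
rewrite /= -mulrBl mulr_gt0// subr_gt0 ltNge; apply/negP => ti.
by move: ai; rewrite vS ?absq0 ?ltxx// finset.in_setC inE -leNgt.
Qed.

Lemma rth_eigenvalueN n (A : 'M[C]_n) r : is_herm A ->
  rth_eigenvalue <=%R A r = - rth_eigenvalue >=%R (- A) r.
Proof.
move=> hA.
have pN : perm_eq [seq complex.Re z | z <- eigenvalues (- A)]
                  [seq - a | a <- [seq complex.Re z | z <- eigenvalues A]].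
  suff : perm_eq (eigenvalues (- A)) [seq - a | a <- eigenvalues A].
    move=> /(perm_map (@complex.Re R))/perm_trans; apply.
    by rewrite -!map_comp; apply/permP => q; congr count; apply: eq_map => -[].
  apply: eigenvaluesP; rewrite big_map /eigenvalues.
  case: closed_field_poly_normal => s /= h.
  have sn : size s = n.
    have := congr1 (fun p : {poly C} => size p) h.
    rewrite size_char_poly (monicP (char_poly_monic A)) scale1r size_prod_XsubC.
    by move=> [].
  rewrite (monicP (char_poly_monic A)) scale1r in h.
  transitivity ((-1) ^+ n * (char_poly A \Po (- 'X))).
    rewrite /char_poly -det_map_mx -detZ; congr (\det _).
    apply/matrixP => i j; rewrite !mxE /= comp_polyB comp_polyC raddfMn/= comp_polyX.
    by rewrite polyCN mulN1r opprB opprK mulNrn opprK addrC.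
  rewrite h rmorph_prod -sn; elim: s {h sn} => [|a s IH].
    by rewrite !big_nil mulr1.
  rewrite !big_cons /= exprS mulrACA IH; congr (_ * _).
  by rewrite comp_polyB comp_polyC comp_polyX polyCN mulN1r opprB opprK opprK addrC.
rewrite /rth_eigenvalue -[in LHS](opprK (nth _ _ _)); congr (- _).
have -> : sort >=%R [seq complex.Re z | z <- eigenvalues (- A)] =
          [seq - a | a <- sort <=%R [seq complex.Re z | z <- eigenvalues A]].
  apply: (sorted_eq ge_trans ge_anti); first exact: sort_ge_sorted.
    rewrite sorted_map; apply: sub_sorted (sort_le_sorted _) => a b /=.
    by rewrite /Order.ge /= lerN2.
  rewrite perm_sort; apply: perm_trans pN _; apply: perm_map.
  by rewrite perm_sym perm_sort.
(* For a rank beyond the size both sides are the default 0, which negation preserves. *)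
have [rn|nr] := ltnP r.-1 (size (eigenvalues A)).
  by rewrite (nth_map 0)// size_sort size_map.
by rewrite !nth_default ?oppr0// ?size_map ?size_sort ?size_map.
Qed.

End minmax.

(** * Deterministic spiked matrices *)

Section inner_product.
Context {R : realType}.
Local Notation C := R[i].
Local Notation cRe := (@complex.Re R).

Lemma dotcC n (u v : 'cV[C]_n) : dotc v u = conjc (dotc u v).
Proof.
by rewrite /dotc rmorph_sum; apply: eq_bigr => j _ /=; rewrite rmorphM /= conjcK mulrC.
Qed.

Lemma dotcDr n (u v w : 'cV[C]_n) : dotc u (v + w) = dotc u v + dotc u w.
Proof. by rewrite -big_split; apply: eq_bigr => j _; rewrite mxE mulrDr. Qed.

Lemma dotcZr n (u v : 'cV[C]_n) a : dotc u (a *: v) = a * dotc u v.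
Proof. by rewrite mulr_sumr; apply: eq_bigr => j _; rewrite mxE mulrCA. Qed.

Lemma dotcBr n (u v w : 'cV[C]_n) : dotc u (v - w) = dotc u v - dotc u w.
Proof. by rewrite -sumrB; apply: eq_bigr => j _; rewrite !mxE mulrBr. Qed.

Lemma dotc0r n (u : 'cV[C]_n) : dotc u 0 = 0.
Proof. by rewrite /dotc big1// => j _; rewrite mxE mulr0. Qed.

Lemma dotc_sumr n (u : 'cV[C]_n) L (a : 'I_L -> C) (v : 'I_L -> 'cV[C]_n) :
  dotc u (\sum_l a l *: v l) = \sum_l a l * dotc u (v l).
Proof.
rewrite (big_morph _ (dotcDr u) (dotc0r u)).
by apply: eq_bigr => l _; rewrite dotcZr.
Qed.

Lemma dotc_suml n (u : 'cV[C]_n) L (a : 'I_L -> C) (v : 'I_L -> 'cV[C]_n) :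
  dotc (\sum_l a l *: v l) u = \sum_l conjc (a l) * dotc (v l) u.
Proof.
rewrite dotcC dotc_sumr rmorph_sum; apply: eq_bigr => l _ /=.
by rewrite rmorphM /= -dotcC.
Qed.

Lemma cReD (a b : C) : cRe (a + b) = cRe a + cRe b.
Proof. by case: a b => ? ? [? ?]. Qed.

Lemma Re_sum (I : finType) (f : I -> C) : cRe (\sum_l f l) = \sum_l cRe (f l).
Proof. exact: raddf_sum. Qed.

Lemma nrm2D n (u v : 'cV[C]_n) : nrm2 (u + v) = nrm2 u + nrm2 v + 2 * cRe (dotc u v).
Proof.
rewrite /nrm2 /dotc raddf_sum mulr_sumr -!big_split; apply: eq_bigr => j _ /=.
rewrite !mxE; case: (u j ord0) (v j ord0) => a b [c e].
by rewrite /absq /=; ring.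
Qed.

Lemma nrm2Z n (u : 'cV[C]_n) a : nrm2 (a *: u) = absq a * nrm2 u.
Proof. by rewrite mulr_sumr; apply: eq_bigr => j _; rewrite mxE absqM. Qed.

Lemma nrm2_eqRe n (u : 'cV[C]_n) : nrm2 u = cRe (dotc u u).
Proof. by rewrite -nrm2E. Qed.

Lemma cauchy_schwarz n (u v : 'cV[C]_n) : absq (dotc u v) <= nrm2 u * nrm2 v.
Proof.
have [->|u0] := eqVneq u 0.
  by rewrite dotcC dotc0r conjc0 absq0 mulr_ge0// nrm2_ge0.
set c := dotc u v; pose s := nrm2 u.
have s0 : 0 < s by rewrite nrm2_gt0.
have := nrm2_ge0 ((s%:C)%C *: v + (- c) *: u).
rewrite nrm2D !nrm2Z absqR absqN dotcZr dotcC dotcZr -/c -/s.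
rewrite (_ : cRe _ = - (s * absq c)); last first.
  by case: (c) => a b; rewrite /absq /=; ring.
rewrite (_ : _ + _ = s * (s * nrm2 v - absq c)); last by ring.
by rewrite pmulr_rge0// subr_ge0.
Qed.

Lemma absq_sum_le n (f g : 'I_n -> C) :
  absq (\sum_i f i * g i) <= (\sum_i absq (f i)) * (\sum_i absq (g i)).
Proof.
pose u : 'cV[C]_n := \col_i conjc (f i); pose v : 'cV[C]_n := \col_i g i.
have -> : \sum_i f i * g i = dotc u v.
  by apply: eq_bigr => i _; rewrite !mxE conjcK.
have -> : \sum_i absq (f i) = nrm2 u by apply: eq_bigr => i _; rewrite mxE absqJ.
have -> : \sum_i absq (g i) = nrm2 v by apply: eq_bigr => i _; rewrite mxE.
exact: cauchy_schwarz.
Qed.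

Lemma Re_le_absq (a b h : C) (e : R) : 0 <= e -> absq h <= e ^+ 2 ->
  `|cRe (conjc a * b * h)| <= e * (absq a + absq b) / 2.
Proof.
move=> e0 he; set z := conjc a * b * h.
have hz : cRe z ^+ 2 <= e ^+ 2 * (absq a * absq b).
  apply: (@le_trans _ _ (absq z)); first by rewrite lerDl sqr_ge0.
  by rewrite /z !absqM absqJ mulrC ler_wpM2r// mulr_ge0// absq_ge0.
have s0 : 0 <= e * (absq a + absq b) / 2.
  by rewrite divr_ge0// mulr_ge0// addr_ge0// absq_ge0.
rewrite -(@ler_pXn2r _ 2)// real_normK ?num_real//; apply: le_trans hz _.
have -> : (e * (absq a + absq b) / 2) ^+ 2 =
  e ^+ 2 * (absq a * absq b) + e ^+ 2 * ((absq a - absq b) / 2) ^+ 2 by field.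
by rewrite lerDl mulr_ge0// sqr_ge0.
Qed.

(** Convergence through real and imaginary parts gives access to the theory of real limits;
    [ccvg_cvg] returns to the topology of [R[i]]. *)
Definition ccvg (u : nat -> C) (z : C) :=
  (cRe (u n) @[n --> \oo] --> cRe z) /\ (complex.Im (u n) @[n --> \oo] --> complex.Im z).

Lemma ccvg_cst z : ccvg (fun=> z) z.
Proof. by split; exact: cvg_cst. Qed.

Lemma eq_ccvg u v z : u =1 v -> ccvg u z -> ccvg v z.
Proof. by move=> /funext ->. Qed.

Lemma ccvgD u v y z : ccvg u y -> ccvg v z -> ccvg (fun n => u n + v n) (y + z).
Proof.
move=> [u1 u2] [v1 v2]; split.
  rewrite cReD (_ : (fun n => _) = (fun n => cRe (u n) + cRe (v n))); last first.
    by apply/funext => n; rewrite cReD.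
  exact: cvgD.
rewrite (_ : (fun n => _) = (fun n => complex.Im (u n) + complex.Im (v n))); last first.
  by apply/funext => n; case: (u n) (v n) => ? ? [].
by rewrite (_ : complex.Im _ = complex.Im y + complex.Im z); [exact: cvgD|case: (y) (z) => ? ? []].
Qed.

Lemma ccvgM u v y z : ccvg u y -> ccvg v z -> ccvg (fun n => u n * v n) (y * z).
Proof.
move=> [u1 u2] [v1 v2]; split.
  rewrite (_ : (fun n => _) = (fun n => cRe (u n) * cRe (v n) -
      complex.Im (u n) * complex.Im (v n))); last first.
    by apply/funext => n; case: (u n) (v n) => ? ? [].
  rewrite (_ : cRe _ = cRe y * cRe z - complex.Im y * complex.Im z).
    by apply: cvgB; apply: cvgM.
  by case: (y) (z) => ? ? [].
rewrite (_ : (fun n => _) = (fun n => cRe (u n) * complex.Im (v n) +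
    complex.Im (u n) * cRe (v n))); last first.
  by apply/funext => n; case: (u n) (v n) => ? ? [].
rewrite (_ : complex.Im _ = cRe y * complex.Im z + complex.Im y * cRe z).
  by apply: cvgD; apply: cvgM.
by case: (y) (z) => ? ? [].
Qed.

Lemma ccvgJ u z : ccvg u z -> ccvg (fun n => conjc (u n)) (conjc z).
Proof.
move=> [u1 u2]; split.
  rewrite (_ : (fun n => _) = (fun n => cRe (u n))); last first.
    by apply/funext => n; case: (u n).
  by case: z u1 {u2}.
rewrite (_ : (fun n => _) = (fun n => - complex.Im (u n))); last first.
  by apply/funext => n; case: (u n).
by rewrite (_ : complex.Im _ = - complex.Im z); [exact: cvgN|case: (z)].
Qed.

Lemma ccvgR (u : nat -> R) (a : R) : u n @[n --> \oo] --> a ->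
  ccvg (fun n => ((u n)%:C)%C) (a%:C)%C.
Proof. by move=> ua; split => //=; exact: cvg_cst. Qed.

Lemma ccvgN u z : ccvg u z -> ccvg (fun n => - u n) (- z).
Proof.
move=> uz; rewrite -mulN1r; apply: eq_ccvg (ccvgM (ccvg_cst (-1)) uz) => n.
by rewrite mulN1r.
Qed.

Lemma ccvgB u v y z : ccvg u y -> ccvg v z -> ccvg (fun n => u n - v n) (y - z).
Proof. by move=> uy vz; apply: ccvgD uy (ccvgN vz). Qed.

Lemma ccvg_sum L (u : nat -> nat -> C) (z : nat -> C) :
  (forall l, (l < L)%N -> ccvg (u l) (z l)) ->
  ccvg (fun n => \sum_(l < L) u l n) (\sum_(l < L) z l).
Proof.
elim: L => [|L IH] h.
  by rewrite big_ord0; apply: eq_ccvg (ccvg_cst 0) => n; rewrite big_ord0.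
rewrite big_ord_recr; apply: eq_ccvg (ccvgD (IH _) (h L _)) => [n|l lL|] //.
  by rewrite big_ord_recr.
exact/h/leqW.
Qed.

Lemma ccvg_absq u z : ccvg u z -> absq (u n) @[n --> \oo] --> absq z.
Proof. by move=> [u1 u2]; apply: cvgD; apply: cvgM. Qed.

Lemma absq_ccvg u z : absq (u n - z) @[n --> \oo] --> (0 : R) -> ccvg u z.
Proof.
move=> h.
have sub (f : nat -> R) (a : R) : (forall n, (f n - a) ^+ 2 <= absq (u n - z)) ->
    f n @[n --> \oo] --> a.
  move=> le; apply/cvgrPdistC_le => e e0; near=> n.
  rewrite -(@ler_pXn2r _ 2)// ?nnegrE; last exact: ltW.
  rewrite real_normK ?num_real//; apply: le_trans (le n) _.
  near: n; move/cvgr_le: h => /(_ (e ^+ 2)); apply.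
  by rewrite exprn_gt0.
split; apply: sub => n; case: (u n) z {h} => a b [c e];
  by rewrite /absq /= ?lerDl ?lerDr sqr_ge0.
Unshelve. all: by end_near. Qed.

Lemma ccvg_cvg u (z : C) : ccvg u z -> u @ \oo --> z.
Proof.
move=> [u1 u2]; apply/cvgrPdist_le => e; rewrite ltcE /= => /andP[/eqP e2 e1].
(* A positive element of [R[i]] has zero imaginary part, so it is enough that each part come within
   half of its real part. *)
have e0 : 0 < cRe e / 2 by rewrite divr_gt0.
near=> n.
have h1 : `|cRe z - cRe (u n)| <= cRe e / 2.
  by near: n; move/cvgrPdist_le: u1; apply.
have h2 : `|complex.Im z - complex.Im (u n)| <= cRe e / 2.
  by near: n; move/cvgrPdist_le: u2; apply.
rewrite normc_def lecE /= e2 eqxx /=.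
rewrite -(@ler_pXn2r _ 2)// ?nnegrE ?sqrtr_ge0//; last exact: ltW.
rewrite sqr_sqrtr ?addr_ge0 ?sqr_ge0//.
have -> : cRe (z - u n) = cRe z - cRe (u n) by case: (z) (u n) => ? ? [].
have -> : complex.Im (z - u n) = complex.Im z - complex.Im (u n) by case: (z) (u n) => ? ? [].
rewrite -(@real_normK _ (cRe z - _)) ?num_real// -(@real_normK _ (complex.Im z - _)) ?num_real//.
apply: (@le_trans _ _ ((cRe e / 2) ^+ 2 + (cRe e / 2) ^+ 2)).
  by apply: lerD; rewrite ler_pXn2r// nnegrE// (ltW e0).
have := sqr_ge0 (cRe e); move: (cRe e) => a; nra.
Unshelve. all: by end_near. Qed.

End inner_product.

Section quadratic_forms.
Context {R : realType}.
Local Notation C := R[i].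
Local Notation cRe := (@complex.Re R).

Lemma cRe_real (r : R) (z : C) : cRe ((r%:C)%C * z) = r * cRe z.
Proof. by case: z => a b /=; ring. Qed.

Lemma conjc_scale (r : R) (z : C) : conjc ((r%:C)%C * z) = (r%:C)%C * conjc z.
Proof. by case: z => a b; simpc; congr (_ +i* _)%C; ring. Qed.

(** The size [L] is fixed, so entrywise convergence is uniform in the coefficients: 2 |c_a| |c_b| <=
    |c_a|^2 + |c_b|^2, and every entry is eventually within e / (L + 1) of its limit. The shift of
    [L] avoids a division by zero for an empty family. *)
Lemma quadratic_cvg L (h : 'I_L -> 'I_L -> nat -> C) (D : 'I_L -> 'I_L -> C) (e : R) :
  (forall a b, ccvg (h a b) (D a b)) -> 0 < e ->
  \forall n \near \oo, forall c : 'I_L -> C,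
    `|cRe (\sum_a \sum_b conjc (c a) * c b * (h a b n - D a b))| <=
    e * \sum_a absq (c a).
Proof.
move=> hD e0; have L0 : 0 < L.+1%:R :> R by rewrite ltr0n.
have d0 : 0 < e / L.+1%:R by rewrite divr_gt0.
have : \forall n \near \oo, forall ab : 'I_L * 'I_L,
    absq (h ab.1 ab.2 n - D ab.1 ab.2) <= (e / L.+1%:R) ^+ 2.
  apply: filter_forall => -[a b] /=.
  have /ccvg_absq := ccvgB (hD a b) (ccvg_cst (D a b)).
  rewrite subrr absq0 => /cvgr_le; apply; exact: exprn_gt0.
apply: filterS => n hn c; rewrite Re_sum.
apply: le_trans (ler_norm_sum _ _ _) _.
apply: (@le_trans _ _ (\sum_(a < L) \sum_(b < L)
    e / L.+1%:R * (absq (c a) + absq (c b)) / 2)).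
  apply: ler_sum => a _; rewrite Re_sum; apply: le_trans (ler_norm_sum _ _ _) _.
  by apply: ler_sum => b _; apply: Re_le_absq (hn (a, b)); exact: ltW.
under eq_bigr => a _ do rewrite -mulr_suml -mulr_sumr big_split /= sumr_const card_ord.
rewrite -mulr_suml -mulr_sumr big_split /= sumr_const card_ord sumrMnl.
rewrite -mulr2n; set S := \sum_(a < L) absq (c a).
have S0 : 0 <= S by apply: sumr_ge0 => a _; exact: absq_ge0.
rewrite -mulrnA -[S *+ _]mulr_natr natrM.
have -> : e / L.+1%:R * (S * (L%:R * 2%:R)) / 2 = e * S * (L%:R / L.+1%:R) by field; rewrite ?gt_eqF.
rewrite ler_piMr ?mulr_ge0//; first exact: ltW.
by rewrite ler_pdivrMr// mul1r ler_nat.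
Qed.

End quadratic_forms.

Section spikes.
Context {R : realType}.
Local Notation C := R[i].
Local Notation cRe := (@complex.Re R).
Context (m xi : nat -> nat -> C) (y : nat -> R).

Definition trunc_mx n : 'M[C]_n := \matrix_(j, k) m j k.
(** These vectors are sqrt n times the u_l of the overview: [gram] holds the inner products of the
    u_l, and [spike_sum] is n times the sum of the y_l u_l u_l^* applied to [v]. *)
Definition spike n l : 'cV[C]_n := \col_k xi l k.
Definition gram n a b : C := ((n%:R^-1)%:C)%C * dotc (spike n a) (spike n b).
Definition spike_sum n L (v : 'cV[C]_n) : 'cV[C]_n :=
  \sum_(l < L) (((y l)%:C)%C * dotc (spike n l) v) *: spike n l.

Context (m_herm : forall j k, m k j = conjc (m j k)).
Context (gram_cvg : forall a b, ccvg (fun n => gram n a b) ((a == b)%:R)).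
(** The number of spikes is fixed before [n] grows: [gram_cvg] controls only finitely many indices
    uniformly. *)
Context (op_small : forall e : R, 0 < e -> exists L0, forall L, (L0 <= L)%N ->
  \forall n \near \oo, forall v : 'cV[C]_n,
    nrm2 (trunc_mx n *m v - spike_sum L v) <= e ^+ 2 * n%:R ^+ 2 * nrm2 v).

Lemma trunc_mx_herm n : is_herm (trunc_mx n).
Proof. by move=> j k; rewrite !mxE. Qed.

Lemma dotc_spike n a b : (0 < n)%N -> dotc (spike n a) (spike n b) = (n%:R%:C)%C * gram n a b.
Proof.
move=> n0; rewrite /gram mulrA -rmorphM /= divff ?rmorph1 ?mul1r//.
by rewrite pnatr_eq0 -lt0n.
Qed.

Lemma gramC n a b : conjc (gram n a b) = gram n b a.
Proof. by rewrite /gram conjc_scale -dotcC. Qed.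

Lemma nrm2_comb n L (f : 'I_L -> nat) (c : 'I_L -> C) : (0 < n)%N ->
  nrm2 (\sum_a c a *: spike n (f a)) =
  n%:R * cRe (\sum_a \sum_b conjc (c a) * c b * gram n (f a) (f b)).
Proof.
move=> n0; rewrite nrm2_eqRe dotc_suml -cRe_real mulr_sumr; congr cRe.
apply: eq_bigr => a _; rewrite dotc_sumr !mulr_sumr; apply: eq_bigr => b _.
by rewrite dotc_spike//; ring.
Qed.

(** The Gram matrix of distinct spikes, divided by n, tends to the identity; injectivity of [f] is
    what makes this limit diagonal. *)
Lemma comb_cvg L (f : 'I_L -> nat) (e : R) : injective f -> 0 < e ->
  \forall n \near \oo, forall c : 'I_L -> C,
    `|nrm2 (\sum_a c a *: spike n (f a)) - n%:R * \sum_a absq (c a)| <=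
    e * n%:R * \sum_a absq (c a).
Proof.
move=> fi e0.
have := quadratic_cvg (fun a b => gram_cvg (f a) (f b)) e0.
apply: filter_app; near=> n => h c; rewrite nrm2_comb; last by near: n; exists 1%N.
rewrite -mulrBr normrM ger0_norm ?ler0n// -mulrA mulrCA ler_wpM2l//.
apply: le_trans (h c); rewrite le_eqVlt; apply/orP; left; apply/eqP; congr (`| _ |).
rewrite (_ : \sum_a absq (c a) = cRe (\sum_a \sum_b conjc (c a) * c b * ((f a == f b)%:R))).
  rewrite -raddfB -sumrB; congr cRe; apply: eq_bigr => a _.
  by rewrite -sumrB; apply: eq_bigr => b _; rewrite mulrBr.
rewrite Re_sum; apply: eq_bigr => a _.
rewrite (bigD1 a)//= big1 ?addr0 ?eqxx ?mulr1 => [|b ba]; first by rewrite -absqE.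
by rewrite (inj_eq fi) eq_sym (negbTE ba) mulr0.
Unshelve. all: by end_near. Qed.

(** Classical proof: the squared norm of v minus its approximate projection is nonnegative, the norm
    of the projection being known up to the error of [comb_cvg]. *)
Lemma bessel L (e : R) : 0 < e -> \forall n \near \oo, forall v : 'cV[C]_n,
  \sum_(l < L) absq (dotc (spike n l) v) <= (1 + e) * n%:R * nrm2 v.
Proof.
(* With d = e / (1 + e), the expansion leaves 1 - d times the sum of squares, and 1 - d is the
   inverse of 1 + e. *)
move=> e0; have d0 : 0 < e / (1 + e) by rewrite divr_gt0// addr_gt0.
have := comb_cvg (f := fun l : 'I_L => val l) val_inj d0.
apply: filter_app; near=> n => h v.
have n0 : 0 < n%:R :> R by rewrite ltr0n; near: n; exists 1%N.
pose c (l : 'I_L) : C := ((n%:R^-1)%:C)%C * dotc (spike n l) v.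
have := h c; set s := \sum_a _ *: _; set S := \sum_a absq (c a).
have -> : \sum_(l < L) absq (dotc (spike n l) v) = n%:R ^+ 2 * S.
  rewrite mulr_sumr; apply: eq_bigr => l _; rewrite absqM absqR.
  by rewrite exprVn mulVKf// expf_neq0// gt_eqF.
rewrite ler_norml => /andP[_ hs].
have := nrm2_ge0 (v + (-1) *: s).
rewrite nrm2D nrm2Z dotcZr dotc_sumr.
have -> : absq (-1 : C) = 1 by rewrite /absq /=; ring.
rewrite mulN1r mul1r.
have -> : cRe (- \sum_(l < L) c l * dotc v (spike n l)) = - (n%:R * S).
  rewrite raddfN /= Re_sum mulr_sumr; congr (- _); apply: eq_bigr => l _.
  rewrite (_ : dotc v _ = (n%:R%:C)%C * conjc (c l)).
    by case: (c l) => a b; rewrite /absq /=; ring.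
  by rewrite dotcC /c conjc_scale mulrA -rmorphM /= divff ?gt_eqF// mul1r.
move: (nrm2 v) (nrm2 s) hs => a b hs ab.
have hS : n%:R * S <= (1 + e) * a.
  have e1 : 0 < 1 + e by rewrite addr_gt0.
  have : b <= (1 + e / (1 + e)) * (n%:R * S) by lra.
  have -> : 1 + e / (1 + e) = 2 - (1 + e)^-1 by field; rewrite gt_eqF.
  move=> hb; have : (1 + e)^-1 * (n%:R * S) <= a by lra.
  by rewrite [(1 + e)^-1 * _]mulrC ler_pdivrMr// [a * _]mulrC.
by rewrite expr2 -mulrA (mulrC (1 + e)) -mulrA ler_wpM2l// ltW.
Unshelve. all: by end_near. Qed.

Lemma hform_spike_sum n L (v : 'cV[C]_n) :
  cRe (dotc v (spike_sum L v)) = \sum_(l < L) y l * absq (dotc (spike n l) v).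
Proof.
rewrite dotc_sumr Re_sum; apply: eq_bigr => l _.
rewrite -mulrA cRe_real (dotcC (spike n l)); congr (_ * _).
by rewrite mulrC -absqE.
Qed.

Lemma hform_approx (e : R) : 0 < e -> exists L0, forall L, (L0 <= L)%N ->
  \forall n \near \oo, forall v : 'cV[C]_n,
    `|hform (trunc_mx n) v - \sum_(l < L) y l * absq (dotc (spike n l) v)| <=
    e * n%:R * nrm2 v.
Proof.
move=> e0; have [L0 h] := op_small e0; exists L0 => L /h; apply: filterS => n hn v.
rewrite -hform_spike_sum /hform -raddfB.
set w := trunc_mx n *m v - spike_sum L v in hn.
rewrite -dotcBr.
have b0 : 0 <= e * n%:R * nrm2 v by rewrite !mulr_ge0 ?nrm2_ge0 ?ler0n// ltW.
rewrite -(@ler_pXn2r _ 2)// real_normK ?num_real//.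
apply: (@le_trans _ _ (absq (dotc v (trunc_mx n *m v - spike_sum L v)))).
  by rewrite lerDl sqr_ge0.
apply: le_trans (cauchy_schwarz _ _) _.
rewrite (_ : _ ^+ 2 = nrm2 v * (e ^+ 2 * n%:R ^+ 2 * nrm2 v)); last by ring.
by rewrite ler_wpM2l ?nrm2_ge0.
Qed.

End spikes.

(** * Eigenvalues of deterministic spiked matrices *)

Section spiked_eigenvalues.
Context {R : realType}.
Local Notation C := R[i].
Local Notation cRe := (@complex.Re R).
Context (m xi : nat -> nat -> C) (y : nat -> R).
Local Notation trunc_mx := (trunc_mx m).
Local Notation spike := (spike xi).
Local Notation gram := (gram xi).
Local Notation spike_sum := (spike_sum xi y).
Context (m_herm : forall j k, m k j = conjc (m j k)).
Context (gram_cvg : forall a b, ccvg (fun n => gram n a b) ((a == b)%:R)).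
Context (op_small : forall e : R, 0 < e -> exists L0, forall L, (L0 <= L)%N ->
  \forall n \near \oo, forall v : 'cV[C]_n,
    nrm2 (trunc_mx n *m v - spike_sum L v) <= e ^+ 2 * n%:R ^+ 2 * nrm2 v).
Local Notation eigen r n := (rth_eigenvalue >=%R (trunc_mx n) r).

(** On the orthogonal complement of the spikes of [s], fewer than [r], the remaining weights are at
    most [t], and Bessel's inequality bounds the form. *)
Lemma eigen_upper (r : nat) (t e : R) (s : seq nat) :
  (size s < r)%N -> (forall l, t < y l -> l \in s) -> 0 < t -> 0 < e ->
  \forall n \near \oo, eigen r n / n%:R <= t + e.
Proof.
move=> sr ys t0 e0; have e20 : 0 < e / 2 by rewrite divr_gt0.
have [L0 /(_ L0 (leqnn _)) hf] := hform_approx op_small e20.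
(* Bessel's factor 1 + e / (2 t), multiplied by [t], costs e / 2; the approximation of the form
   costs the other half. *)
have et0 : 0 < e / 2 / t by rewrite divr_gt0.
have hb := bessel gram_cvg L0 et0.
apply: filter_app hb; apply: filter_app hf; near=> n => hf hb.
have n0 : 0 < n%:R :> R by rewrite ltr0n; near: n; exists 1%N.
rewrite ler_pdivrMr//.
pose B : 'M[C]_(size s, n) := \matrix_(a, k) conjc (xi (nth 0%N s a) k).
apply: (rth_eigenvalue_upper (B := B)); first exact: trunc_mx_herm.
  by rewrite sr; near: n; exists r.
move=> v Bv.
have dv l : l \in s -> dotc (spike n l) v = 0.
  rewrite -index_mem => ls; move/matrixP/(_ (Ordinal ls) ord0): Bv.
  rewrite !mxE /= => <-; apply: eq_bigr => k _.
  by rewrite !mxE /= nth_index// -index_mem.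
have hv := hf v; have bv := hb v.
have yv : \sum_(l < L0) y l * absq (dotc (spike n l) v) <=
    t * \sum_(l < L0) absq (dotc (spike n l) v).
  rewrite mulr_sumr; apply: ler_sum => l _.
  have [ls|ls] := boolP (val l \in s); first by rewrite dv// absq0 !mulr0.
  rewrite ler_wpM2r ?absq_ge0// leNgt; apply: contra ls; exact: ys.
have tb : t * \sum_(l < L0) absq (dotc (spike n l) v) <= (t + e / 2) * n%:R * nrm2 v.
  apply: (@le_trans _ _ (t * ((1 + e / 2 / t) * n%:R * nrm2 v))).
    by rewrite ler_wpM2l// ltW.
  by rewrite le_eqVlt; apply/orP; left; apply/eqP; field; rewrite gt_eqF.
move: hv; rewrite ler_norml => /andP[_ hv]; lra.
Unshelve. all: by end_near. Qed.

(** The approximating form vanishes on the orthogonal complement of the first [L0] spikes, whose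
    codimension stays bounded while n grows: there is room for [r] eigenvalues. *)
Lemma eigen_lower0 (r : nat) (e : R) : (0 < r)%N -> 0 < e ->
  \forall n \near \oo, - e <= eigen r n / n%:R.
Proof.
move=> r0 e0.
have [L0 /(_ L0 (leqnn _)) hf] := hform_approx op_small e0.
apply: filter_app hf; near=> n => hf.
have n0 : 0 < n%:R :> R by rewrite ltr0n; near: n; exists 1%N.
rewrite ler_pdivlMr//.
pose B : 'M[C]_(L0, n) := \matrix_(a, k) conjc (xi a k).
apply: (rth_eigenvalue_lower (U := 1%:M) (B := B)) => //.
- exact: trunc_mx_herm.
- by near: n; exists (L0 + r)%N.
move=> v v0 Bv; rewrite !mul1mx; split => //.
have dv (l : 'I_L0) : dotc (spike n l) v = 0.
  move/matrixP/(_ l ord0): Bv; rewrite !mxE => <-; apply: eq_bigr => k _.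
  by rewrite !mxE.
have := hf v; rewrite big1 => [|l _]; last by rewrite dv absq0 mulr0.
by rewrite subr0 ler_norml => /andP[hv _]; lra.
Unshelve. all: by end_near. Qed.

(** The test space is the span of the spikes in [s]. On it the form is close to n^2 times the
    quadratic form of [h], the compression of the sum of the y_l u_l u_l^* to this span, which tends
    to a diagonal matrix with entries at least [t]. *)
Lemma eigen_lower (t e : R) (s : seq nat) : (0 < size s)%N -> uniq s ->
  (forall l, l \in s -> t <= y l) -> 0 < t -> 0 < e ->
  \forall n \near \oo, t - e <= eigen (size s) n / n%:R.
Proof.
move=> s0 us ys t0 e0.
(* [d < 1] makes [U] injective, [d < t] keeps t - d positive, and the last bound serves through (t -
   d) / (1 + d) >= t - d (1 + t). *)
pose d := Num.min (1 / 2) (Num.min (t / 2) (e / 2 / (1 + t))).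
have t1 : 0 < 1 + t by rewrite addr_gt0.
have d0 : 0 < d by rewrite !lt_min !divr_gt0.
have d1 : d < 1 by rewrite gt_min ltr_pdivrMr// mul1r ltr1n.
have dt : d < t.
  by rewrite !gt_min; apply/orP; right; apply/orP; left; lra.
have de : d * (1 + t) <= e / 2.
  by rewrite -ler_pdivlMr// !ge_min lexx !orbT.
pose f (a : 'I_(size s)) := nth 0%N s a.
have fi : injective f.
  by move=> a b /eqP; rewrite nth_uniq// => /eqP/val_inj.
have e20 : 0 < e / 2 by rewrite divr_gt0.
have [L0 hL] := hform_approx op_small e20.
(* [L] must also exceed every index in [s], otherwise the weight of such a spike would be missing
   from the truncated sum. *)
pose L := maxn L0 (\max_(l <- s) l.+1).
have fL a : (f a < L)%N.
  by rewrite /L leq_max; apply/orP; right; apply: leq_bigmax_seq => //; exact: mem_nth.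
have {hL} hf := hL L (leq_maxl _ _).
have hc := comb_cvg gram_cvg fi d0.
pose h a b n := \sum_(l < L) ((y l)%:C)%C * (gram n (f a) l * gram n l (f b)).
pose D a b : C := ((y (f a))%:C)%C * (f a == f b)%:R.
have hD a b : ccvg (h a b) (D a b).
  have -> : D a b = \sum_(l < L) ((y l)%:C)%C * ((f a == l)%:R * (l == f b :> nat)%:R).
    rewrite (bigD1 (Ordinal (fL a)))//= eqxx mul1r big1 ?addr0// => l.
    by rewrite -val_eqE /= eq_sym => /negbTE ->; rewrite mul0r mulr0.
  pose z l : C := ((y l)%:C)%C * ((f a == l)%:R * (l == f b)%:R).
  pose u l n := ((y l)%:C)%C * (gram n (f a) l * gram n l (f b)).
  apply: (@ccvg_sum _ L u z) => l _; apply: ccvgM; first exact: ccvg_cst.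
  by apply: ccvgM; exact: gram_cvg.
have hq := quadratic_cvg hD d0.
apply: filter_app hq; apply: filter_app hc; apply: filter_app hf.
near=> n => hf hc hq.
have n0 : (0 < n)%N by near: n; exists 1%N.
have n0R : 0 < n%:R :> R by rewrite ltr0n.
rewrite ler_pdivlMr//.
pose U : 'M[C]_(n, size s) := \matrix_(k, a) xi (f a) k.
apply: (rth_eigenvalue_lower (U := U) (B := (0 : 'M[C]_(0, size s)))) => //.
  exact: trunc_mx_herm.
move=> c c0 _.
have -> : U *m c = \sum_a c a ord0 *: spike n (f a).
  apply/colP => k; rewrite mxE summxE; apply: eq_bigr => a _.
  by rewrite !mxE mulrC.
pose c' a := c a ord0.
have hn := hc c'; have qn := hq c'.
rewrite -/c'; set v := \sum_a _ *: _ in hn *.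
have hv := hf v.
set S := \sum_a absq (c' a) in hn qn.
have S0 : 0 < S by rewrite (_ : S = nrm2 c)// nrm2_gt0.
have nS : 0 < n%:R * S by rewrite mulr_gt0.
move: hn; rewrite ler_norml => /andP[hn1 hn2].
have v0 : 0 < nrm2 v.
  have : (1 - d) * (n%:R * S) <= nrm2 v by lra.
  by apply: lt_le_trans; rewrite mulr_gt0// subr_gt0.
split; first by rewrite -nrm2_gt0.
have sumE : \sum_(l < L) y l * absq (dotc (spike n l) v) =
    n%:R ^+ 2 * cRe (\sum_a \sum_b conjc (c' a) * c' b * h a b n).
  rewrite -cRe_real -(Re_sum (fun l : 'I_L => ((y l * absq (dotc (spike n l) v))%:C)%C)).
  have dl l : dotc (spike n l) v = (n%:R%:C)%C * \sum_b c' b * gram n l (f b).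
    rewrite dotc_sumr mulr_sumr; apply: eq_bigr => b _.
    by rewrite dotc_spike// mulrCA.
  have dlc l : conjc (dotc (spike n l) v) =
      (n%:R%:C)%C * \sum_a conjc (c' a) * gram n (f a) l.
    rewrite dl conjc_scale rmorph_sum; congr (_ * _); apply: eq_bigr => a _ /=.
    by rewrite rmorphM /= gramC.
  congr cRe; rewrite mulr_sumr.
  transitivity (\sum_(l < L) \sum_a \sum_b ((n%:R ^+ 2)%:C)%C *
      (conjc (c' a) * c' b * (((y l)%:C)%C * (gram n (f a) l * gram n l (f b))))).
    apply: eq_bigr => l _; rewrite rmorphM /= absqE dlc dl mulrACA big_distrlr /=.
    rewrite !mulr_sumr; apply: eq_bigr => a _; rewrite !mulr_sumr; apply: eq_bigr => b _.
    by rewrite rmorphXn /=; ring.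
  rewrite exchange_big; apply: eq_bigr => a _; rewrite exchange_big mulr_sumr.
  by apply: eq_bigr => b _; rewrite !mulr_sumr.
have DE : cRe (\sum_a \sum_b conjc (c' a) * c' b * D a b) = \sum_a y (f a) * absq (c' a).
  rewrite Re_sum; apply: eq_bigr => a _.
  rewrite (bigD1 a)//= big1 ?addr0 => [|b ba].
    by rewrite /D eqxx mulr1 mulrC cRe_real -absqE.
  by rewrite /D (inj_eq fi) eq_sym (negbTE ba) !mulr0.
have yS : t * S <= \sum_a y (f a) * absq (c' a).
  rewrite mulr_sumr; apply: ler_sum => a _.
  by rewrite ler_wpM2r ?absq_ge0// ys// mem_nth.
have low : (t - d) * S <= cRe (\sum_a \sum_b conjc (c' a) * c' b * h a b n).
  move: qn; have -> : \sum_a \sum_b conjc (c' a) * c' b * (h a b n - D a b) =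
     (\sum_a \sum_b conjc (c' a) * c' b * h a b n) - \sum_a \sum_b conjc (c' a) * c' b * D a b.
    rewrite -sumrB; apply: eq_bigr => a _; rewrite -sumrB; apply: eq_bigr => b _.
    by rewrite mulrBr.
  by rewrite raddfB /= DE ler_norml => /andP[+ _]; lra.
move: hv; rewrite sumE ler_norml => /andP[hv _].
have hS : n%:R * S >= nrm2 v / (1 + d).
  by rewrite ler_pdivrMr ?addr_gt0//; lra.
have : n%:R ^+ 2 * ((t - d) * S) >= (t - d) / (1 + d) * (n%:R * nrm2 v).
  have -> : n%:R ^+ 2 * ((t - d) * S) = ((t - d) * n%:R) * (n%:R * S) by ring.
  have -> : (t - d) / (1 + d) * (n%:R * nrm2 v) = ((t - d) * n%:R) * (nrm2 v / (1 + d)).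
    by field; rewrite gt_eqF// addr_gt0.
  by rewrite ler_wpM2l// mulr_ge0 ?ler0n// subr_ge0 ltW.
have : (t - d) / (1 + d) >= t - d * (1 + t).
  rewrite ler_pdivlMr ?addr_gt0// -subr_ge0.
  have -> : t - d - (t - d * (1 + t)) * (1 + d) = d ^+ 2 * (1 + t) by ring.
  by rewrite mulr_ge0 ?sqr_ge0// ltW.
move=> h1 h2.
have h3 : (t - e / 2) * (n%:R * nrm2 v) <= (t - d) / (1 + d) * (n%:R * nrm2 v).
  by rewrite ler_wpM2r ?mulr_ge0 ?ler0n ?(ltW v0)//; lra.
have h4 : n%:R ^+ 2 * ((t - d) * S) <=
  n%:R ^+ 2 * cRe (\sum_a \sum_b conjc (c' a) * c' b * h a b n).
  by rewrite ler_wpM2l// sqr_ge0.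
lra.
Unshelve. all: by end_near. Qed.

End spiked_eigenvalues.

(** * Quotients and moduli of complex limits *)

Section complex_limits.
Context {R : realType}.
Local Notation C := R[i].
Local Notation cRe := (@complex.Re R).

Lemma near_eq_ccvg (u v : nat -> C) (z : C) :
  (\forall n \near \oo, u n = v n) -> ccvg u z -> ccvg v z.
Proof.
move=> uv [u1 u2]; split.
  by apply: cvg_trans u1; apply: near_eq_cvg; apply: filterS uv => n ->.
by apply: cvg_trans u2; apply: near_eq_cvg; apply: filterS uv => n ->.
Qed.

Lemma invcE (z : C) : z^-1 = (((absq z)^-1)%:C)%C * conjc z.
Proof.
have [->|z0] := eqVneq z 0; first by rewrite conjc0 invr0 mulr0.
apply: (mulIf z0); rewrite mulVf// -mulrA -absqE -rmorphM /= mulVf ?absq_eq0//.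
Qed.

Lemma ccvgV (u : nat -> C) z : z != 0 -> ccvg u z -> ccvg (fun n => (u n)^-1) z^-1.
Proof.
move=> z0 uz; rewrite invcE; apply: eq_ccvg (fun n => esym (invcE (u n))) _.
apply: ccvgM (ccvgJ uz); apply: ccvgR; apply: cvgV; last exact: ccvg_absq.
by rewrite absq_eq0.
Qed.

Lemma ccvg_neq0 (u : nat -> C) z : z != 0 -> ccvg u z -> \forall n \near \oo, u n != 0.
Proof.
rewrite -absq_eq0 => z0 /ccvg_absq /cvgr_gt /(_ 0).
rewrite lt0r z0 absq_ge0 => /(_ isT); apply: filterS => n.
by rewrite -absq_eq0 => /gt_eqF ->.
Qed.

Lemma ccvg_divr (u w : nat -> C) z y : y != 0 -> ccvg w y ->
  ccvg (fun n => u n * w n) z -> ccvg u (z / y).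
Proof.
move=> y0 wy uz; apply: near_eq_ccvg (ccvgM uz (ccvgV y0 wy)).
by apply: filterS (ccvg_neq0 y0 wy) => n wn; rewrite mulfK.
Qed.

(** Expand |u|^2 - |v|^2 as |u - v|^2 plus twice the real part of (u - v) times the conjugate of v.
    Only the modulus of [v] is assumed to converge, because the phase of the eigenvector is still
    unknown where this serves. *)
Lemma cvg_absq_sub (u v : nat -> C) (s : R) : ccvg (fun n => u n - v n) 0 ->
  absq (v n) @[n --> \oo] --> s -> absq (u n) @[n --> \oo] --> s.
Proof.
move=> uv vs; pose D n := u n - v n.
have DE n : absq (u n) - absq (v n) = absq (D n) + 2 * cRe (D n * conjc (v n)).
  by rewrite /D; case: (u n) (v n) => a b [c e]; rewrite /absq /=; ring.
have D0 : absq (D n) @[n --> \oo] --> (0 : R) by rewrite -absq0; exact: ccvg_absq.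
suff h : absq (D n) + 2 * cRe (D n * conjc (v n)) @[n --> \oo] --> (0 : R).
  rewrite -(addr0 s) (_ : (fun n => _) = (fun n => absq (v n) + (absq (u n) - absq (v n)))).
    by apply: cvgD => //; under eq_fun do rewrite DE.
  by apply/funext => n; rewrite addrC subrK.
rewrite -(addr0 (0 : R)); apply: cvgD => //.
suff h : cRe (D n * conjc (v n)) @[n --> \oo] --> (0 : R).
  by rewrite -(mulr0 2); apply: cvgM => //; exact: cvg_cst.
have sq n : `|cRe (D n * conjc (v n))| <= Num.sqrt (absq (D n) * absq (v n)).
  rewrite -(@ler_pXn2r _ 2)// ?nnegrE ?sqrtr_ge0// sqr_sqrtr ?mulr_ge0 ?absq_ge0//.
  rewrite real_normK ?num_real// -(absqJ (v n)) -absqM.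
  by rewrite /absq lerDl sqr_ge0.
have h0 : Num.sqrt (absq (D n) * absq (v n)) @[n --> \oo] --> (0 : R).
  rewrite -(sqrtr0 R) -(mul0r s); apply: (cvg_comp _ Num.sqrt (cvgM D0 vs)).
  exact: sqrt_continuous.
apply: norm_cvg0; apply: (squeeze_cvgr _ (cvg_cst 0) h0).
by apply: nearW => n; rewrite normr_ge0 sq.
Qed.
End complex_limits.

(** * Eigenvectors of deterministic spiked matrices *)

Section spiked_eigenvectors.
Context {R : realType}.
Local Notation C := R[i].
Local Notation cRe := (@complex.Re R).
Context (m xi : nat -> nat -> C) (y : nat -> R).
Local Notation trunc_mx := (trunc_mx m).
Local Notation spike := (spike xi).
Local Notation gram := (gram xi).
Local Notation spike_sum := (spike_sum xi y).
Context (gram_cvg : forall a b, ccvg (fun n => gram n a b) ((a == b)%:R)).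
Context (op_small : forall e : R, 0 < e -> exists L0, forall L, (L0 <= L)%N ->
  \forall n \near \oo, forall v : 'cV[C]_n,
    nrm2 (trunc_mx n *m v - spike_sum L v) <= e ^+ 2 * n%:R ^+ 2 * nrm2 v).
Context (row_bounded : forall a, exists B : R, \forall n \near \oo,
  \sum_(k < n) absq (m a k) <= B * n%:R).
Context (l : nat).
Context (row_cvg : forall a,
  ccvg (fun n => ((n%:R^-1)%:C)%C * \sum_(k < n) m a k * xi l k)
       (((y l)%:C)%C * xi l a)).
Context (xi0 : xi l 0%N != 0) (yl0 : y l != 0).
Context (yl_single : forall l', y l' = y l -> l' = l).
Context (y_cvg0 : y n @[n --> \oo] --> (0 : R)).
Context (lam : nat -> R) (V : forall n, 'cV[C]_n).
Context (lam_cvg : lam n / n%:R @[n --> \oo] --> y l).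
Context (V_eigen : \forall n \near \oo, trunc_mx n *m V n = ((lam n)%:C)%C *: V n).
Context (V_norm : \forall n \near \oo, nrm2 (V n) = n%:R).
Context (V_phase : \forall n \near \oo, forall i : 'I_n, V n i ord0 != 0 ->
  (forall j : 'I_n, (j < i)%N -> V n j ord0 = 0) -> 0 < V n i ord0).

(** Inner product of u_l with V_n / sqrt n: the approximate constant c of the overview. *)
Let coef n : C := ((n%:R^-1)%:C)%C * dotc (spike n l) (V n).

(** All but finitely many weights lie within |y_l| / 2 of 0, and simplicity separates y_l from the
    others. The distance to 0 matters too, for the part of the eigenvector orthogonal to all the
    spikes retained. *)
Lemma spectral_gap : exists2 g : R, 0 < g &
  g <= `|y l| /\ forall l', l' != l -> g <= `|y l - y l'|.
Proof.
have yl2 : 0 < `|y l| / 2 by rewrite divr_gt0// normr_gt0.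
have [N _ hN] : \forall n \near \oo, `|y n| <= `|y l| / 2.
  by move/cvgr0Pnorm_le: y_cvg0; apply.
have [g g0 hg] : exists2 g : R, 0 < g & forall l', (l' < N)%N -> l' != l -> g <= `|y l - y l'|.
  elim: (N) => [|k [g g0 hg]]; first by exists 1.
  have [kl|kl] := eqVneq k l.
    exists g => // l'; rewrite ltnS leq_eqVlt => /orP[/eqP -> |]; last exact: hg.
    by rewrite kl eqxx.
  exists (Num.min g `|y l - y k|).
    rewrite lt_min g0 normr_gt0 subr_eq0; apply/eqP => h.
    by move/eqP: kl; apply; apply: yl_single.
  move=> l'; rewrite ltnS leq_eqVlt => /orP[/eqP -> _|l'k l'l].
    by rewrite ge_min lexx orbT.
  by rewrite ge_min hg.
exists (Num.min g (`|y l| / 2)); first by rewrite lt_min g0.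
split; first by rewrite ge_min; apply/orP; right; lra.
move=> l' l'l; have [l'N|Nl'] := ltnP l' N; first by rewrite ge_min hg.
rewrite ge_min; apply/orP; right; have := hN l' Nl'.
by have := ler_distD (y l') (y l) 0; rewrite !subr0; lra.
Qed.

Lemma coef_upper (e : R) : 0 < e -> \forall n \near \oo, absq (coef n) <= 1 + e.
Proof.
move=> e0; have := bessel gram_cvg l.+1 e0.
apply: filter_app; move: V_norm; apply: filter_app; near=> n => vn hb.
have n0 : 0 < n%:R :> R by rewrite ltr0n; near: n; exists 1%N.
move/(_ (V n)): hb; rewrite vn big_ord_recr /= => hb.
rewrite absqM absqR -(@ler_pM2l _ (n%:R ^+ 2)) ?exprn_gt0// exprVn mulVKf ?expf_neq0 ?gt_eqF//.
apply: le_trans (le_trans hb _); first by rewrite lerDr sumr_ge0// => i _; exact: absq_ge0.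
by rewrite le_eqVlt; apply/orP; left; apply/eqP; ring.
Unshelve. all: by end_near. Qed.

(* The squared norm of [(mu - sum_l y_l u_l u_l^* ) v] is at least
   [mu^2 (1 - sum p) + sum (mu - y)^2 p] up to the Gram error. *)
Lemma coef_lower_alg L (p : 'I_L -> R) (z : 'I_L -> R) (mu g d e K : R) (l0 : 'I_L) :
  (forall a, 0 <= p a) -> 0 <= d <= 1 -> (forall a, `|z a| <= K) -> 0 <= K -> 0 <= g ->
  `|mu| <= K + 1 -> g <= `|mu| -> (forall a, a != l0 -> g <= `|mu - z a|) ->
  \sum_a p a <= 1 + d ->
  mu ^+ 2 + (1 - d) * (\sum_a z a ^+ 2 * p a) - 2 * mu * (\sum_a z a * p a) <= e ->
  g ^+ 2 * (1 - p l0) <= e + 3 * d * (K + 1) ^+ 2.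
Proof.
move=> p0 /andP[d0 d1] zK K0 g0 muK gmu gz pd h.
set S := \sum_a p a in pd.
have S0 : 0 <= S by apply: sumr_ge0.
have sqr_norm (a b : R) : 0 <= a -> a <= `|b| -> a ^+ 2 <= b ^+ 2.
  by move=> a0 ab; rewrite -(real_normK (num_real b)) ler_pXn2r// nnegrE.
have mu2 : mu ^+ 2 <= (K + 1) ^+ 2.
  by rewrite -(real_normK (num_real mu)) ler_pXn2r// nnegrE addr_ge0.
have z2 a : z a ^+ 2 <= (K + 1) ^+ 2.
  rewrite -(real_normK (num_real (z a))) ler_pXn2r// ?nnegrE ?addr_ge0//.
  by apply: le_trans (zK a) _; rewrite lerDl.
have hz : \sum_a z a ^+ 2 * p a <= (K + 1) ^+ 2 * S.
  by rewrite mulr_sumr; apply: ler_sum => a _; rewrite ler_wpM2r.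
have E : mu ^+ 2 * (1 - S) + \sum_a (mu - z a) ^+ 2 * p a =
    mu ^+ 2 + (\sum_a z a ^+ 2 * p a) - 2 * mu * (\sum_a z a * p a).
  rewrite (eq_bigr (fun a => mu ^+ 2 * p a + (z a ^+ 2 * p a - 2 * mu * (z a * p a)))).
    by rewrite big_split /= sumrB -!mulr_sumr -/S; ring.
  by move=> a _; ring.
have hS : d * (\sum_a z a ^+ 2 * p a) <= d * ((K + 1) ^+ 2 * 2).
  rewrite ler_wpM2l//; apply: le_trans hz _; rewrite ler_wpM2l ?sqr_ge0//; lra.
have hE : mu ^+ 2 * (1 - S) + \sum_a (mu - z a) ^+ 2 * p a <= e + 2 * d * (K + 1) ^+ 2.
  rewrite E; lra.
have Sl : S = p l0 + \sum_(a | a != l0) p a by rewrite /S (bigD1 l0).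
have g1 : g ^+ 2 * (\sum_(a | a != l0) p a) <= \sum_a (mu - z a) ^+ 2 * p a.
  rewrite [leRHS](bigD1 l0)//=; apply: ler_wpDl; first by rewrite mulr_ge0 ?sqr_ge0.
  rewrite mulr_sumr.
  by apply: ler_sum => a al; rewrite ler_wpM2r// sqr_norm// gz.
(* [1 - S] may be negative, but is at least - d; the term mu^2 d compensates for it. *)
have g2 : g ^+ 2 * (1 - S) <= mu ^+ 2 * (1 - S) + mu ^+ 2 * d.
  have gm : g ^+ 2 <= mu ^+ 2 by exact: sqr_norm.
  have g20 := sqr_ge0 g.
  have [S1|S1] := leP S 1; first by nra.
  nra.
have g3 : mu ^+ 2 * d <= (K + 1) ^+ 2 * d by rewrite ler_wpM2r.
have -> : g ^+ 2 * (1 - p l0) = g ^+ 2 * (1 - S) + g ^+ 2 * (\sum_(a | a != l0) p a).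
  by rewrite Sl; ring.
lra.
Qed.

(** For an eigenvector of eigenvalue n mu, the approximation makes mu v minus the sum of the y_a u_a
    u_a^* v small. The mass of v away from u_l is multiplied there by at least the spectral gap,
    hence is small. *)
Lemma coef_lower (e : R) : 0 < e -> \forall n \near \oo, 1 - absq (coef n) <= e.
Proof.
move=> e0; have [g g0 [gl gy]] := spectral_gap.
have [K K0 yK] : exists2 K : R, 0 <= K & forall k, `|y k| <= K.
  have /cvg_seq_bounded[K [Kr hK]] : cvgn y by apply/cvg_ex; exists 0.
  exists (`|K| + 1); first by rewrite addr_ge0.
  by move=> k; apply: hK => //; apply: le_lt_trans (ler_norm K) _; rewrite ltrDl.
(* Half of the gap, since mu is only known to lie within g / 2 of y_l. *)
pose g2 := g / 2; have g20 : 0 < g2 by rewrite divr_gt0.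
have K10 : 0 < K + 1 by rewrite ltr_wpDl.
(* The two errors in [coef_lower_alg], eps^2 and 3 d (K + 1)^2, are each allowed half of g2^2 e. *)
pose d := Num.min 1 (g2 ^+ 2 * (e / 2) / (3 * (K + 1) ^+ 2)).
have K2 : 0 < 3 * (K + 1) ^+ 2 by rewrite mulr_gt0// exprn_gt0.
have d0 : 0 < d by rewrite lt_min ltr01 divr_gt0// mulr_gt0 ?exprn_gt0// divr_gt0.
have d1 : d <= 1 by rewrite ge_min lexx.
have dK : 3 * d * (K + 1) ^+ 2 <= g2 ^+ 2 * (e / 2).
  by rewrite mulrAC mulrC -ler_pdivlMr// ge_min lexx orbT.
pose eps := g2 * Num.min 1 (e / 2).
have m0 : 0 < Num.min 1 (e / 2) by rewrite lt_min ltr01 divr_gt0.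
have m1 : Num.min 1 (e / 2) <= 1 by rewrite ge_min lexx.
have me : Num.min 1 (e / 2) <= e / 2 by rewrite ge_min lexx orbT.
have eps0 : 0 < eps by rewrite mulr_gt0.
have epse : eps ^+ 2 <= g2 ^+ 2 * (e / 2).
  rewrite exprMn ler_wpM2l ?sqr_ge0// expr2; apply: le_trans me.
  by rewrite ler_piMr// ltW.
clearbody eps; have [L0 hL] := op_small eps0.
pose L := maxn L0 l.+1; have lL : (l < L)%N by rewrite leq_max ltnSn orbT.
have {hL} := hL L (leq_maxl _ _).
have := comb_cvg gram_cvg (f := fun a : 'I_L => val a) val_inj d0.
have := bessel gram_cvg L d0.
have muy : \forall n \near \oo, `|y l - lam n / n%:R| <= Num.min 1 g2.
  by move/cvgrPdist_le: lam_cvg; apply; rewrite lt_min ltr01.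
apply: filter_app3; move: muy; apply: filter_app; move: V_norm; apply: filter_app.
move: V_eigen; apply: filter_app; near=> n => vM vn.
rewrite le_min => /andP[mu1 mug] hb hc hop.
have n0 : (0 < n)%N by near: n; exists 1%N.
have n0R : 0 < n%:R :> R by rewrite ltr0n.
have nN0 : n%:R != 0 :> R by rewrite gt_eqF.
pose mu := lam n / n%:R.
have lamE : lam n = n%:R * mu by rewrite /mu mulrC divfK.
rewrite -/mu in mu1 mug; clearbody mu.
pose c (a : 'I_L) : C := ((n%:R^-1)%:C)%C * dotc (spike n a) (V n).
pose p a := absq (c a).
have dotE (a : 'I_L) : dotc (spike n a) (V n) = (n%:R%:C)%C * c a.
  by rewrite /c mulrA -rmorphM /= divff// mul1r.
have dotp (a : 'I_L) : absq (dotc (spike n a) (V n)) = n%:R ^+ 2 * p a.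
  by rewrite dotE absqM absqR.
have pd : \sum_a p a <= 1 + d.
  have := hb (V n); rewrite vn; under eq_bigr do rewrite dotp.
  rewrite -mulr_sumr -mulrA -expr2 mulrC ler_pM2r ?exprn_gt0//.
have BE : spike_sum L (V n) = \sum_a ((n%:R * y (val a))%:C%C * c a) *: spike n (val a).
  by apply: eq_bigr => a _; rewrite dotE rmorphM /= mulrA (mulrC (y _)%:C%C).
have := hc (fun a => (n%:R * y (val a))%:C%C * c a); rewrite -BE.
under eq_bigr => a _ do rewrite absqM absqR exprMn -mulrA -/(p a).
rewrite -mulr_sumr; set S2 := \sum_a _ ^+ 2 * p a.
rewrite ler_norml => /andP[hB _].
have := hop (V n); rewrite vM vn -scaleN1r nrm2D nrm2Z absqR vn nrm2Z.
have -> : absq (-1 : C) = 1 by rewrite /absq /=; ring.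
rewrite dotcZr mulN1r dotcC dotcZr.
set S1 := \sum_a y (val a) * p a.
have -> : cRe (- conjc (((lam n)%:C)%C * dotc (spike_sum L (V n)) (V n))) =
   - (lam n * (n%:R ^+ 2 * S1)).
  rewrite conjc_scale -dotcC raddfN /= cRe_real hform_spike_sum; congr (- (_ * _)).
  by rewrite mulr_sumr; apply: eq_bigr => a _; rewrite dotp mulrCA.
rewrite mul1r lamE => hV.
have n3 : 0 < n%:R ^+ 3 :> R by rewrite exprn_gt0.
(* The cube of n to be divided out is n^2, from the squared scale of the matrix, times n, the
   squared norm of [V n]. *)
have key : mu ^+ 2 + (1 - d) * S2 - 2 * mu * S1 <= eps ^+ 2.
  rewrite -(ler_pM2l n3).
  move: hB hV; move: (nrm2 _) => b; rewrite !exprMn.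
  have -> : n%:R ^+ 3 * (mu ^+ 2 + (1 - d) * S2 - 2 * mu * S1) =
     n%:R ^+ 2 * mu ^+ 2 * n%:R + (1 - d) * (n%:R * (n%:R ^+ 2 * S2)) -
     2 * (n%:R * mu * (n%:R ^+ 2 * S1)) by ring.
  have -> : n%:R ^+ 3 * eps ^+ 2 = eps ^+ 2 * n%:R ^+ 2 * n%:R by ring.
  by rewrite -mulrA; move: (n%:R * (n%:R ^+ 2 * S2)) (n%:R * mu * _) => u v; lra.
have muK : `|mu| <= K + 1.
  by have := ler_distD (y l) mu 0; rewrite !subr0 distrC; have := yK l; lra.
have gmu : g2 <= `|mu|.
  by have := ler_distD mu (y l) 0; rewrite !subr0; rewrite /g2 in mug *; lra.
have gmz (a : 'I_L) : a != Ordinal lL -> g2 <= `|mu - y a|.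
  rewrite -val_eqE /= => /gy; have := ler_distD mu (y l) (y a).
  by rewrite /g2 in mug *; lra.
have := coef_lower_alg (fun a => absq_ge0 (c a)) _ (fun a => yK (val a)) K0 (ltW g20)
  muK gmu gmz pd key.
rewrite (ltW d0) d1 => /(_ isT); rewrite -/(coef n) => h.
have : g2 ^+ 2 * (1 - absq (coef n)) <= g2 ^+ 2 * e by lra.
by rewrite ler_pM2l// exprn_gt0.
Unshelve. all: by end_near. Qed.

Lemma coef_cvg : absq (coef n) @[n --> \oo] --> (1 : R).
Proof.
apply/cvgrPdist_le => e e0; near=> n; rewrite ler_norml; apply/andP; split.
  by rewrite lerNl opprB lerBlDl; near: n; exact: coef_upper.
by near: n; exact: coef_lower.
Unshelve. all: by end_near. Qed.

(** The square expands as 1 + |c|^2 |u_l|^2 - 2 |c|^2, where |c|^2 and |u_l|^2 tend to 1. *)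
Lemma residual_cvg : n%:R^-1 * nrm2 (V n - coef n *: spike n l) @[n --> \oo] --> (0 : R).
Proof.
have h : 1 + absq (coef n) * cRe (gram n l l) - 2 * absq (coef n) @[n --> \oo] --> (0 : R).
  have -> : (0 : R) = 1 + 1 * 1 - 2 * 1 by ring.
  apply: cvgB; last by apply: cvgM; [exact: cvg_cst|exact: coef_cvg].
  apply: cvgD; first exact: cvg_cst.
  apply: cvgM; first exact: coef_cvg.
  by have [+ _] := gram_cvg l l; rewrite eqxx.
apply: cvg_trans h; apply: near_eq_cvg.
move: V_norm; apply: filter_app; near=> n => vn.
have n0 : (0 < n)%N by near: n; exists 1%N.
have nN0 : n%:R != 0 :> R by rewrite gt_eqF// ltr0n.
have -> : V n - coef n *: spike n l = V n + (- coef n) *: spike n l by rewrite scaleNr.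
rewrite nrm2D nrm2Z absqN vn nrm2_eqRe dotc_spike// dotcZr
  (cRe_real n%:R (gram n l l)).
have -> : dotc (V n) (spike n l) = (n%:R%:C)%C * conjc (coef n).
  by rewrite dotcC /coef conjc_scale mulrA -rmorphM /= divff// mul1r.
rewrite (_ : cRe (- _ * _) = - (n%:R * absq (coef n))).
  move: (absq (coef n)) (cRe _) => a b; by field.
by case: (coef n) => a b; rewrite /absq /=; ring.
Unshelve. all: by end_near. Qed.

Lemma nth_coordE n (v : 'cV[C]_n) (i : 'I_n) : nth_coord v i = v i ord0.
Proof. by rewrite /nth_coord valK. Qed.

Let row n a : C := ((n%:R^-1)%:C)%C * \sum_(k < n) m a k * xi l k.

(** Replacing [V n] by [coef n] times the spike in row [a] costs, in squared modulus and by
    Cauchy-Schwarz, the squared row norm O(n) times the residual o(n), divided by n^2. *)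
Lemma eigen_row_cvg a :
  ccvg (fun n => ((lam n / n%:R)%:C)%C * nth_coord (V n) a - coef n * row n a) 0.
Proof.
apply: absq_ccvg; have [B hB] := row_bounded a.
have h : B * (n%:R^-1 * nrm2 (V n - coef n *: spike n l)) @[n --> \oo] --> (0 : R).
  by rewrite -(mulr0 B); apply: cvgM; [exact: cvg_cst|exact: residual_cvg].
apply: (squeeze_cvgr _ (cvg_cst 0) h).
move: hB V_eigen; apply: filter_app2; near=> n => hB vM.
have an : (a < n)%N by near: n; exists a.+1.
have n0 : 0 < n%:R :> R by rewrite ltr0n; near: n; exists 1%N.
rewrite absq_ge0 subr0 /=.
have -> : ((lam n / n%:R)%:C)%C * nth_coord (V n) a - coef n * row n a =
    ((n%:R^-1)%:C)%C * \sum_(k < n) m a k * (V n - coef n *: spike n l) k ord0.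
  have := congr1 (fun v : 'cV[C]_n => v (Ordinal an) ord0) vM; rewrite !mxE => vE.
  rewrite -[a]/(val (Ordinal an)) nth_coordE mulrC rmorphM /= mulrA (mulrC (V n _ _)).
  rewrite -vE /row (mulrCA (coef n)) mulrC -mulrBr mulr_sumr -sumrB; congr (_ * _).
  by apply: eq_bigr => k _; rewrite !mxE mulrBr mulrCA.
rewrite absqM absqR; apply: (@le_trans _ _ (n%:R^-1 ^+ 2 * (B * n%:R * nrm2 (V n - coef n *: spike n l)))).
  rewrite ler_wpM2l ?sqr_ge0//; apply: le_trans (absq_sum_le _ _) _.
  by rewrite ler_wpM2r// nrm2_ge0.
rewrite le_eqVlt; apply/orP; left; apply/eqP; field; rewrite gt_eqF//.
Unshelve. all: by end_near. Qed.

(** Row 0 is used twice. It gives the limit of the modulus of coordinate 0 from that of [coef n];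
    positivity turns it into a limit of the coordinate itself, and the same row then yields the
    limit of [coef n], phase included. *)
Lemma eigen_coord_cvg a :
  ccvg (fun n => nth_coord (V n) a) (xi l a * (`|xi l 0%N| / xi l 0%N)).
Proof.
have lamC := ccvgR lam_cvg.
have y0C : ((y l)%:C)%C != 0 by rewrite eq_complex /= eqxx andbT.
have rowl0 := row_cvg 0.
have nxi0 : ((y l)%:C)%C * xi l 0%N != 0 by rewrite mulf_neq0.
have mod0 : absq (nth_coord (V n) 0) @[n --> \oo] --> absq (xi l 0%N).
  have h : absq (coef n * row n 0) @[n --> \oo] --> y l ^+ 2 * absq (xi l 0%N).
    under eq_fun do rewrite absqM.
    rewrite -(absqR (y l)) -absqM -[absq (_ * xi _ _)]mul1r.
    by apply: cvgM; [exact: coef_cvg|exact: ccvg_absq].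
  have := cvg_absq_sub (eigen_row_cvg 0) h.
  under eq_fun do rewrite absqM absqR.
  move=> h1; have h2 : ((lam n / n%:R) ^+ 2)^-1 @[n --> \oo] --> (y l ^+ 2)^-1.
    by apply: cvgV; [rewrite expf_neq0|apply: cvgM].
  have h3 : ((lam n / n%:R) ^+ 2)^-1 * ((lam n / n%:R) ^+ 2 *
      absq (nth_coord (V n) 0)) @[n --> \oo] --> absq (xi l 0%N).
    rewrite -[X in _ --> X](mulKf (expf_neq0 2 yl0)); exact: cvgM.
  apply: cvg_trans h3.
  apply: near_eq_cvg; have : \forall n \near \oo, lam n / n%:R != 0.
    by apply: (cvgr_neq0 _ lam_cvg).
  by apply: filterS => n ln; rewrite mulKf// expf_neq0.
have v0 : ccvg (fun n => nth_coord (V n) 0) `|xi l 0%N|.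
  have -> : `|xi l 0%N| = ((Num.sqrt (absq (xi l 0%N)))%:C)%C by rewrite normc_def.
  have h : ccvg (fun n => ((Num.sqrt (absq (nth_coord (V n) 0)))%:C)%C)
      ((Num.sqrt (absq (xi l 0%N)))%:C)%C.
    apply: ccvgR; apply: (cvg_comp _ Num.sqrt mod0); exact: sqrt_continuous.
  apply: near_eq_ccvg h.
  (* Once coordinate 0 is nonzero it is the first nonzero one, so the normalization makes it real
     and positive. *)
  have : \forall n \near \oo, 0 < absq (nth_coord (V n) 0).
    move/cvgr_gt: mod0; apply; rewrite lt0r absq_ge0 absq_eq0 xi0//.
  move: V_phase; apply: filter_app2; near=> n => ph v0.
  have n0 : (0 < n)%N by near: n; exists 1%N.
  move: v0; rewrite -[0%N]/(val (Ordinal n0)) nth_coordE => v0.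
  have := ph (Ordinal n0); rewrite -absq_eq0 (gt_eqF v0) => /(_ isT) /(_ (fun j j0 => False_ind _ (notF j0))).
  case: (V n _ _) {v0} => p q; rewrite ltcE /= => /andP[/eqP -> p0].
  by rewrite /absq /= expr0n addr0 sqrtr_sqr gtr0_norm.
have c0 : ccvg coef (`|xi l 0%N| / xi l 0%N).
  have -> : `|xi l 0%N| / xi l 0%N = ((y l)%:C)%C * `|xi l 0%N| / (((y l)%:C)%C * xi l 0%N).
    by field; rewrite xi0 y0C.
  apply: (ccvg_divr nxi0 rowl0).
  have := ccvgB (ccvgM lamC v0) (eigen_row_cvg 0); rewrite subr0.
  by apply: eq_ccvg => n; rewrite opprB addrCA subrr addr0.
have -> : xi l a * (`|xi l 0%N| / xi l 0%N) =
   (`|xi l 0%N| / xi l 0%N * (((y l)%:C)%C * xi l a)) / ((y l)%:C)%C.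
  by field; rewrite xi0 y0C.
apply: (ccvg_divr y0C lamC).
have := ccvgD (eigen_row_cvg a) (ccvgM c0 (row_cvg a)); rewrite add0r.
by apply: eq_ccvg => n; rewrite subrK mulrC.
Unshelve. all: by end_near. Qed.

End spiked_eigenvectors.

(** * Moments and independence *)

Section sub_sigma_algebras.
Context d (T : measurableType d) (R : realType) (P : probability T R).
Context (I : eqType) (X : I -> T -> R[i]).
Context (X_meas : forall i, complex_rv (X i)).
Context (X_indep : mutually_independent P (fun i => sigma_rv (X i))).

Definition generators (A : set I) : set_system T := \bigcup_(i in A) sigma_rv (X i).

Lemma sigma_rv_measurable i E : sigma_rv (X i) E -> measurable E.
Proof. by move=> [S mS <-]; rewrite -[_ `&` _]/(_ `&` _); exact: X_meas. Qed.

Lemma sigma_generators_measurable A E : <<s generators A >> E -> measurable E.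
Proof.
apply: smallest_sub; first exact: sigma_algebra_measurable.
by move=> S [i _]; exact: sigma_rv_measurable.
Qed.

(** Finite intersections of events of the individual variables: a pi-system generating the same
    sigma-algebra, to which [mutually_independent] applies directly. *)
Let cyl (A : set I) : set_system T := [set E | exists s (C : I -> set T),
  [/\ uniq s, forall i, i \in s -> A i, forall i, i \in s -> sigma_rv (X i) (C i) &
      E = \bigcap_(i in [set` s]) C i]].

Lemma sigma_rvT i : sigma_rv (X i) setT.
Proof. by exists setT => //; rewrite preimage_setT setTI. Qed.

Lemma sigma_rvI i : setI_closed (sigma_rv (X i)).
Proof.
move=> _ _ [S mS <-] [S' mS' <-]; exists (S `&` S'); first exact: measurableI.
by rewrite preimage_setI setIIr.
Qed.

Let cylI A : setI_closed (cyl A).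
Proof.
move=> _ _ [s [C [us sA sC ->]]] [t [D [ut tA tD ->]]].
exists (undup (s ++ t)).
(* An index present in only one list receives [setT] from the other side. *)
exists (fun i => (if i \in s then C i else setT) `&` (if i \in t then D i else setT)).
split.
- exact: undup_uniq.
- by move=> i; rewrite mem_undup mem_cat => /orP[/sA|/tA].
- move=> i; rewrite mem_undup mem_cat => _; apply: sigma_rvI.
    by case: ifPn => [/sC//|_]; exact: sigma_rvT.
  by case: ifPn => [/tD//|_]; exact: sigma_rvT.
- rewrite eqEsubset; split => w /=.
    by move=> [h1 h2] i /= _; split; case: ifPn => // it; [exact: h1|exact: h2].
  move=> h; split => i /= it.
    by have /= := h i; rewrite mem_undup mem_cat it => /(_ isT) [].
  by have /= := h i; rewrite mem_undup mem_cat it orbT => /(_ isT) [].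
Qed.

Let sigma_cyl A : <<s generators A >> `<=` <<d cyl A >>.
Proof.
rewrite setI_closed_g_dynkin_g_sigma_algebra; last exact: cylI.
apply: smallest_sub; first exact: smallest_sigma_algebra.
move=> E [i Ai iE]; apply: sub_sigma_algebra.
exists [:: i], (fun=> E); split => //.
- by move=> j; rewrite inE => /eqP ->.
- by move=> j; rewrite inE => /eqP ->.
- rewrite eqEsubset; split => w /=; first by move=> Ew j.
  by move=> /(_ i); apply; rewrite /= inE.
Qed.

Let cyl_measurable A E : cyl A E -> measurable E.
Proof.
move=> [s [C [_ _ sC ->]]]; apply: fin_bigcap_measurable => // i /= /sC.
exact: sigma_rv_measurable.
Qed.

Let dynkin_indep F : measurable F ->
  dynkin [set E | measurable E /\ P (E `&` F) = (P E * P F)%E].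
Proof.
move=> mF; split => /=.
- by split=> //; rewrite setTI probability_setT mul1e.
- move=> E [mE EF]; split; first exact: measurableC.
  have -> : P (~` E `&` F) = (P F - P (F `&` E))%E.
    by rewrite setIC -setDE; apply: measureD => //; rewrite ltey_eq fin_num_measure.
  by rewrite (setIC F) EF probability_setC// muleBl ?mul1e ?fin_num_measure// fin_num_adde_defr// fin_num_measure.
- move=> E trE mE; split; first by apply: bigcup_measurable => k _; exact: (mE k).1.
  have mEk k : measurable (E k) by exact: (mE k).1.
  have mEF k : measurable (E k `&` F) by exact: measurableI.
  rewrite setI_bigcupl.
  have -> : P (\bigcup_i (E i `&` F)) = (\sum_(k <oo) P (E k `&` F))%E.
    apply: measure_semi_bigcup => //; first exact: trivIset_setIr.
    by apply: bigcup_measurable => k _.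
  have -> : P (\bigcup_i E i) = (\sum_(k <oo) P (E k))%E.
    by apply: measure_semi_bigcup => //; apply: bigcup_measurable => k _.
  rewrite (eq_eseriesr (g := fun k => (P F * P (E k))%E)); last first.
    by move=> k _; rewrite (mE k).2 muleC.
  have -> : P F = (fine (P F))%:E by rewrite fineK// fin_num_measure.
  by rewrite nneseriesZl// muleC.
Qed.

Let indep_cyl A B E F : A `&` B = set0 -> cyl A E -> cyl B F ->
  P (E `&` F) = (P E * P F)%E.
Proof.
move=> AB [s [C [us sA sC ->]]] [t [D [ut tB tD ->]]].
have st i : i \in t -> i \notin s.
  move=> it; apply/negP => is_; have : (A `&` B) i by split; [exact: sA|exact: tB].
  by rewrite AB.
pose H i := if i \in s then C i else D i.
have HC : \bigcap_(i in [set` s]) C i = \bigcap_(i in [set` s]) H i.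
  by apply: eq_bigcapr => i /= is_; rewrite /H is_.
have HD : \bigcap_(i in [set` t]) D i = \bigcap_(i in [set` t]) H i.
  by apply: eq_bigcapr => i /= it; rewrite /H (negbTE (st _ it)).
have Hs i : i \in s -> sigma_rv (X i) (H i) by move=> is_; rewrite /H is_; exact: sC.
have Ht i : i \in t -> sigma_rv (X i) (H i).
  by move=> it; rewrite /H (negbTE (st _ it)); exact: tD.
rewrite HC HD.
have -> : (\bigcap_(i in [set` s]) H i) `&` (\bigcap_(i in [set` t]) H i) =
   \bigcap_(i in [set` s ++ t]) H i.
  rewrite eqEsubset; split => w /=.
    by move=> [h1 h2] i /=; rewrite mem_cat => /orP[/h1|/h2].
  by move=> h; split => i /= it; apply: h; rewrite /= mem_cat it ?orbT.
rewrite !X_indep//; first by rewrite big_cat.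
  rewrite cat_uniq us ut andbT; apply/hasPn => i; exact: st.
by move=> i; rewrite mem_cat => /orP[/Hs|/Ht].
Qed.

(** Dynkin's argument in each event in turn: two cylinders by mutual independence, then a cylinder
    and any event, then two arbitrary events. *)
Lemma sigma_indep A B E F : A `&` B = set0 ->
  <<s generators A >> E -> <<s generators B >> F -> P (E `&` F) = (P E * P F)%E.
Proof.
move=> AB /sigma_cyl AE BF.
have mF := sigma_generators_measurable BF; move/sigma_cyl: BF => BF.
suff : [set E | measurable E /\ P (E `&` F) = (P E * P F)%E] E by case.
move: E AE; apply: smallest_sub; first exact: dynkin_indep.
move=> E cE /=; split; first exact: cyl_measurable cE.
have mE := cyl_measurable cE.
suff : [set F | measurable F /\ P (F `&` E) = (P F * P E)%E] F.
  by move=> [_]; rewrite setIC muleC.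
move: F mF BF => F0 _; move: F0; apply: smallest_sub; first exact: dynkin_indep.
move=> F0 cF; split; first exact: cyl_measurable cF.
by rewrite setIC muleC; exact: indep_cyl AB cE cF.
Qed.

End sub_sigma_algebras.

(** * Expectations of variables with all moments *)

Section moments.
Context d (T : measurableType d) (R : realType) (P : probability T R).
Implicit Types f g : T -> R.

(* A class of random variables closed under products, so that integrability never
   has to be tracked exponent by exponent. *)
Definition all_moments f : Prop := measurable_fun setT f /\
  forall p, (\int[P]_w (`|f w| ^+ p)%:E < +oo)%E.

Definition Ex f : R := fine (\int[P]_w (f w)%:E)%E.

Lemma powD_le (a b : R) p : 0 <= a -> 0 <= b ->
  (a + b) ^+ p <= 2 ^+ p * (a ^+ p + b ^+ p).
Proof.
move=> a0 b0; wlog ab : a b a0 b0 / a <= b.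
  move=> h; have /orP[ab|ba] := le_total a b; first exact: h.
  by rewrite addrC (addrC (a ^+ p)); exact: h.
apply: (@le_trans _ _ ((2 * b) ^+ p)).
  by rewrite lerXn2r ?nnegrE ?addr_ge0 ?mulr_ge0//; lra.
by rewrite exprMn ler_wpM2l ?exprn_ge0// lerDr exprn_ge0.
Qed.

Let mabs f p : measurable_fun setT f ->
  measurable_fun [set: T] (EFin \o ((fun w => `|f w| ^+ p) : T -> R)).
Proof.
move=> mf; apply/measurable_EFinP; apply: measurable_funX.
by apply: measurableT_comp => //; exact: normr_measurable.
Qed.

Lemma all_moments_cst (c : R) : all_moments (fun=> c).
Proof.
split=> [|p]; first exact: measurable_cst.
by rewrite integral_cst//= probability_setT mule1 ltry.
Qed.

Lemma all_momentsD f g : all_moments f -> all_moments g -> all_moments (fun w => f w + g w).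
Proof.
move=> [mf hf] [mg hg]; split=> [|p]; first exact: measurable_funD.
apply: (@le_lt_trans _ _ (\int[P]_w ((2 ^+ p)%:E *
    ((`|f w| ^+ p)%:E + (`|g w| ^+ p)%:E)))%E).
  apply: ge0_le_integral => //.
  - by apply: mabs; exact: measurable_funD.
  - by apply: measurable_funeM; apply: emeasurable_funD; exact: mabs.
  - move=> w _; rewrite -EFinD -EFinM lee_fin; apply: le_trans _ (powD_le _ _ _) => //.
    by rewrite lerXn2r ?nnegrE ?addr_ge0// ler_normD.
rewrite ge0_integralZl_EFin ?exprn_ge0//; last 2 first.
- by move=> w _; rewrite adde_ge0// lee_fin exprn_ge0.
- by apply: emeasurable_funD; exact: mabs.
rewrite ge0_integralD//; try exact: mabs;
  try by move=> w _; rewrite lee_fin exprn_ge0.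
by rewrite lte_mul_pinfty ?lee_fin ?exprn_ge0// lte_add_pinfty.
Qed.

Lemma all_momentsM f g : all_moments f -> all_moments g -> all_moments (fun w => f w * g w).
Proof.
move=> [mf hf] [mg hg]; split=> [|p]; first exact: measurable_funM.
apply: (@le_lt_trans _ _ (\int[P]_w
    ((`|f w| ^+ (p * 2))%:E + (`|g w| ^+ (p * 2))%:E))%E).
  apply: ge0_le_integral => //.
  - by apply: mabs; exact: measurable_funM.
  - by apply: emeasurable_funD; exact: mabs.
  - move=> w _; rewrite -EFinD lee_fin normrM exprMn !exprM.
    have : 0 <= `|f w| ^+ p by rewrite exprn_ge0.
    have : 0 <= `|g w| ^+ p by rewrite exprn_ge0.
    by move: (_ ^+ p) (_ ^+ p) => a b; nra.
rewrite ge0_integralD//; try exact: mabs;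
  try by move=> w _; rewrite lee_fin exprn_ge0.
by rewrite lte_add_pinfty.
Qed.

Lemma all_momentsZ f (c : R) : all_moments f -> all_moments (fun w => c * f w).
Proof. by move=> mf; apply: all_momentsM => //; exact: all_moments_cst. Qed.

Lemma all_momentsN f : all_moments f -> all_moments (fun w => - f w).
Proof.
move=> /(all_momentsZ (-1)); congr all_moments.
by apply/funext => w; rewrite mulN1r.
Qed.

Lemma all_momentsB f g : all_moments f -> all_moments g -> all_moments (fun w => f w - g w).
Proof. by move=> mf mg; apply: all_momentsD => //; exact: all_momentsN. Qed.

Lemma all_momentsX f n : all_moments f -> all_moments (fun w => f w ^+ n).
Proof.
move=> mf; elim: n => [|n IH]; first exact: all_moments_cst.
have := all_momentsM mf IH; congr all_moments.
by apply/funext => w; rewrite exprS.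
Qed.

Lemma all_moments_sum (J : Type) (s : seq J) (F : J -> T -> R) :
  (forall j, all_moments (F j)) -> all_moments (fun w => \sum_(j <- s) F j w).
Proof.
move=> mF; elim: s => [|j s IH].
  by under eq_fun do rewrite big_nil; exact: all_moments_cst.
by under eq_fun do rewrite big_cons; exact: all_momentsD.
Qed.

Lemma all_moments_bounded f (c : R) : measurable_fun setT f ->
  (forall w, `|f w| <= c) -> all_moments f.
Proof.
move=> mf fc; split=> // p.
apply: (@le_lt_trans _ _ (\int[P]_w (c ^+ p)%:E)%E).
  apply: ge0_le_integral => //.
  - exact: mabs.
  - move=> w _; rewrite lee_fin lerXn2r// nnegrE//.
    exact: le_trans (fc w).
by rewrite integral_cst//= probability_setT mule1 ltry.
Qed.

Lemma all_moments_integrable f : all_moments f -> P.-integrable setT (fun w => (f w)%:E).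
Proof.
move=> [mf /(_ 1)] h; apply/integrableP; split; first exact/measurable_EFinP.
by apply: le_lt_trans h; rewrite le_eqVlt; apply/orP; left; apply/eqP;
   apply: eq_integral => w _; rewrite expr1.
Qed.

Lemma ExE f : all_moments f -> (\int[P]_w (f w)%:E)%E = (Ex f)%:E.
Proof. by move=> /all_moments_integrable/integrable_fin_num h; rewrite /Ex fineK// h. Qed.

Lemma Ex_cst (c : R) : Ex (fun=> c) = c.
Proof. by rewrite /Ex integral_cst//= probability_setT mule1. Qed.

Lemma ExD f g : all_moments f -> all_moments g -> Ex (fun w => f w + g w) = Ex f + Ex g.
Proof.
move=> mf mg; apply: EFin_inj; rewrite EFinD -!ExE//; last exact: all_momentsD.
by rewrite -integralD//; exact: all_moments_integrable.
Qed.

Lemma ExZ f (c : R) : all_moments f -> Ex (fun w => c * f w) = c * Ex f.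
Proof.
move=> mf; apply: EFin_inj; rewrite EFinM -!ExE//; last exact: all_momentsZ.
by rewrite -integralZl//; exact: all_moments_integrable.
Qed.

Lemma ExN f : all_moments f -> Ex (fun w => - f w) = - Ex f.
Proof.
by move=> mf; rewrite -mulN1r -ExZ//; congr Ex; apply/funext => w; rewrite mulN1r.
Qed.

Lemma ExB f g : all_moments f -> all_moments g -> Ex (fun w => f w - g w) = Ex f - Ex g.
Proof. by move=> mf mg; rewrite ExD ?ExN//; exact: all_momentsN. Qed.

Lemma Ex_sum (J : Type) (s : seq J) (F : J -> T -> R) :
  (forall j, all_moments (F j)) ->
  Ex (fun w => \sum_(j <- s) F j w) = \sum_(j <- s) Ex (F j).
Proof.
move=> mF; elim: s => [|j s IH].
  by under [in LHS]eq_fun do rewrite big_nil; rewrite big_nil Ex_cst.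
under [in LHS]eq_fun do rewrite big_cons.
by rewrite big_cons ExD ?IH//; exact: all_moments_sum.
Qed.

Lemma Ex_ge0 f : (forall w, 0 <= f w) -> 0 <= Ex f.
Proof. by move=> f0; rewrite fine_ge0// integral_ge0// => w _; rewrite lee_fin. Qed.

Lemma Ex_le f g : all_moments f -> all_moments g -> (forall w, f w <= g w) -> Ex f <= Ex g.
Proof.
move=> mf mg fg; rewrite -subr_ge0 -ExB//; apply: Ex_ge0 => w.
by rewrite subr_ge0.
Qed.

(** The joint law agrees with the product of the laws on rectangles, hence everywhere; Fubini's
    theorem then factors the integral of the product. *)
Lemma Ex_indep f g : all_moments f -> all_moments g ->
  (forall A B : set R, measurable A -> measurable B ->
     P (f @^-1` A `&` g @^-1` B) = (P (f @^-1` A) * P (g @^-1` B))%E) ->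
  Ex (fun w => f w * g w) = Ex f * Ex g.
Proof.
move=> mf mg fg.
pose F : {mfun T >-> R} :=
  HB.pack f (isMeasurableFun.Build _ _ _ _ f mf.1).
pose G : {mfun T >-> R} :=
  HB.pack g (isMeasurableFun.Build _ _ _ _ g mg.1).
pose h w : R * R := (f w, g w).
have mh : measurable_fun [set: T] h by apply: measurable_fun_pair; [exact: mf.1|exact: mg.1].
pose H : {mfun T >-> (R * R)%type} :=
  HB.pack h (isMeasurableFun.Build _ _ _ _ h mh).
pose k (z : R * R) : \bar R := (z.1 * z.2)%:E.
have mk : measurable_fun [set: R * R] k.
  by apply/measurable_EFinP; apply: measurable_funM; [exact: measurable_fst|exact: measurable_snd].
have ik : P.-integrable setT (k \o H).
  by apply: (@all_moments_integrable (fun w => f w * g w)); exact: all_momentsM.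
have eqd A : measurable A -> (distribution P F \x distribution P G)%E A = distribution P H A.
  apply: product_measure_unique => {}A B mA mB.
  rewrite [LHS]/(P ((fun w => (f w, g w)) @^-1` (A `*` B))).
  by rewrite -[RHS](fg A B mA mB); congr (P _).
have ikd : (distribution P F \x distribution P G)%E.-integrable setT k.
  apply/integrableP; split => //.
  have : (distribution P H).-integrable setT k by exact: integrable_pushforward.
  move=> /integrableP[_]; congr (_ < _)%E; apply: eq_measure_integral => A mA _.
  exact/esym/eqd.
have idm : measurable_fun [set: R] (fun y : R => y%:E).
  by apply/measurable_EFinP; exact: measurable_id.
have iG : (distribution P G).-integrable setT (fun y : R => y%:E).
  by apply: integrable_pushforward => //; exact: (all_moments_integrable mg).
have iF : (distribution P F).-integrable setT (fun y : R => y%:E).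
  by apply: integrable_pushforward => //; exact: (all_moments_integrable mf).
have EG : (\int[distribution P G]_y (y : R)%:E)%E = (Ex g)%:E.
  rewrite -(ExE mg) integral_distribution//; exact: (all_moments_integrable mg).
have EF : (\int[distribution P F]_y (y : R)%:E)%E = (Ex f)%:E.
  rewrite -(ExE mf) integral_distribution//; exact: (all_moments_integrable mf).
apply: EFin_inj; rewrite -ExE; last exact: all_momentsM.
transitivity (\int[distribution P H]_z k z)%E; first by rewrite integral_distribution.
transitivity (\int[distribution P F \x distribution P G]_z k z)%E.
  by apply: eq_measure_integral => A mA _; exact/esym/eqd.
rewrite -integral12_prod_meas1//.
transitivity (\int[distribution P F]_x ((Ex g)%:E * (x : R)%:E))%E.
  apply: eq_integral => x _; rewrite /fubini_F /k /=.
  under eq_integral do rewrite EFinM.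
  by rewrite integralZl// EG muleC.
by rewrite integralZl// EF -EFinM mulrC.
Qed.

End moments.

Section complex_moments.
Context d (T : measurableType d) (R : realType) (P : probability T R).
Local Notation C := R[i].
Local Notation cRe := (@complex.Re R).
Local Notation cIm := (@complex.Im R).
Implicit Types Y Z : T -> C.

Definition call_moments Z :=
  all_moments P (fun w => cRe (Z w)) /\ all_moments P (fun w => cIm (Z w)).

Definition cEx Z : C := (Ex P (fun w => cRe (Z w)) +i* Ex P (fun w => cIm (Z w)))%C.

Lemma call_moments_cst (c : C) : call_moments (fun=> c).
Proof. by split; exact: all_moments_cst. Qed.

Lemma cImD (a b : C) : cIm (a + b) = cIm a + cIm b.
Proof. by case: a b => ? ? [? ?]. Qed.

Lemma cReM (a b : C) : cRe (a * b) = cRe a * cRe b - cIm a * cIm b.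
Proof. by case: a b => ? ? [? ?]. Qed.

Lemma cImM (a b : C) : cIm (a * b) = cRe a * cIm b + cIm a * cRe b.
Proof. by case: a b => ? ? [? ?]. Qed.

Lemma cReJ (a : C) : cRe (conjc a) = cRe a.
Proof. by case: a. Qed.

Lemma cImJ (a : C) : cIm (conjc a) = - cIm a.
Proof. by case: a. Qed.

Lemma call_momentsD Y Z : call_moments Y -> call_moments Z ->
  call_moments (fun w => Y w + Z w).
Proof.
move=> [y1 y2] [z1 z2]; split.
  by under eq_fun do rewrite cReD; exact: all_momentsD.
by under eq_fun do rewrite cImD; exact: all_momentsD.
Qed.

Lemma call_momentsM Y Z : call_moments Y -> call_moments Z ->
  call_moments (fun w => Y w * Z w).
Proof.
move=> [y1 y2] [z1 z2]; split.
  by under eq_fun do rewrite cReM; apply: all_momentsB; exact: all_momentsM.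
by under eq_fun do rewrite cImM; apply: all_momentsD; exact: all_momentsM.
Qed.

Lemma call_momentsJ Z : call_moments Z -> call_moments (fun w => conjc (Z w)).
Proof.
move=> [z1 z2]; split; first by under eq_fun do rewrite cReJ.
by under eq_fun do rewrite cImJ; exact: all_momentsN.
Qed.

Lemma call_momentsZ (c : C) Z : call_moments Z -> call_moments (fun w => c * Z w).
Proof. by move=> mZ; apply: call_momentsM => //; exact: call_moments_cst. Qed.

Lemma call_momentsB Y Z : call_moments Y -> call_moments Z ->
  call_moments (fun w => Y w - Z w).
Proof.
move=> mY mZ; under eq_fun do rewrite -mulN1r.
by apply: call_momentsD => //; exact: call_momentsZ.
Qed.

Lemma call_moments_sum (J : Type) (s : seq J) (F : J -> T -> C) :
  (forall j, call_moments (F j)) -> call_moments (fun w => \sum_(j <- s) F j w).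
Proof.
move=> mF; elim: s => [|j s IH].
  by under eq_fun do rewrite big_nil; exact: call_moments_cst.
by under eq_fun do rewrite big_cons; exact: call_momentsD.
Qed.

Lemma call_moments_absq Z : call_moments Z -> all_moments P (fun w => absq (Z w)).
Proof. by move=> [z1 z2]; apply: all_momentsD; exact: all_momentsX. Qed.

Lemma Re_cEx Z : cRe (cEx Z) = Ex P (fun w => cRe (Z w)).
Proof. by []. Qed.

Lemma cEx_cst (c : C) : cEx (fun=> c) = c.
Proof. by rewrite /cEx !Ex_cst; case: c. Qed.

Lemma cExD Y Z : call_moments Y -> call_moments Z ->
  cEx (fun w => Y w + Z w) = cEx Y + cEx Z.
Proof.
move=> [y1 y2] [z1 z2]; rewrite /cEx; under eq_fun do rewrite cReD.
rewrite ExD//; congr (_ +i* _)%C.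
by under eq_fun do rewrite cImD; rewrite ExD.
Qed.

Lemma cExJ Z : call_moments Z -> cEx (fun w => conjc (Z w)) = conjc (cEx Z).
Proof.
move=> [z1 z2]; rewrite /cEx; under eq_fun do rewrite cReJ.
by rewrite /=; congr (_ +i* _)%C; under eq_fun do rewrite cImJ; rewrite ExN.
Qed.

Lemma cEx_sum (J : Type) (s : seq J) (F : J -> T -> C) :
  (forall j, call_moments (F j)) ->
  cEx (fun w => \sum_(j <- s) F j w) = \sum_(j <- s) cEx (F j).
Proof.
move=> mF; elim: s => [|j s IH].
  by under [in LHS]eq_fun do rewrite big_nil; rewrite big_nil cEx_cst.
under [in LHS]eq_fun do rewrite big_cons.
by rewrite big_cons cExD ?IH//; exact: call_moments_sum.
Qed.

Lemma Ex_absq_sum (J : Type) (s : seq J) (F : J -> T -> C) :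
  (forall j, call_moments (F j)) ->
  Ex P (fun w => absq (\sum_(j <- s) F j w)) =
  \sum_(i <- s) \sum_(j <- s) cRe (cEx (fun w => F i w * conjc (F j w))).
Proof.
move=> mF; have E w : absq (\sum_(j <- s) F j w) =
    \sum_(i <- s) \sum_(j <- s) cRe (F i w * conjc (F j w)).
  have -> : absq (\sum_(j <- s) F j w) =
      cRe ((\sum_(j <- s) F j w) * conjc (\sum_(j <- s) F j w)).
    by rewrite mulrC -absqE.
  rewrite rmorph_sum big_distrlr /= raddf_sum; apply: eq_bigr => i _.
  by rewrite raddf_sum.
have mij i j : all_moments P (fun w => cRe (F i w * conjc (F j w))).
  by have [] := call_momentsM (mF i) (call_momentsJ (mF j)).
under eq_fun do rewrite E; rewrite Ex_sum; last by move=> i; exact: all_moments_sum.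
by apply: eq_bigr => i _; rewrite Ex_sum.
Qed.

End complex_moments.

(** * Variables depending on a subset of the family *)

Section adapted.
Context d (T : measurableType d) (R : realType) (P : probability T R).
Local Notation C := R[i].
Local Notation cRe := (@complex.Re R).
Local Notation cIm := (@complex.Im R).
Context (I : eqType) (X : I -> T -> R[i]).
Context (X_meas : forall i, complex_rv (X i)).
Context (X_indep : mutually_independent P (fun i => sigma_rv (X i))).
Implicit Types (A B : set I).

(** Measurability for the sigma-algebra of the [X i], i in [A]; independence then reduces to
    disjointness of index sets, through [Ex_adapted]. *)
Definition adapted A (f : T -> R) :=
  measurable_fun [set: g_sigma_algebraType (generators X A)] (f : g_sigma_algebraType _ -> R).

Definition cadapted A (Z : T -> C) :=
  adapted A (fun w => cRe (Z w)) /\ adapted A (fun w => cIm (Z w)).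

Lemma adapted_preimage A f S : adapted A f -> measurable S ->
  <<s generators X A >> (f @^-1` S).
Proof. by move=> /[apply] => /(_ measurableT); rewrite setTI; apply. Qed.

Lemma adapted_sub A B f : A `<=` B -> adapted A f -> adapted B f.
Proof.
move=> AB af _ S mS; have := af measurableT S mS.
rewrite !setTI; apply: smallest_sub; first exact: smallest_sigma_algebra.
by move=> E [i Ai iE]; apply: sub_sigma_algebra; exists i => //; exact: AB.
Qed.

Lemma cadapted_gen A i : A i -> cadapted A (X i).
Proof.
move=> Ai; split=> _ S mS; rewrite setTI; apply: sub_sigma_algebra; exists i => //.
  exists (S `*` setT); first exact: measurableX.
  by rewrite setTI; apply/funext => w /=; apply/propext; split => [[]|].
exists (setT `*` S); first exact: measurableX.
by rewrite setTI; apply/funext => w /=; apply/propext; split => [[]|].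
Qed.

Lemma cadapted_cst A (c : C) : cadapted A (fun=> c).
Proof. by split; exact: measurable_cst. Qed.

Lemma cadaptedD A Y Z : cadapted A Y -> cadapted A Z -> cadapted A (fun w => Y w + Z w).
Proof.
move=> [y1 y2] [z1 z2]; split.
  by rewrite /adapted; under eq_fun do rewrite cReD; exact: measurable_funD.
by rewrite /adapted; under eq_fun do rewrite cImD; exact: measurable_funD.
Qed.

Lemma cadaptedM A Y Z : cadapted A Y -> cadapted A Z -> cadapted A (fun w => Y w * Z w).
Proof.
move=> [y1 y2] [z1 z2]; split.
  rewrite /adapted; under eq_fun do rewrite cReM.
  by apply: measurable_funB; exact: measurable_funM.
rewrite /adapted; under eq_fun do rewrite cImM.
by apply: measurable_funD; exact: measurable_funM.
Qed.

Lemma cadaptedJ A Z : cadapted A Z -> cadapted A (fun w => conjc (Z w)).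
Proof.
move=> [z1 z2]; split; first by rewrite /adapted; under eq_fun do rewrite cReJ.
by rewrite /adapted; under eq_fun do rewrite cImJ; exact: measurable_funN.
Qed.

Lemma cadapted_sum A (J : Type) (s : seq J) (F : J -> T -> C) :
  (forall j, cadapted A (F j)) -> cadapted A (fun w => \sum_(j <- s) F j w).
Proof.
move=> mF; elim: s => [|j s IH].
  by under eq_fun do rewrite big_nil; exact: cadapted_cst.
by under eq_fun do rewrite big_cons; exact: cadaptedD.
Qed.

Lemma Ex_adapted A B f g : A `&` B = set0 -> all_moments P f -> all_moments P g ->
  adapted A f -> adapted B g -> Ex P (fun w => f w * g w) = Ex P f * Ex P g.
Proof.
move=> AB mf mg af ag; apply: Ex_indep => // S S' mS mS'.
by apply: (sigma_indep X_meas X_indep AB); exact: adapted_preimage.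
Qed.

Lemma cEx_adapted A B Y Z : A `&` B = set0 -> call_moments P Y -> call_moments P Z ->
  cadapted A Y -> cadapted B Z -> cEx P (fun w => Y w * Z w) = cEx P Y * cEx P Z.
Proof.
move=> AB [y1 y2] [z1 z2] [ay1 ay2] [az1 az2].
rewrite /cEx.
have -> (u v u' v' : R) : (u +i* v)%C * (u' +i* v')%C = ((u * u' - v * v') +i* (u * v' + v * u'))%C.
  by [].
congr (_ +i* _)%C.
  under eq_fun do rewrite cReM; rewrite ExB; try exact: all_momentsM.
  by rewrite !(@Ex_adapted A B).
under eq_fun do rewrite cImM; rewrite ExD; try exact: all_momentsM.
by rewrite !(@Ex_adapted A B).
Qed.

End adapted.

(** * Almost sure convergence *)

Section almost_sure.
Context d (T : measurableType d) (R : realType) (P : probability T R).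
Local Notation C := R[i].
Local Notation cRe := (@complex.Re R).
Local Notation cIm := (@complex.Im R).

(* Fatou's lemma in [K], then summability in [q]: statements about almost sure
   limits of the truncated series are reduced to moments of the truncations. *)
Lemma fatou_cvg0 (f : nat -> nat -> T -> R) (u : nat -> R) (B : R) :
  (forall q K, all_moments P (f q K)) -> (forall q K w, 0 <= f q K w) ->
  (forall q K, Ex P (f q K) <= u q) -> (forall n, \sum_(q < n) u q <= B) ->
  {ae P, forall w, forall g : nat -> R,
    (forall q, f q K w @[K --> \oo] --> g q) -> g q @[q --> \oo] --> (0 : R)}.
Proof.
move=> mf f0 fu uB.
pose F q K : T -> \bar R := fun w => (f q K w)%:E.
have mF q K : measurable_fun [set: T] (F q K).
  by apply/measurable_EFinP; exact: (mf q K).1.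
have F0 q K w : (0 <= F q K w)%E by rewrite lee_fin.
(* The lower limit is defined everywhere and measurable; it coincides with the limit in [K] at the
   points where the latter exists. *)
pose Z q : T -> \bar R := fun w => limn_einf (F q ^~ w).
have einf_ge0 (v : nat -> \bar R) : (forall n, (0 <= v n)%E) -> (0 <= limn_einf v)%E.
  move=> v0; rewrite limn_einf_lim; apply: lime_ge; first exact: is_cvg_einfs.
  by apply: nearW => n; apply: le_ereal_inf_tmp => _ [k _ <-].
have einf_le (v : nat -> \bar R) c : (forall n, (v n <= c)%E) -> (limn_einf v <= c)%E.
  move=> v0; rewrite limn_einf_lim; apply: lime_le; first exact: is_cvg_einfs.
  apply: nearW => n; apply: le_trans (v0 n); apply: ereal_inf_lbound.
  by exists n => //=.
have Z0 q w : (0 <= Z q w)%E by exact: einf_ge0.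
have mZ q : measurable_fun [set: T] (Z q).
  apply: measurableT_comp => //; apply: measurable_fun_limn_esup => K.
  exact: measurableT_comp.
have iZ q : (\int[P]_w Z q w <= (u q)%:E)%E.
  apply: le_trans (fatou P measurableT (mF q) _) _; first by move=> n w _.
  by apply: einf_le => K; rewrite /F ExE// lee_fin.
have mS : measurable_fun [set: T] (fun w => \sum_(q <oo) Z q w)%E.
  by apply: ge0_emeasurable_sum => // q w _ _.
have S0 w : (0 <= \sum_(q <oo) Z q w)%E by apply: nneseries_ge0.
have iS : P.-integrable setT (fun w => \sum_(q <oo) Z q w)%E.
  apply/integrableP; split => //.
  under eq_integral do rewrite gee0_abs//.
  rewrite integral_nneseries//; apply: (@le_lt_trans _ _ B%:E); last by rewrite ltry.
  apply: lime_le.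
    by apply: is_cvg_nneseries => n _ _; exact: integral_ge0.
  apply: nearW => n; apply: (@le_trans _ _ (\sum_(0 <= q < n) (u q)%:E)%E).
    by apply: lee_sum => q _; exact: iZ.
  by rewrite sumEFin lee_fin big_mkord; exact: uB.
have := integrable_ae measurableT iS.
apply: filterS => w /(_ I) Sfin g fg.
have Zg q : Z q w = (g q)%:E.
  have h : F q K w @[K --> \oo] --> (g q)%:E.
    by apply: cvg_EFin; [exact: nearW|exact: fg].
  rewrite /Z is_cvg_limn_einfE; last by apply/cvg_ex; exists (g q)%:E.
  exact/cvg_lim.
have g0 q : 0 <= g q by rewrite -lee_fin -Zg.
apply: cvg_series_cvg_0; apply: nnseries_is_cvg => //.
under eq_eseriesr do rewrite -Zg.
by rewrite ltey_eq Sfin.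
Qed.

Lemma sum_inv_sqr (n : nat) : \sum_(q < n) (q.+1%:R ^+ 2)^-1 <= 2 :> R.
Proof.
case: n => [|n]; first by rewrite big_ord0.
(* The strengthened bound telescopes: 1/(k+1)^2 <= 1/k - 1/(k+1). *)
suff : \sum_(q < n.+1) (q.+1%:R ^+ 2)^-1 <= 2 - n.+1%:R^-1 :> R.
  by move/le_trans; apply; rewrite gerBl invr_ge0 ler0n.
elim: n => [|n IH]; first by rewrite big_ord_recr big_ord0 /= add0r expr1n invr1; lra.
rewrite big_ord_recr /=; apply: (@le_trans _ _ (2 - n.+1%:R^-1 + (n.+2%:R ^+ 2)^-1)).
  by rewrite lerD2r.
rewrite -[n.+2%:R]natr1; have : 0 < n.+1%:R :> R by rewrite ltr0n.
move: (n.+1%:R) => a a0; rewrite -subr_ge0.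
have -> : 2 - (a + 1)^-1 - (2 - a^-1 + ((a + 1) ^+ 2)^-1) = (a * (a + 1) ^+ 2)^-1.
  by field; rewrite !gt_eqF// ltr_wpDl// ltW.
by rewrite invr_ge0 mulr_ge0 ?sqr_ge0// ltW.
Qed.

Lemma sqrt_bracket (n : nat) : (0 < n)%N -> exists q, (q.+1 ^ 2 <= n < q.+2 ^ 2)%N.
Proof.
case: n => // n _; elim: n => [|n [q /andP[q1 q2]]]; first by exists 0%N.
have [h|h] := ltnP n.+2 (q.+2 ^ 2); first by exists q; rewrite h (leq_trans q1).
by exists q.+1; rewrite h /=; apply: leq_ltn_trans q2 _; rewrite ltn_sqr.
Qed.

Lemma absq_sum_card n (V : nat -> C) :
  absq (\sum_(k < n) V k) <= n%:R * \sum_(k < n) absq (V k).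
Proof.
have := absq_sum_le (fun=> 1 : C) (fun k : 'I_n => V k).
have -> : \sum_(k < n) absq (1 : C) = n%:R.
  rewrite (_ : absq (1 : C) = 1); last by rewrite /absq /=; ring.
  by rewrite sumr_const card_ord.
by under eq_bigr do rewrite mul1r.
Qed.

Lemma cvg_sum_ord n (f : nat -> nat -> R) (a : nat -> R) :
  (forall j, f j K @[K --> \oo] --> a j) ->
  \sum_(j < n) f j K @[K --> \oo] --> \sum_(j < n) a j.
Proof.
move=> fa; elim: n => [|n IH].
  by rewrite big_ord0; under eq_fun do rewrite big_ord0; exact: cvg_cst.
by rewrite big_ord_recr; under eq_fun do rewrite big_ord_recr; exact: cvgD.
Qed.

(** Orthogonality gives averages of variance O(1/n), summable along n = (q+1)^2; the block up to the
    next square has at most 2q + 3 terms and is handled by Cauchy-Schwarz. [K] is the truncation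
    level of a random series and [V] the limit; [W] is constant in [K] when the variables are not
    limits. *)
Lemma l2_slln (W : nat -> nat -> T -> C) (c : R) :
  (forall K k, call_moments P (W K k)) ->
  (forall K k, Ex P (fun w => absq (W K k w)) <= c) ->
  (forall K k k', k != k' -> cRe (cEx P (fun w => W K k w * conjc (W K k' w))) = 0) ->
  {ae P, forall w, forall V : nat -> C,
    (forall k, ccvg (fun K => W K k w) (V k)) ->
    ccvg (fun n => ((n%:R^-1)%:C)%C * \sum_(k < n) V k) 0}.
Proof.
move=> mW Wc orth.
have c0 : 0 <= c by apply: le_trans (Wc 0%N 0%N); apply: Ex_ge0 => w; exact: absq_ge0.
pose h (V : nat -> C) q := (absq (\sum_(k < q.+1 ^ 2) V k) +
  (q * 2 + 3)%:R * \sum_(j < q * 2 + 3) absq (V (q.+1 ^ 2 + j)%N)) / q.+1%:R ^+ 4.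
have mf q K : all_moments P (fun w => h (fun k => W K k w) q).
  rewrite /h; under eq_fun do rewrite mulrC.
  apply: all_momentsZ; apply: all_momentsD.
    by apply: call_moments_absq; apply: call_moments_sum.
  by apply: all_momentsZ; apply: all_moments_sum => j; exact: call_moments_absq.
have h0 V q : 0 <= h V q.
  rewrite divr_ge0 ?exprn_ge0// addr_ge0 ?absq_ge0// mulr_ge0// sumr_ge0// => j _.
  exact: absq_ge0.
have Esum K n : Ex P (fun w => absq (\sum_(k < n) W K k w)) <= n%:R * c.
  rewrite Ex_absq_sum//.
  rewrite (eq_bigr (fun k : 'I_n => Ex P (fun w => absq (W K k w)))) => [|k _].
    apply: (@le_trans _ _ (\sum_(k < n) c)); first by apply: ler_sum => k _.
    by rewrite sumr_const card_ord mulr_natl.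
  rewrite (bigD1 k)//= big1 ?addr0 => [|k' k'k]; last by apply: orth; rewrite eq_sym.
  by congr Ex; apply/funext => w; rewrite mulrC -absqE.
(* The constant 10 is 1 for the sum up to the square plus 9 for the block, since (2q + 3)^2 <= 9 (q
   + 1)^2. *)
have Eh q K : Ex P (fun w => h (fun k => W K k w) q) <= 10 * c * (q.+1%:R ^+ 2)^-1.
  rewrite /h; under eq_fun do rewrite mulrC.
  have m1 : all_moments P (fun w => absq (\sum_(k < q.+1 ^ 2) W K k w)).
    by apply: call_moments_absq; apply: call_moments_sum.
  have m2 : all_moments P (fun w => \sum_(j < q * 2 + 3) absq (W K (q.+1 ^ 2 + j)%N w)).
    by apply: all_moments_sum => j; exact: call_moments_absq.
  rewrite ExZ; last by apply: all_momentsD => //; exact: all_momentsZ.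
  rewrite ExD ?ExZ//; last exact: all_momentsZ.
  rewrite Ex_sum; last by move=> j; exact: call_moments_absq.
  have e1 := Esum K (q.+1 ^ 2)%N.
  have e2 : \sum_(j < q * 2 + 3) Ex P (fun w => absq (W K (q.+1 ^ 2 + j)%N w)) <=
      (q * 2 + 3)%:R * c.
    apply: (@le_trans _ _ (\sum_(j < q * 2 + 3) c)); first by apply: ler_sum => j _.
    by rewrite sumr_const card_ord mulr_natl.
  rewrite natrX in e1.
  have q3 : (q * 2 + 3)%:R <= 3 * q.+1%:R :> R by rewrite -natrM ler_nat; lia.
  have q0 : 0 < q.+1%:R :> R by rewrite ltr0n.
  move: (\sum_(j < _) _) e2 => b e2.
  have q30 : 0 <= (q * 2 + 3)%:R :> R by rewrite ler0n.
  have e3 : (q * 2 + 3)%:R * b <= 9 * q.+1%:R ^+ 2 * c.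
    apply: (@le_trans _ _ ((q * 2 + 3)%:R * ((q * 2 + 3)%:R * c))); first by rewrite ler_wpM2l.
    rewrite mulrA ler_wpM2r// -expr2.
    rewrite (_ : 9 * q.+1%:R ^+ 2 = (3 * q.+1%:R) ^+ 2); last by ring.
    by rewrite lerXn2r// nnegrE mulr_ge0.
  have -> : 10 * c * (q.+1%:R ^+ 2)^-1 = (q.+1%:R ^+ 4)^-1 * (10 * q.+1%:R ^+ 2 * c).
    by field; rewrite gt_eqF.
  by rewrite ler_wpM2l ?invr_ge0 ?exprn_ge0//; lra.
have uB n : \sum_(q < n) 10 * c * (q.+1%:R ^+ 2)^-1 <= 10 * c * 2.
  by rewrite -mulr_sumr ler_wpM2l ?mulr_ge0// sum_inv_sqr.
have := fatou_cvg0 mf (fun q K w => h0 _ q) Eh uB.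
apply: filterS => w hw V WV.
have {}hw : h V q @[q --> \oo] --> (0 : R).
  apply: hw => q; apply: cvgM; last exact: cvg_cst.
  apply: cvgD; first by apply: ccvg_absq; apply: (@ccvg_sum _ _ (fun k K => W K k w)) => k _; exact: WV.
  apply: cvgM; first exact: cvg_cst.
  by apply: (@cvg_sum_ord _ (fun j K => absq (W K (q.+1 ^ 2 + j)%N w))
      (fun j => absq (V (q.+1 ^ 2 + j)%N))) => j; apply: ccvg_absq; exact: WV.
apply: absq_ccvg; apply/cvgr0Pnorm_le => e e0.
have [Q _ hQ] : \forall q \near \oo, `|h V q| <= e / 2.
  by move/cvgr0Pnorm_le: hw; apply; rewrite divr_gt0.
exists (Q.+1 ^ 2)%N => // n /= Qn.
have n0 : (0 < n)%N by apply: leq_trans Qn; rewrite expn_gt0.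
have [q /andP[q1 q2]] := sqrt_bracket n0.
have Qq : (Q <= q)%N.
  by have := leq_ltn_trans Qn q2; rewrite ltn_sqr; lia.
have hq : h V q <= e / 2 by apply: le_trans (hQ q Qq); exact: ler_norm.
rewrite subr0 ger0_norm ?absq_ge0// absqM absqR.
have -> : e = 2 * (e / 2) by field.
apply: le_trans (ler_wpM2l _ hq) => //.
pose r := (n - q.+1 ^ 2)%N; have nE : n = (q.+1 ^ 2 + r)%N by rewrite subnKC.
have r3 : (r <= q * 2 + 3)%N by move: q2; rewrite nE -!mulnn; lia.
have S1 : absq (\sum_(k < n) V k) <= 2 * (absq (\sum_(k < q.+1 ^ 2) V k) +
    (q * 2 + 3)%:R * \sum_(j < q * 2 + 3) absq (V (q.+1 ^ 2 + j)%N)).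
  rewrite nE big_split_ord /= mulrDr; apply: le_trans (absqD_le _ _) _.
  rewrite lerD2l ler_wpM2l//; apply: le_trans (absq_sum_card _ (fun j => V (q.+1 ^ 2 + j)%N)) _.
  apply: ler_pM; rewrite ?ler0n ?ler_nat//; first by apply: sumr_ge0 => j _; exact: absq_ge0.
  rewrite -(subnKC r3) big_split_ord /= lerDl; apply: sumr_ge0 => j _; exact: absq_ge0.
have n1 : q.+1%:R ^+ 2 <= n%:R :> R by rewrite -natrX ler_nat.
have q0 : 0 < q.+1%:R ^+ 2 :> R by rewrite exprn_gt0// ltr0n.
rewrite /h mulrA mulrC; apply: ler_pM => //; rewrite ?absq_ge0 ?exprn_ge0 ?invr_ge0//.
rewrite exprVn lef_pV2 ?posrE ?exprn_gt0 ?ltr0n//.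
by rewrite (_ : 4 = 2 * 2)%N// exprM lerXn2r// nnegrE ?ler0n// ltW.
Qed.

End almost_sure.

(** * Almost sure convergence of random series *)

Section kolmogorov.
Context d (T : measurableType d) (R : realType) (P : probability T R).
Context (I : eqType) (X : I -> T -> R[i]).
Context (X_meas : forall i, complex_rv (X i)).
Context (X_indep : mutually_independent P (fun i => sigma_rv (X i))).
Context (S : nat -> set I) (S_disj : forall l l', l != l' -> S l `&` S l' = set0).
Context (Y : nat -> T -> R) (v : nat -> R) (B : R).
Context (mY : forall l, all_moments P (Y l)) (aY : forall l, adapted X (S l) (Y l)).
Context (Y_centered : forall l, Ex P (Y l) = 0).
Context (Y_var : forall l, Ex P (fun w => Y l w ^+ 2) <= v l).
Context (v_sum : forall n, \sum_(0 <= l < n) v l <= B).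

Section stopped.
Context (e : R) (m : nat).

Let inside : set R := `]- e, e[%classic.

(* The partial sums of [Y m + Y m.+1 + ...], frozen once they leave ]-e, e[. *)
Fixpoint stopped_sum (k : nat) (w : T) : R := if k is k'.+1 then
  stopped_sum k' w + \1_inside (stopped_sum k' w) * Y (m + k')%N w else 0.

Let insideE (z : R) : \1_inside z = (`|z| < e)%R%:R :> R.
Proof. by rewrite indicE /inside mem_setE in_itv /= ltr_norml. Qed.

Let m_inside : measurable_fun [set: R] (\1_inside : R -> R).
Proof. by apply: measurable_indic; exact: measurable_itv. Qed.

Lemma adapted_stopped k : adapted X (\bigcup_(l in `I_(m + k)%N) S l) (stopped_sum k).
Proof.
elim: k => [|k IH]; first exact: measurable_cst.
have IH' : adapted X (\bigcup_(l in `I_(m + k.+1)%N) S l) (stopped_sum k).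
  apply: adapted_sub IH => i [l /= lk Sl]; exists l => //=.
  by rewrite addnS ltnW.
have aY' : adapted X (\bigcup_(l in `I_(m + k.+1)%N) S l) (Y (m + k)%N).
  by apply: (adapted_sub _ (@aY (m + k)%N)) => i Si; exists (m + k)%N => //=; rewrite addnS.
apply: measurable_funD => //; apply: measurable_funM => //.
exact: measurableT_comp IH'.
Qed.

Lemma adapted_measurable A (f : T -> R) : adapted X A f -> measurable_fun [set: T] f.
Proof.
move=> af _ E mE; rewrite setTI.
exact: (sigma_generators_measurable X_meas (adapted_preimage af mE)).
Qed.

Let mI k : all_moments P (fun w => \1_inside (stopped_sum k w)).
Proof.
apply: (@all_moments_bounded _ _ _ _ _ 1) => [|w].
  by apply: measurableT_comp => //; exact: (adapted_measurable (@adapted_stopped k)).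
by rewrite insideE; case: (_ < _); rewrite ?normr1 ?normr0.
Qed.

Lemma all_moments_stopped k : all_moments P (stopped_sum k).
Proof.
elim: k => [|k IH]; first exact: all_moments_cst.
by apply: all_momentsD => //; exact: all_momentsM.
Qed.

Lemma stopped_sum_var k :
  Ex P (fun w => stopped_sum k w ^+ 2) <= \sum_(m <= l < m + k) v l.
Proof.
elim: k => [|k IH].
  by rewrite addn0 big_geq//=; under eq_fun do rewrite expr0n; rewrite Ex_cst.
rewrite addnS big_nat_recr ?leq_addr//=.
have mZ := all_moments_stopped k.
have mZI : all_moments P (fun w => stopped_sum k w * \1_inside (stopped_sum k w)).
  exact: all_momentsM.
have mY2 : all_moments P (fun w => (\1_inside (stopped_sum k w) * Y (m + k)%N w) ^+ 2).
  by apply: all_momentsX; exact: all_momentsM.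
have E w : (stopped_sum k w + \1_inside (stopped_sum k w) * Y (m + k)%N w) ^+ 2 =
   stopped_sum k w ^+ 2 + 2 * (stopped_sum k w * \1_inside (stopped_sum k w) * Y (m + k)%N w)
   + (\1_inside (stopped_sum k w) * Y (m + k)%N w) ^+ 2 by ring.
under eq_fun do rewrite E.
rewrite ExD//; last first.
  by apply: all_momentsD; [exact: all_momentsX|apply: all_momentsZ; exact: all_momentsM].
rewrite ExD; [|exact: all_momentsX|by apply: all_momentsZ; exact: all_momentsM].
rewrite ExZ; last exact: all_momentsM.
rewrite (@Ex_adapted _ _ _ _ _ _ X_meas X_indep (\bigcup_(l in `I_(m + k)%N) S l) (S (m + k)%N))//.
- rewrite Y_centered !mulr0 addr0 lerD//; apply: le_trans (Y_var _).
  apply: Ex_le => // [|w]; first exact: all_momentsX.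
  by rewrite exprMn ler_piMl ?sqr_ge0// insideE; case: (_ < _); rewrite ?expr1n ?expr0n.
- rewrite setI_bigcupl bigcup0// => l /= lk.
  by apply: S_disj; rewrite ltn_eqF.
- apply: measurable_funM; first exact: adapted_stopped.
  exact: measurableT_comp (@adapted_stopped k).
Qed.

Lemma stopped_sum_exit k w : e <= `|stopped_sum k w| -> e <= `|stopped_sum k.+1 w|.
Proof. by move=> h /=; rewrite insideE ltNge h mul0r addr0. Qed.

Lemma stopped_sum_inside k w : `|stopped_sum k w| < e ->
  stopped_sum k w = \sum_(m <= l < m + k) Y l w.
Proof.
elim: k => [|k IH] /=; first by rewrite addn0 big_geq.
rewrite insideE; have [h|h] := ltP `|stopped_sum k w| e.
  by rewrite mul1r addnS big_nat_recr ?leq_addr//= IH.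
by rewrite mul0r addr0 ltNge h.
Qed.

End stopped.

Lemma v_ge0 l : 0 <= v l.
Proof. by apply: le_trans (Y_var l); apply: Ex_ge0 => w; exact: sqr_ge0. Qed.

Lemma tail_small (r : R) : 0 < r -> exists m, forall k, \sum_(m <= l < m + k) v l <= r.
Proof.
move=> r0; have cv : cvgn (series v).
  apply: nondecreasing_is_cvgn.
    by apply/nondecreasing_seqP => n; rewrite seriesSr /= lerDl v_ge0.
  by exists B => _ [n _ <-]; exact: v_sum.
have [m _ hm] : \forall n \near \oo, limn (series v) - r <= series v n.
  by apply: (cvgr_ge _ cv); rewrite ltrBlDr ltrDl.
exists m => k; rewrite (_ : \sum_(m <= l < m + k) v l = series v (m + k)%N - series v m).
  have h : series v (m + k)%N <= limn (series v).
    apply: nondecreasing_cvgn_le => //.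
    by apply/nondecreasing_seqP => n; rewrite seriesSr /= lerDl v_ge0.
  by have := hm m (leqnn m); rewrite /=; lra.
by rewrite /series /= [in RHS](big_cat_nat (n := m)) ?leq_addr//= addrAC subrr add0r.
Qed.

(** Chebyshev's inequality for the stopped sum bounds the probability of ever leaving ]-e, e[, which
    replaces the maximal inequality. Tails starting at [mq q] have variance at most (q+1)^-2, so the
    exit probabilities are summable in q and almost surely some tail never exits. Taking e = 1/(p+1)
    for every p gives the Cauchy criterion. *)
Theorem kolmogorov_cvg : {ae P, forall w, cvgn (series (fun l => Y l w))}.
Proof.
have main p : {ae P, forall w, exists m, forall k,
    `|\sum_(m <= l < m + k) Y l w| < (p.+1%:R)^-1}.
  pose e : R := (p.+1%:R)^-1; have e0 : 0 < e by rewrite invr_gt0 ltr0n.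
  have /choice[mq hmq] : forall q, exists m, forall k,
      \sum_(m <= l < m + k) v l <= (q.+1%:R ^+ 2)^-1.
    by move=> q; apply: tail_small; rewrite invr_gt0 exprn_gt0// ltr0n.
  pose out : set R := ~` `]- e, e[%classic.
  have outE (z : R) : \1_out z = (e <= `|z|)%R%:R :> R.
    rewrite indicE /out; congr (_ : bool)%:R; apply/idP/idP.
      by rewrite in_setC mem_setE in_itv /= -ltr_norml -leNgt.
    by rewrite in_setC mem_setE in_itv /= -ltr_norml -leNgt.
  pose f q K w : R := \1_out (stopped_sum e (mq q) K w).
  have mf q K : all_moments P (f q K).
    apply: (@all_moments_bounded _ _ _ _ _ 1) => [|w].
      apply: measurableT_comp; last exact: (all_moments_stopped e (mq q) K).1.
      by apply: measurable_indic; apply: measurableC; exact: measurable_itv.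
    by rewrite /f outE; case: (e <= _); rewrite ?normr1 ?normr0.
  have f0 q K w : 0 <= f q K w by rewrite /f outE ler0n.
  have Ef q K : Ex P (f q K) <= (e ^+ 2)^-1 * (q.+1%:R ^+ 2)^-1.
    have ms := all_momentsX 2 (all_moments_stopped e (mq q) K).
    apply: (@le_trans _ _ (Ex P (fun w => (e ^+ 2)^-1 * stopped_sum e (mq q) K w ^+ 2))).
      apply: Ex_le => //; first exact: all_momentsZ.
      move=> w; rewrite /f outE; have [h|h] := leP e `|stopped_sum e (mq q) K w|; last first.
        by rewrite mulr_ge0 ?sqr_ge0 ?invr_ge0// sqr_ge0.
      rewrite mulrC ler_pdivlMr ?exprn_gt0// mul1r -(real_normK (num_real (stopped_sum _ _ _ _))).
      by rewrite lerXn2r// nnegrE ltW.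
    rewrite ExZ// ler_wpM2l ?invr_ge0 ?sqr_ge0//.
    by apply: le_trans (stopped_sum_var _ _ _) _ => //; exact: hmq.
  have uB n : \sum_(q < n) (e ^+ 2)^-1 * (q.+1%:R ^+ 2)^-1 <= (e ^+ 2)^-1 * 2.
    by rewrite -mulr_sumr ler_wpM2l ?invr_ge0 ?sqr_ge0// sum_inv_sqr.
  have := fatou_cvg0 mf f0 Ef uB; apply: filterS => w hw.
  have f1 q K : f q K w <= 1 by rewrite /f outE; case: (e <= _).
  (* An exit is permanent, so the indicator increases with [K]; a limit below 1 means that no exit
     occurs at any time. *)
  have ndf q : nondecreasing_seq (fun K => f q K w).
    apply/nondecreasing_seqP => K; rewrite /f !outE ler_nat.
    by have [/stopped_sum_exit ->|//] := leP e `|stopped_sum e (mq q) K w|.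
  have cf q : cvgn (fun K => f q K w).
    by apply: nondecreasing_is_cvgn => //; exists 1 => _ [K _ <-].
  have g0 : (fun q => limn (fun K => f q K w)) @ \oo --> (0 : R) by apply: hw => q; exact: cf.
  have [q _ /(_ q (leqnn q)) /= hq] : \forall q \near \oo, limn (fun K => f q K w) < 1.
    by apply: (cvgr_lt _ g0).
  exists (mq q) => k.
  have : f q k w < 1 by apply: le_lt_trans hq; exact: (nondecreasing_cvgn_le (ndf q) (cf q) k).
  rewrite /f outE; have [_|h _] := leP e `|stopped_sum e (mq q) k w|; first by rewrite ltxx.
  by rewrite -(stopped_sum_inside h).
have := ae_foralln main; apply: filterS => w hw.
apply/cauchy_cvgP/cauchy_seriesP => e e0.
have [p _ /(_ p (leqnn p)) /= pe] : \forall p \near \oo, (p.+1%:R^-1 : R) < e / 2.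
  by apply: (cvgr_lt _ (@cvg_harmonic R)); rewrite divr_gt0.
have [m hm] := hw p.
have h n : (m <= n)%N -> `|\sum_(m <= l < n) Y l w| < e / 2.
  by move=> mn; apply: lt_trans pe; rewrite -(subnKC mn).
near=> n.
have mn1 : (m <= n.1)%N by near: n; exists ([set k | (m <= k)%N], setT) => //=;
  [by split; [exists m|exact: filterT]|case=> ? ? []].
have mn2 : (m <= n.2)%N by near: n; exists (setT, [set k | (m <= k)%N]) => //=;
  [by split; [exact: filterT|exists m]|case=> ? ? []].
have [n12|n21] := leqP n.1 n.2; last by rewrite big_geq ?normr0// ltnW.
have -> : \sum_(n.1 <= k < n.2) Y k w = \sum_(m <= k < n.2) Y k w - \sum_(m <= k < n.1) Y k w.
  by rewrite [in RHS](big_cat_nat (n := n.1))//= addrAC subrr add0r.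
apply: le_lt_trans (ler_normB _ _) _; have := h _ mn1; have := h _ mn2; lra.
Unshelve. all: by end_near. Qed.

End kolmogorov.

(** * Gaussian moments *)

Section gaussian_moments.
Context (R : realType).
Local Notation mu := (@lebesgue_measure R).

(** Boundedness provides the integrability for the Radon-Nikodym change of measure;
    [integral_truncated] reaches unbounded functions by monotone convergence. *)
Lemma integral_normal_prob_bounded (m s K : R) (f : R -> R) : s != 0 ->
  measurable_fun [set: R] f -> (forall x, 0 <= f x <= K) ->
  (\int[normal_prob m s]_x (f x)%:E = \int[mu]_x (f x * normal_pdf m s x)%:E)%E.
Proof.
move=> s0 mf fK.
have finf : (normal_prob m s).-integrable [set: R] (fun x => (f x)%:E).
  apply: measurable_bounded_integrable => //.
    by rewrite /= probability_setT ltry.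
  exists K; split; first exact: num_real.
  move=> x Kx y _ /=; have /andP[f0 fk] := fK y.
  by rewrite ger0_norm//; apply: le_trans fk _; exact: ltW.
rewrite -(Radon_Nikodym_change_of_variables (normal_prob_dominates m s))//.
apply: ae_eq_integral => //.
- apply: emeasurable_funM; first exact/measurable_EFinP.
  apply: (measurable_int mu).
  by apply: Radon_Nikodym_integrable; exact: normal_prob_dominates.
- apply/measurable_EFinP; apply: measurable_funM => //; exact: measurable_normal_pdf.
- under [X in ae_eq _ _ _ X]eq_fun do rewrite EFinM.
  apply: ae_eqe_mul2l => /=.
  rewrite Radon_NikodymE//=; first exact: normal_prob_dominates.
  move=> abmu; case: cid => /= h [h1 h2 h3].
  apply: integral_ae_eq => //=.
  + by apply/measurable_EFinP; exact: measurable_normal_pdf.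
  + by move=> E E01 mE; rewrite -h3.
Qed.

Lemma pow_le_exp (p : nat) (y : R) : 0 <= y -> y ^+ p <= p`!%:R * expR y.
Proof.
move=> y0; case: p => [|p].
  by rewrite expr0 fact0 mul1r -[leLHS]expR0 ler_expR.
have := expR_ge1Dxn p y0; have f0 : 0 < p.+1`!%:R :> R by rewrite ltr0n fact_gt0.
move=> h; rewrite mulrC -ler_pdivrMr//; lra.
Qed.

(* Moments are controlled through the normalization of the law of parameter
   [2 * s]: crude bounds are enough, no exact Gaussian moment is computed. *)
Lemma normal_pdf_moment (m s x : R) (p : nat) : 0 < s ->
  (x - m) ^+ (p * 2) * normal_pdf m s x <=
  (2 * p`!%:R * (8 / 3) ^+ p) * (s ^+ 2) ^+ p * normal_pdf m (2 * s) x.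
Proof.
move=> s0; have s20 : 2 * s != 0 by rewrite mulf_neq0 ?gt_eqF.
rewrite !normal_pdfE ?gt_eqF ?mulr_gt0//= /normal_fun.
have -> : normal_peak s = 2 * normal_peak (2 * s).
  rewrite /normal_peak (_ : (2 * s) ^+ 2 * pi *+ 2 = 2 ^+ 2 * (s ^+ 2 * pi *+ 2)); last by ring.
  by rewrite sqrtrM ?sqr_ge0// sqrtr_sqr ger0_norm// invfM mulrA divff ?pnatr_eq0// mul1r.
set q := normal_peak _; have q0 : 0 <= q by exact: normal_peak_ge0.
(* The exponent splits by 1/(2 s^2) = 1/(8 s^2) + 3/(8 s^2): the first part belongs to the density
   of parameter 2 s, the second absorbs the power. *)
pose y := 3 * (x - m) ^+ 2 / (8 * s ^+ 2).
have y0 : 0 <= y by rewrite divr_ge0// mulr_ge0// sqr_ge0.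
have -> : - (x - m) ^+ 2 / (s ^+ 2 *+ 2) = - y + - (x - m) ^+ 2 / ((2 * s) ^+ 2 *+ 2).
  by rewrite /y; field; rewrite gt_eqF.
have -> : (x - m) ^+ (p * 2) = (8 / 3) ^+ p * (s ^+ 2) ^+ p * y ^+ p.
  rewrite -!exprMn mulnC exprM; congr (_ ^+ p); rewrite /y; field; rewrite gt_eqF//.
rewrite expRD; move: (expR (- _ / _)) (expR_ge0 (- (x - m) ^+ 2 / ((2 * s) ^+ 2 *+ 2))) => g g0.
have hy : y ^+ p * expR (- y) <= p`!%:R.
  have := pow_le_exp p y0; rewrite -ler_pdivrMr ?expR_gt0// expRN.
  done.
have c0 : 0 <= (8 / 3) ^+ p * (s ^+ 2) ^+ p * 2 * q * g.
  by do 4 apply: mulr_ge0 => //; apply: exprn_ge0; rewrite ?sqr_ge0// divr_ge0.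
have -> : (8 / 3) ^+ p * (s ^+ 2) ^+ p * y ^+ p * (2 * q * (expR (- y) * g)) =
  ((8 / 3) ^+ p * (s ^+ 2) ^+ p * 2 * q * g) * (y ^+ p * expR (- y)) by ring.
have -> : 2 * p`!%:R * (8 / 3) ^+ p * (s ^+ 2) ^+ p * (q * g) =
  ((8 / 3) ^+ p * (s ^+ 2) ^+ p * 2 * q * g) * p`!%:R by ring.
by rewrite ler_wpM2l.
Qed.

(** The density is at most 1 / (2 s), because pi >= 2, and the interval has length [s]. Being valid
    for every mean [m], this controls [s] by the second moment. *)
Lemma normal_small_ball (m s : R) : 0 < s ->
  (normal_prob m s `](- (s / 2))%R, (s / 2)%R[%classic <= (1 / 2)%:E)%E.
Proof.
move=> s0; have sn0 : s != 0 by rewrite gt_eqF.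
apply: (@le_trans _ _ (\int[mu]_(x in `](- (s / 2))%R, (s / 2)%R[) (normal_peak s)%:E)%E).
  apply: ge0_le_integral => //.
  - by move=> x _; rewrite lee_fin normal_pdf_ge0.
  - by apply: measurable_funTS; apply/measurable_EFinP; exact: measurable_normal_pdf.
  - by move=> x _; rewrite lee_fin normal_pdf_ub.
rewrite integral_cst//= lebesgue_measure_itv/= lte_fin.
rewrite ifT; last by rewrite gtrN// divr_gt0.
rewrite -EFinB -EFinM lee_fin opprK -splitr /normal_peak.
have pi0 := pi_ge2 R.
have r2 : 2 * s <= Num.sqrt (s ^+ 2 * pi *+ 2).
  have -> : 2 * s = Num.sqrt ((2 * s) ^+ 2).
    by rewrite sqrtr_sqr ger0_norm// mulr_ge0// ltW.
  apply: ler_wsqrtr.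
  have := sqr_ge0 s; rewrite exprMn -mulr_natr; nra.
rewrite mulrC ler_pdivrMr; last by apply: lt_le_trans r2; rewrite mulr_gt0.
lra.
Qed.

Section moments_bound.
Context d (T : measurableType d) (P : probability T R).

Lemma integral_truncated (f : T -> R) (c : R) : measurable_fun [set: T] f ->
  (forall w, 0 <= f w) ->
  (forall k, (\int[P]_w (Num.min (f w) k%:R)%:E <= c%:E)%E) ->
  (\int[P]_w (f w)%:E <= c%:E)%E.
Proof.
move=> mf f0 h; pose g k : T -> \bar R := fun w => (Num.min (f w) k%:R)%:E.
have mg k : measurable_fun [set: T] (g k).
  by apply/measurable_EFinP; apply: measurable_minr => //; exact: measurable_cst.
have g0 k w : setT w -> (0 <= g k w)%E by rewrite lee_fin le_min f0 ler0n.
have ndg w : setT w -> {homo g ^~ w : n k / (n <= k)%N >-> (n <= k)%E}.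
  move=> _ n k nk; rewrite lee_fin le_min !ge_min lexx /= ; apply/orP; right.
  by rewrite ler_nat.
have gf w : limn (g ^~ w) = (f w)%:E.
  apply/cvg_lim => //; apply: cvg_near_cst; near=> k.
  rewrite /g min_l//; near: k; exists (Num.truncn (f w)).+1 => // k /= fk.
  by apply: ltW; apply: lt_le_trans (truncnS_gt _) _; rewrite ler_nat.
have cv : (\int[P]_w g k w @[k --> \oo] --> \int[P]_w (f w)%:E)%E.
  rewrite (eq_integral (fun w => limn (g ^~ w))) => [|w _]; last by rewrite gf.
  exact: cvg_monotone_convergence.
rewrite -(cvg_lim _ cv)//; apply: lime_le.
  by apply/cvg_ex; eexists; exact: cv.
exact: nearW.
Unshelve. all: by end_near. Qed.

Lemma integral_law (nu : {measure set (measurableTypeR R) -> \bar R}) (X : T -> R) (f : R -> R) :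
  @measurable_fun _ _ T (measurableTypeR R) [set: T] X ->
  (forall A : set (measurableTypeR R), measurable A -> P (X @^-1` A) = nu A) ->
  measurable_fun [set: R] f -> (forall x, 0 <= f x) ->
  (\int[P]_w (f (X w))%:E = \int[nu]_x (f x)%:E)%E.
Proof.
move=> mX lawX mf f0.
pose F : {mfun T >-> measurableTypeR R} :=
  HB.pack X (@isMeasurableFun.phant_Build _ _ T (measurableTypeR R) X mX).
have mf' : measurable_fun [set: measurableTypeR R] (fun x => (f x)%:E).
  exact/measurable_EFinP.
transitivity (\int[distribution P F]_x (f x)%:E)%E.
  by rewrite ge0_integral_distribution// => x; rewrite lee_fin.
by apply: eq_measure_integral => A mA _; exact: lawX.
Qed.

(** The factor of [normal_pdf_moment], with [s ^+ 2] replaced by the bound 8 of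
    [normal_scale_bound]. *)
Definition normal_moment_bound (q : nat) : R := 2 * q`!%:R * (8 / 3) ^+ q * 8 ^+ q.

Lemma normal_moment_bound_ge0 q : 0 <= normal_moment_bound q.
Proof.
by apply: mulr_ge0; [apply: mulr_ge0; [exact: mulr_ge0|]|]; apply: exprn_ge0;
  rewrite ?divr_ge0.
Qed.

(** |X| is at least s / 2 with probability at least 1/2, so s^2 / 8 is at most the second moment. *)
Lemma normal_scale_bound (X : T -> R) (m s : R) : 0 < s ->
  @measurable_fun _ _ T (measurableTypeR R) [set: T] X ->
  (forall A : set (measurableTypeR R), measurable A -> P (X @^-1` A) = normal_prob m s A) ->
  (\int[P]_w ((X w) ^+ 2)%:E <= 1)%E -> s ^+ 2 <= 8.
Proof.
move=> s0 mX lawX X2; pose E := ~` (X @^-1` `](- (s / 2))%R, (s / 2)%R[%classic).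
have mB : measurable (X @^-1` `](- (s / 2))%R, (s / 2)%R[%classic).
  by rewrite -[X in measurable X]setTI; apply: mX => //; exact: measurable_itv.
have mE : measurable E by exact: measurableC.
have PE : ((1 / 2)%:E <= P E)%E.
  rewrite probability_setC// lawX; last exact: measurable_itv.
  apply: (@le_trans _ _ (1 - (1 / 2)%:E)%E); last first.
    by rewrite leeB//; exact: normal_small_ball.
  by rewrite -EFinB lee_fin; lra.
have mX2 : measurable_fun [set: T] (fun w => ((X w) ^+ 2)%:E).
  by apply/measurable_EFinP; exact: measurable_funX.
have h : ((s ^+ 2 / 4)%:E * P E <= 1)%E.
  apply: le_trans X2.
  apply: (@le_trans _ _ (\int[P]_(w in E) ((X w) ^+ 2)%:E)%E); last first.
    by apply: ge0_subset_integral => // w _; rewrite lee_fin sqr_ge0.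
  rewrite -[leLHS]integral_cst//; apply: ge0_le_integral => //.
  - by move=> w _; rewrite lee_fin divr_ge0 ?sqr_ge0.
  - exact: measurable_funTS.
  - move=> w; rewrite /E /= in_itv /= -ltr_norml => /negP; rewrite -leNgt => Xw.
    rewrite lee_fin -(real_normK (num_real (X w))).
    have -> : s ^+ 2 / 4 = (s / 2) ^+ 2 by field.
    by rewrite lerXn2r// nnegrE divr_ge0// ltW.
have : ((s ^+ 2 / 4)%:E * (1 / 2)%:E <= 1)%E.
  by apply: le_trans h; rewrite lee_wpmul2l// lee_fin divr_ge0 ?sqr_ge0.
by rewrite -EFinM lee_fin; lra.
Qed.

Lemma normal_centered_moment (X : T -> R) (m s : R) (q : nat) : 0 < s -> s ^+ 2 <= 8 ->
  @measurable_fun _ _ T (measurableTypeR R) [set: T] X ->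
  (forall A : set (measurableTypeR R), measurable A -> P (X @^-1` A) = normal_prob m s A) ->
  (\int[P]_w ((X w - m) ^+ (q * 2))%:E <= (normal_moment_bound q)%:E)%E.
Proof.
move=> s0 s8 mX lawX; have sn0 : s != 0 by rewrite gt_eqF.
have pow0 (x : R) : 0 <= x ^+ (q * 2) by rewrite exprM sqr_ge0.
have mpow : measurable_fun [set: R] (fun x : R => (x - m) ^+ (q * 2)).
  by apply: measurable_funX; apply: measurable_funB => //; exact: measurable_cst.
apply: integral_truncated => // [|k].
  by apply: (measurableT_comp mpow); exact: mX.
pose f (x : R) := Num.min ((x - m) ^+ (q * 2)) k%:R.
have f0 x : 0 <= f x by rewrite le_min pow0 ler0n.
have mf : measurable_fun [set: R] f by apply: measurable_minr => //; exact: measurable_cst.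
rewrite (integral_law mX lawX mf f0).
rewrite (@integral_normal_prob_bounded m s k%:R f)//; last first.
  by move=> x; rewrite f0 ge_min lexx orbT.
have c0 : 0 <= 2 * q`!%:R * (8 / 3) ^+ q * (s ^+ 2) ^+ q :> R.
  by apply: mulr_ge0; [apply: mulr_ge0; [exact: mulr_ge0|]|]; apply: exprn_ge0;
    rewrite ?sqr_ge0// divr_ge0.
have mpdf a : measurable_fun [set: measurableTypeR R] (fun x => (normal_pdf m a x)%:E).
  by apply/measurable_EFinP; exact: measurable_normal_pdf.
apply: (@le_trans _ _ (\int[mu]_x ((2 * q`!%:R * (8 / 3) ^+ q * (s ^+ 2) ^+ q)%:E *
    (normal_pdf m (2 * s) x)%:E))%E).
  apply: ge0_le_integral => //.
  - by move=> x _; rewrite lee_fin mulr_ge0// normal_pdf_ge0.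
  - by apply/measurable_EFinP; apply: measurable_funM => //; exact: measurable_normal_pdf.
  - exact: measurable_funeM.
  - move=> x _; rewrite -EFinM lee_fin; apply: le_trans (normal_pdf_moment m x q s0).
    by rewrite ler_wpM2r ?normal_pdf_ge0// ge_min lexx.
rewrite ge0_integralZl_EFin//; last by move=> x _; rewrite lee_fin normal_pdf_ge0.
rewrite integral_normal_pdf mule1 lee_fin /normal_moment_bound.
apply: ler_wpM2l; last by rewrite lerXn2r// ?nnegrE ?sqr_ge0.
by apply: mulr_ge0; [exact: mulr_ge0|apply: exprn_ge0; rewrite divr_ge0].
Qed.

(** The constant is uniform over all Gaussian variables of second moment at most 1, as infinitely
    many entries have to be bounded at once. *)
Lemma gaussian_moment (p : nat) : exists2 c : R, 0 <= c &
  forall X : T -> R, real_gaussian P X -> (\int[P]_w ((X w) ^+ 2)%:E <= 1)%E ->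
    (\int[P]_w (`|X w| ^+ p)%:E <= c%:E)%E.
Proof.
(* [M] bounds the squared mean, by integrating m^2 <= 2 X^2 + 2 (X - m)^2. *)
pose b q := normal_moment_bound q; pose M := 2 + 2 * b 1%N.
have b0 q : 0 <= b q := normal_moment_bound_ge0 q.
have M0 : 0 <= M by rewrite addr_ge0// mulr_ge0.
have c0 : 0 <= 2 ^+ (p * 2) * (b p + M ^+ p).
  by rewrite mulr_ge0 ?exprn_ge0// addr_ge0// exprn_ge0.
exists (1 + 2 ^+ (p * 2) * (b p + M ^+ p)); first by rewrite addr_ge0.
move=> X [mX [m [s [s0 lawX]]]] X2.
have mabs (f : T -> R) k : measurable_fun [set: T] f ->
    measurable_fun [set: T] (fun w => `|f w| ^+ k).
  move=> mf; apply: measurable_funX; apply: measurableT_comp => //; exact: normr_measurable.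
have mX' : measurable_fun [set: T] X by exact: mX.
(* In the degenerate case the law is the Dirac mass at [m], and the second moment gives |m| <= 1. *)
have [s00|sn0] := eqVneq s 0.
  pose nu : {measure set (measurableTypeR R) -> \bar R} := \d_(m : measurableTypeR R).
  have lawX' (A : set (measurableTypeR R)) : measurable A -> P (X @^-1` A) = nu A.
    by move=> mA; rewrite lawX// /gaussian_law s00 eqxx.
  have msqr : measurable_fun [set: R] (fun x : R => x ^+ 2) by exact: measurable_funX.
  have mpow : measurable_fun [set: R] (fun x : R => `|x| ^+ p).
    by apply: measurable_funX; exact: normr_measurable.
  move: X2; rewrite (integral_law mX lawX' msqr) => [|x]; last exact: sqr_ge0.
  rewrite (integral_law mX lawX' mpow) => [|x]; last exact: exprn_ge0.
  rewrite /nu !integral_dirac//; try exact/measurable_EFinP.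
  rewrite diracT !mul1e !lee_fin -(real_normK (num_real m)) => m2.
  have m1 : `|m| <= 1 by rewrite -(@ler_pXn2r _ 2)// ?nnegrE// expr1n.
  apply: (@le_trans _ _ 1); last by rewrite lerDl.
  by rewrite exprn_ile1.
have {}s0 : 0 < s by rewrite lt0r sn0.
have {}lawX (A : set (measurableTypeR R)) : measurable A -> P (X @^-1` A) = normal_prob m s A.
  by move=> mA; rewrite lawX// /gaussian_law (negbTE sn0).
have s8 := normal_scale_bound s0 mX lawX X2.
have hb q := normal_centered_moment q s0 s8 mX lawX.
have mXm : measurable_fun [set: T] (fun w => X w - m).
  by apply: measurable_funB => //; exact: measurable_cst.
have mM : m ^+ 2 <= M.
  have h : ((m ^+ 2)%:E <= \int[P]_w ((2%:E * ((X w) ^+ 2)%:E) + (2%:E * ((X w - m) ^+ 2)%:E)))%E.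
    have -> : (m ^+ 2)%:E = (\int[P]_w (m ^+ 2)%:E)%E.
      by rewrite integral_cst//= probability_setT mule1.
    apply: ge0_le_integral => //.
    - by move=> w _; rewrite lee_fin sqr_ge0.
    - by apply: emeasurable_funD; apply: measurable_funeM; apply/measurable_EFinP;
        exact: measurable_funX.
    - move=> w _; rewrite -!EFinM -EFinD lee_fin.
      have := sqr_ge0 (2 * X w - m); rewrite -subr_ge0 => h; nra.
  rewrite -lee_fin; apply: le_trans h _.
  have mf (f : T -> R) : measurable_fun [set: T] f ->
      measurable_fun [set: T] (fun w => ((f w) ^+ 2)%:E).
    by move=> mf; apply/measurable_EFinP; exact: measurable_funX.
  rewrite ge0_integralD//; try (by move=> w _; rewrite -EFinM lee_fin mulr_ge0// sqr_ge0);
    try (by apply: measurable_funeM; exact: mf).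
  rewrite !ge0_integralZl_EFin//; try (by move=> w _; rewrite lee_fin sqr_ge0); try exact: mf.
  have h1 := hb 1%N; rewrite mul1n in h1.
  have -> : M%:E = (2%:E + 2%:E * (b 1%N)%:E)%E by rewrite -EFinM -EFinD.
  apply: leeD; last by rewrite lee_wpmul2l// lee_fin.
  by rewrite -[leRHS]mule1 lee_wpmul2l// lee_fin.
(* |X|^p <= 1 + |X|^(2p) reduces to an even power, which is then split around the mean. *)
apply: (@le_trans _ _ (\int[P]_w (1 + (2 ^+ (p * 2))%:E *
    (((X w - m) ^+ (p * 2))%:E + (M ^+ p)%:E)))%E).
  apply: ge0_le_integral => //.
  - by apply/measurable_EFinP; exact: mabs.
  - apply: emeasurable_funD; first exact: measurable_cst.
    apply: measurable_funeM; apply: emeasurable_funD; last exact: measurable_cst.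
    by apply/measurable_EFinP; exact: measurable_funX.
  - move=> w _; rewrite [X in (_ <= X)%E](_ : _ =
      (1 + 2 ^+ (p * 2) * ((X w - m) ^+ (p * 2) + M ^+ p))%:E)// lee_fin.
    have e1 : `|X w| ^+ p <= 1 + `|X w| ^+ (p * 2).
      rewrite exprM; have : 0 <= `|X w| ^+ p by rewrite exprn_ge0.
      by move: (_ ^+ p) => a; nra.
    apply: le_trans e1 _; rewrite lerD2l.
    apply: (@le_trans _ _ ((`|X w - m| + `|m|) ^+ (p * 2))).
      by rewrite lerXn2r ?nnegrE ?addr_ge0// -[in leLHS](subrK m (X w)) ler_normD.
    apply: le_trans (powD_le _ (normr_ge0 _) (normr_ge0 _)) _.
    rewrite ler_wpM2l ?exprn_ge0//; apply: lerD.
      by rewrite -normrX ger0_norm// exprM sqr_ge0.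
    rewrite mulnC exprM real_normK ?num_real// lerXn2r// nnegrE ?sqr_ge0//.
have mc : measurable_fun [set: T] (fun w => ((X w - m) ^+ (p * 2))%:E).
  by apply/measurable_EFinP; exact: measurable_funX.
have pos w : (0 <= ((X w - m) ^+ (p * 2))%:E)%E by rewrite lee_fin exprM sqr_ge0.
have mc' : measurable_fun [set: T] (fun w => (((X w - m) ^+ (p * 2))%:E + (M ^+ p)%:E)%E).
  by apply: emeasurable_funD => //; exact: measurable_cst.
have pos' w : (0 <= ((X w - m) ^+ (p * 2))%:E + (M ^+ p)%:E)%E.
  by rewrite adde_ge0// lee_fin exprn_ge0.
rewrite ge0_integralD//; last 2 first.
- by move=> w _; rewrite mule_ge0// lee_fin exprn_ge0.
- exact: measurable_funeM.
rewrite integral_cst//= probability_setT mule1 EFinD leeD2l//.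
rewrite ge0_integralZl_EFin// ?exprn_ge0//.
rewrite EFinM lee_wpmul2l ?lee_fin ?exprn_ge0//.
rewrite ge0_integralD//; last by move=> w _; rewrite lee_fin exprn_ge0.
by rewrite integral_cst//= probability_setT mule1 EFinD leeD2r.
Qed.

End moments_bound.
End gaussian_moments.

(** * Moments of sums of independent variables *)

Section independent_sums.
Context d (T : measurableType d) (R : realType) (P : probability T R).

Lemma all_moments_dominated (f g : T -> R) : measurable_fun [set: T] f ->
  all_moments P g -> (forall w, `|f w| <= `|g w|) -> all_moments P f.
Proof.
move=> mf [mg hg] fg; split=> // p; apply: le_lt_trans (hg p).
have mabs (h : T -> R) : measurable_fun [set: T] h ->
    measurable_fun [set: T] (EFin \o ((fun w => `|h w| ^+ p) : T -> R)).
  move=> mh; apply/measurable_EFinP; apply: measurable_funX.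
  by apply: measurableT_comp => //; exact: normr_measurable.
apply: ge0_le_integral => //; try exact: mabs.
by move=> w _; rewrite lee_fin lerXn2r// nnegrE.
Qed.

Context (I : eqType) (X : I -> T -> R[i]).
Context (X_meas : forall i, complex_rv (X i)).
Context (X_indep : mutually_independent P (fun i => sigma_rv (X i))).
Context (S : nat -> set I) (S_disj : forall l l', l != l' -> S l `&` S l' = set0).
Context (Y : nat -> T -> R) (v : nat -> R).
Context (mY : forall l, all_moments P (Y l)) (aY : forall l, adapted X (S l) (Y l)).
Context (Y_centered : forall l, Ex P (Y l) = 0).
Context (Y_var : forall l, Ex P (fun w => Y l w ^+ 2) <= v l).
Context (Y_fourth : forall l, Ex P (fun w => Y l w ^+ 4) <= v l ^+ 2).

Let U m k w := \sum_(m <= l < m + k) Y l w.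

Lemma all_moments_range m k : all_moments P (U m k).
Proof. exact: all_moments_sum. Qed.

Lemma adapted_range m k : adapted X (\bigcup_(l in `I_(m + k)%N) S l) (U m k).
Proof.
elim: k => [|k IH].
  have -> : U m 0 = (fun=> 0) by apply/funext => w; rewrite /U addn0 big_geq.
  exact: measurable_cst.
have IH' : adapted X (\bigcup_(l in `I_(m + k.+1)%N) S l) (U m k).
  by apply: adapted_sub IH => i [l /= lk Sl]; exists l => //=; rewrite addnS ltnW.
have aY' : adapted X (\bigcup_(l in `I_(m + k.+1)%N) S l) (Y (m + k)%N).
  by apply: (adapted_sub _ (@aY (m + k)%N)) => i Si; exists (m + k)%N => //=; rewrite addnS.
have -> : U m k.+1 = (fun w => U m k w + Y (m + k)%N w).
  by apply/funext => w; rewrite /U addnS big_nat_recr ?leq_addr.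
exact: measurable_funD.
Qed.

(** Induction on [k]: the cross terms with a first power vanish, and 3 V^2 + 6 V v + v^2 <= 3 (V +
    v)^2. *)
Lemma range_moments m k : let V := \sum_(m <= l < m + k) v l in
  [/\ Ex P (U m k) = 0, Ex P (fun w => U m k w ^+ 2) <= V &
      Ex P (fun w => U m k w ^+ 4) <= 3 * V ^+ 2].
Proof.
move=> /=; elim: k => [|k [IH1 IH2 IH4]].
  have -> : U m 0 = (fun=> 0) by apply/funext => w; rewrite /U addn0 big_geq.
  by rewrite !Ex_cst addn0 big_geq// !expr0n /= mulr0.
have UE : U m k.+1 = (fun w => U m k w + Y (m + k)%N w).
  by apply/funext => w; rewrite /U addnS big_nat_recr ?leq_addr.
have mU := all_moments_range m k; have mYk := mY (m + k)%N.
have fact a b : Ex P (fun w => U m k w ^+ a * Y (m + k)%N w ^+ b) =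
    Ex P (fun w => U m k w ^+ a) * Ex P (fun w => Y (m + k)%N w ^+ b).
  apply: (@Ex_adapted _ _ _ _ _ _ X_meas X_indep (\bigcup_(l in `I_(m + k)%N) S l) (S (m + k)%N)).
  - rewrite setI_bigcupl bigcup0// => l /= lk.
    by apply: S_disj; rewrite ltn_eqF.
  - exact: all_momentsX.
  - exact: all_momentsX.
  - by apply: measurable_funX; exact: adapted_range.
  - by apply: measurable_funX; exact: aY.
have V0 : 0 <= \sum_(m <= l < m + k) v l.
  by apply: le_trans IH2; apply: Ex_ge0 => w; exact: sqr_ge0.
have v0 := le_trans (Ex_ge0 P (fun w => sqr_ge0 (Y (m + k)%N w))) (Y_var (m + k)%N).
have mab a b : all_moments P (fun w => U m k w ^+ a * Y (m + k)%N w ^+ b).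
  by apply: all_momentsM; exact: all_momentsX.
have Y1 : Ex P (fun w => Y (m + k)%N w ^+ 1) = 0 := Y_centered _.
have U1 : Ex P (fun w => U m k w ^+ 1) = 0 := IH1.
rewrite UE addnS big_nat_recr ?leq_addr//=; split.
- by rewrite ExD// IH1 Y_centered addr0.
- have E w : (U m k w + Y (m + k)%N w) ^+ 2 = U m k w ^+ 2 +
      (2 * (U m k w ^+ 1 * Y (m + k)%N w ^+ 1) + Y (m + k)%N w ^+ 2) by ring.
  under eq_fun do rewrite E.
  rewrite ExD; [|exact: all_momentsX|by apply: all_momentsD; [exact: all_momentsZ|exact: all_momentsX]].
  rewrite ExD; [|exact: all_momentsZ|exact: all_momentsX].
  by rewrite ExZ// fact Y1 !mulr0 add0r lerD.
- have E w : (U m k w + Y (m + k)%N w) ^+ 4 = U m k w ^+ 4 +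
      (4 * (U m k w ^+ 3 * Y (m + k)%N w ^+ 1) + (6 * (U m k w ^+ 2 * Y (m + k)%N w ^+ 2) +
      (4 * (U m k w ^+ 1 * Y (m + k)%N w ^+ 3) + Y (m + k)%N w ^+ 4))) by ring.
  under eq_fun do rewrite E.
  have m4 : all_moments P (fun w => Y (m + k)%N w ^+ 4) by exact: all_momentsX.
  have m3 : all_moments P (fun w => 4 * (U m k w ^+ 1 * Y (m + k)%N w ^+ 3) + Y (m + k)%N w ^+ 4).
    by apply: all_momentsD => //; exact: all_momentsZ.
  have m2 : all_moments P (fun w => 6 * (U m k w ^+ 2 * Y (m + k)%N w ^+ 2) +
      (4 * (U m k w ^+ 1 * Y (m + k)%N w ^+ 3) + Y (m + k)%N w ^+ 4)).
    by apply: all_momentsD => //; exact: all_momentsZ.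
  rewrite ExD; [|exact: all_momentsX|by apply: all_momentsD => //; exact: all_momentsZ].
  rewrite ExD//; last exact: all_momentsZ.
  rewrite ExD//; last exact: all_momentsZ.
  rewrite ExD//; last exact: all_momentsZ.
  rewrite !ExZ// !fact Y1 U1 mul0r !mulr0 !add0r.
  have := Y_fourth (m + k)%N; have := Y_var (m + k)%N.
  have := Ex_ge0 P (fun w => sqr_ge0 (Y (m + k)%N w)).
  have := Ex_ge0 P (fun w => sqr_ge0 (U m k w)).
  set a := Ex P (fun w => U m k w ^+ 4) in IH4 *.
  set b := Ex P (fun w => U m k w ^+ 2) in IH2 *.
  set c := Ex P (fun w => Y _ w ^+ 2).
  set e := Ex P (fun w => Y _ w ^+ 4).
  move: (\sum_(_ <= _ < _) _) (v _) V0 v0 IH2 IH4 => V u V0 u0 bV aV b0 c0 cu eu.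
  have bc : b * c <= V * u by exact: ler_pM.
  have := sqr_ge0 u; nra.
Qed.

End independent_sums.

(** * Complex Gaussian entries *)

Section gaussian_entries.
Context d (T : measurableType d) (R : realType) (P : probability T R).
Local Notation C := R[i].
Local Notation cRe := (@complex.Re R).
Local Notation cIm := (@complex.Im R).

(** Each part has second moment at most that of |Z|, so the real bound applies to both, with a
    constant common to all entries. *)
Lemma gaussian_entry_moment (p : nat) : exists2 c : R, 0 <= c &
  forall Z : T -> C, real_gaussian P (fun w => cRe (Z w)) ->
    real_gaussian P (fun w => cIm (Z w)) ->
    (\int[P]_w (absq (Z w))%:E = 1)%E ->
    call_moments P Z /\ Ex P (fun w => absq (Z w) ^+ p) <= c.
Proof.
have [c c0 hc] := gaussian_moment P (p * 2).
exists (2 ^+ p * (c + c)); first by rewrite mulr_ge0 ?exprn_ge0// addr_ge0.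
move=> Z gR gI Z2.
have mR : measurable_fun [set: T] (fun w => cRe (Z w)) by exact: gR.1.
have mI : measurable_fun [set: T] (fun w => cIm (Z w)) by exact: gI.1.
have part (f : T -> R) : real_gaussian P f -> (forall w, f w ^+ 2 <= absq (Z w)) ->
    (\int[P]_w ((f w) ^+ 2)%:E <= 1)%E.
  move=> gf fZ; rewrite -Z2; apply: ge0_le_integral => //.
  - by move=> w _; rewrite lee_fin sqr_ge0.
  - by apply/measurable_EFinP; apply: measurable_funX; exact: gf.1.
  - by apply/measurable_EFinP; apply: measurable_funD; exact: measurable_funX.
  - by move=> w _; rewrite lee_fin.
have R2 : (\int[P]_w ((cRe (Z w)) ^+ 2)%:E <= 1)%E.
  by apply: part => // w; rewrite lerDl sqr_ge0.
have I2 : (\int[P]_w ((cIm (Z w)) ^+ 2)%:E <= 1)%E.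
  by apply: part => // w; rewrite lerDr sqr_ge0.
have am (f : T -> R) : real_gaussian P f -> (\int[P]_w ((f w) ^+ 2)%:E <= 1)%E ->
    all_moments P f.
  move=> gf f2; split; first exact: gf.1.
  move=> k; have [ck _ hk] := gaussian_moment P k.
  by apply: le_lt_trans (hk f gf f2) _; rewrite ltry.
have aR := am _ gR R2; have aI := am _ gI I2.
split=> //; apply: (@le_trans _ _ (Ex P (fun w => 2 ^+ p *
    (`|cRe (Z w)| ^+ (p * 2) + `|cIm (Z w)| ^+ (p * 2))))).
  have aX (f : T -> R) k : all_moments P f -> all_moments P (fun w => `|f w| ^+ k).
    move=> af; apply: all_momentsX; apply: (all_moments_dominated _ af) => [|w].
      by apply: measurableT_comp af.1; exact: normr_measurable.
    by rewrite normr_id.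
  apply: Ex_le.
  - by apply: all_momentsX; apply: call_moments_absq.
  - by apply: all_momentsZ; apply: all_momentsD; exact: aX.
  - move=> w; rewrite !(mulnC p) !exprM !real_normK ?num_real//.
    by apply: powD_le; exact: sqr_ge0.
have aX (f : T -> R) : all_moments P f -> all_moments P (fun w => `|f w| ^+ (p * 2)).
  move=> af; apply: all_momentsX; apply: (all_moments_dominated _ af) => [|w].
    by apply: measurableT_comp af.1; exact: normr_measurable.
  by rewrite normr_id.
rewrite ExZ; last by apply: all_momentsD; exact: aX.
rewrite ExD; try exact: aX.
rewrite ler_wpM2l ?exprn_ge0//.
by apply: lerD; rewrite -lee_fin -ExE ?hc//; exact: aX.
Qed.

Lemma complex_gaussian_parts (Z : T -> C) : complex_gaussian P Z ->
  real_gaussian P (fun w => cRe (Z w)) /\ real_gaussian P (fun w => cIm (Z w)).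
Proof.
move=> [_ h]; split; [have := h 1 0|have := h 0 1]; congr real_gaussian; apply/funext => w.
  by rewrite mul1r mul0r addr0.
by rewrite mul1r mul0r add0r.
Qed.

Lemma normsq_absq (z : C) : cRe (`|z| ^+ 2) = absq z.
Proof. by rewrite -add_Re2_Im2. Qed.

Lemma has_expectation_normsq (Z : T -> C) : has_expectation P (fun w => `|Z w| ^+ 2) 1 ->
  (\int[P]_w (absq (Z w))%:E = 1)%E.
Proof.
move=> [+ _]; rewrite unlock => Z1; rewrite -[RHS]Z1.
by apply: eq_integral => w _; rewrite -normsq_absq.
Qed.

Lemma has_expectation0 (Z : T -> C) : has_expectation P Z 0 -> cEx P Z = 0.
Proof.
move=> [h1 h2]; rewrite /cEx /Ex; move: h1 h2; rewrite !unlock /= => -> -> /=.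
by [].
Qed.

(** A nondegenerate real Gaussian has no atom at 0, and a degenerate centered one vanishes almost
    surely; both parts cannot be degenerate when |Z|^2 has mean 1. This gives a meaning to the phase
    of coordinate 0 of a spike. *)
Lemma gaussian_entry_neq0 (Z : T -> C) : complex_gaussian P Z -> cEx P Z = 0 ->
  (\int[P]_w (absq (Z w))%:E = 1)%E -> {ae P, forall w, Z w != 0}.
Proof.
move=> gZ Z0 Z2; have [gR gI] := complex_gaussian_parts gZ.
have atom (f : T -> R) : real_gaussian P f -> Ex P f = 0 ->
    P (f @^-1` [set 0]) = 0%E \/ {ae P, forall w, f w = 0}.
  move=> [mf [m [s [s0 law]]]] f0.
  have [s00|sn0] := eqVneq s 0; last first.
    left; rewrite law; last exact: measurable_set1.
    by rewrite /gaussian_law (negbTE sn0) /normal_prob integral_set1.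
  right; have fm : {ae P, forall w, f w = m}.
    exists (~` (f @^-1` [set m])); split.
    - by apply: measurableC; rewrite -[X in measurable X]setTI; apply: mf => //; exact: measurable_set1.
    - rewrite probability_setC; last first.
        by rewrite -[X in measurable X]setTI; apply: mf => //; exact: measurable_set1.
      rewrite law; last exact: measurable_set1.
      by rewrite /gaussian_law s00 eqxx diracE mem_set// subee.
    - by move=> w /= h1 h2; apply: h1.
  have m0 : m = 0.
    rewrite -f0 /Ex (ae_eq_integral (cst m%:E))//=; first by rewrite integral_cst//= probability_setT mule1.
    - exact/measurable_EFinP.
    - by apply: filterS fm => w -> _.
  by rewrite -m0.
have [R0|R0] := atom _ gR (congr1 (@complex.Re R) Z0).
  exists ((fun w => cRe (Z w)) @^-1` [set 0]); split => //.
    by rewrite -[X in measurable X]setTI; apply: gR.1 => //; exact: measurable_set1.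
  by move=> w /= /negP; rewrite negbK => /eqP ->.
have [I0|I0] := atom _ gI (congr1 (@complex.Im R) Z0).
  exists ((fun w => cIm (Z w)) @^-1` [set 0]); split => //.
    by rewrite -[X in measurable X]setTI; apply: gI.1 => //; exact: measurable_set1.
  by move=> w /= /negP; rewrite negbK => /eqP ->.
exfalso; move: Z2; rewrite (ae_eq_integral (cst 0%E))//=.
- by rewrite integral0 => /eqP; rewrite eq_sym onee_eq0.
- apply/measurable_EFinP; apply: measurable_funD; apply: measurable_funX; [exact: gR.1|exact: gI.1].
- by apply: filterS2 R0 I0 => w h1 h2 _; rewrite /absq h1 h2 !expr0n addr0.
Qed.

End gaussian_entries.

(** * The series of spikes *)

Section spiked_noise.
Context d (T : measurableType d) (R : realType) (P : probability T R).
Local Notation C := R[i].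
Local Notation cRe := (@complex.Re R).
Local Notation cIm := (@complex.Im R).

Lemma cEx_mulJ (Z : T -> C) : cEx P (fun w => Z w * conjc (Z w)) =
  ((Ex P (fun w => absq (Z w)))%:C)%C.
Proof.
have E w : Z w * conjc (Z w) = ((absq (Z w))%:C)%C by rewrite mulrC -absqE.
by rewrite /cEx; under eq_fun do rewrite E; under [in X in (_ +i* X)%C]eq_fun do rewrite E;
   rewrite /= Ex_cst.
Qed.

Context (xi : nat -> nat -> T -> C).
Let X (lj : nat * nat) := xi lj.1 lj.2.
Context (X_meas : forall lj, complex_rv (X lj)).
Context (X_indep : mutually_independent P (fun lj => sigma_rv (X lj))).
Context (xiM : forall l j, call_moments P (xi l j)).
Context (xiE : forall l j, cEx P (xi l j) = 0).
Context (xiV : forall l j, Ex P (fun w => absq (xi l j w)) = 1).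
Context (c : R) (c0 : 0 <= c) (xiB : forall l j, Ex P (fun w => absq (xi l j w) ^+ 4) <= c).

Lemma xi_adapted l j (A : set (nat * nat)) : A (l, j) -> cadapted X A (xi l j).
Proof. exact: (@cadapted_gen _ _ _ _ X A (l, j)). Qed.

Lemma xi_prod l j l' j' : (l, j) != (l', j') ->
  cEx P (fun w => xi l j w * conjc (xi l' j' w)) = 0.
Proof.
move=> h; rewrite (@cEx_adapted _ _ _ _ _ _ X_meas X_indep [set (l, j)] [set (l', j')]).
- by rewrite xiE mul0r.
- by apply/seteqP; split => // -[a b] /= [-> e]; move: h; rewrite e eqxx.
- exact: xiM.
- exact: call_momentsJ.
- exact: xi_adapted.
- by apply: cadaptedJ; exact: xi_adapted.
Qed.

(** Entry of the centered rank-one matrix of spike [l], before weighting by y_l. *)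
Definition pair_dev l j k w : C := xi l j w * conjc (xi l k w) - (j == k)%:R.

Lemma pair_devM l j k : call_moments P (pair_dev l j k).
Proof.
apply: call_momentsB; last exact: call_moments_cst.
by apply: call_momentsM => //; exact: call_momentsJ.
Qed.

Lemma pair_dev_centered l j k : cEx P (pair_dev l j k) = 0.
Proof.
have -> : pair_dev l j k = (fun w => xi l j w * conjc (xi l k w) + (- (j == k)%:R)) by [].
rewrite cExD ?cEx_cst; [|by apply: call_momentsM => //; exact: call_momentsJ|exact: call_moments_cst].
have [<-|jk] := eqVneq j k; first by rewrite cEx_mulJ xiV subrr.
by rewrite xi_prod ?subrr// xpair_eqE eqxx.
Qed.

(** Square |u v - delta|^2 <= 2 |u|^2 |v|^2 + 2; the hypothesis on [c] is a bound on the eighth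
    absolute moments of the xi. *)
Lemma pair_dev_fourth l j k : Ex P (fun w => absq (pair_dev l j k w) ^+ 2) <= 16 * c + 8.
Proof.
have ax l' j' : all_moments P (fun w => absq (xi l' j' w) ^+ 4).
  by apply: all_momentsX; exact: call_moments_absq.
apply: (@le_trans _ _ (Ex P (fun w => 8 * (absq (xi l j w) ^+ 4 + absq (xi l k w) ^+ 4) + 8))).
  apply: Ex_le.
  - by apply: all_momentsX; apply: call_moments_absq; exact: pair_devM.
  - by apply: all_momentsD; [apply: all_momentsZ; exact: all_momentsD|exact: all_moments_cst].
  - move=> w; rewrite /pair_dev.
    have h : absq (xi l j w * conjc (xi l k w) - (j == k)%:R) <=
        2 * (absq (xi l j w) * absq (xi l k w)) + 2.
      apply: le_trans (absqD_le _ _) _; rewrite absqM absqJ absqN lerD2l.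
      by case: (j == k); rewrite /absq /=; lra.
    have h0 := absq_ge0 (xi l j w * conjc (xi l k w) - (j == k)%:R).
    move: h h0 (absq_ge0 (xi l j w)) (absq_ge0 (xi l k w)).
    move: (absq (_ - _)) (absq (xi l j w)) (absq (xi l k w)) => z a b h h0 a0 b0.
    have z2 : z ^+ 2 <= (2 * (a * b) + 2) ^+ 2 by rewrite lerXn2r// nnegrE addr_ge0// !mulr_ge0.
    apply: le_trans z2 _.
    have h1 : (2 * (a * b) + 2) ^+ 2 <= 8 * (a * b) ^+ 2 + 8.
      by rewrite -subr_ge0; have := sqr_ge0 (a * b - 1); move: (a * b) => u; lra.
    apply: le_trans h1 _; rewrite lerD2r ler_wpM2l//.
    have -> : (a * b) ^+ 2 = a ^+ 2 * b ^+ 2 by rewrite exprMn.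
    have -> : a ^+ 4 = (a ^+ 2) ^+ 2 by rewrite -exprM.
    have -> : b ^+ 4 = (b ^+ 2) ^+ 2 by rewrite -exprM.
    have := sqr_ge0 (a ^+ 2 - b ^+ 2); have := sqr_ge0 (a ^+ 2); have := sqr_ge0 (b ^+ 2).
    by move: (a ^+ 2) (b ^+ 2) => u v; nra.
rewrite ExD ?Ex_cst; [|by apply: all_momentsZ; exact: all_momentsD|exact: all_moments_cst].
rewrite ExZ; last exact: all_momentsD.
rewrite ExD//; have := xiB l j; have := xiB l k; lra.
Qed.

Context (y : nat -> R) (B : R) (y_sum : forall n, \sum_(0 <= l < n) y l ^+ 2 <= B).

(** One plus the bound of [pair_dev_fourth]: it dominates the variance, as t <= 1 + t^2, while its
    square dominates the fourth moment. *)
Let kappa : R := 16 * c + 9.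
Let v l : R := kappa * y l ^+ 2.
(** Terms of the series with different [l] depend on different rows, hence are independent. *)
Let row l : set (nat * nat) := [set lj | lj.1 = l].
Definition noise m K j k w : C := \sum_(m <= l < m + K) ((y l)%:C)%C * pair_dev l j k w.

Let row_disj l l' : l != l' -> row l `&` row l' = set0.
Proof. by move=> ll'; apply/seteqP; split => // x [/= xl xl']; move: ll'; rewrite -xl -xl' eqxx. Qed.

Lemma pair_dev_adapted l j k (A : set (nat * nat)) : A (l, j) -> A (l, k) ->
  cadapted X A (pair_dev l j k).
Proof.
move=> Alj Alk; apply: cadaptedD; last exact: cadapted_cst.
by apply: cadaptedM; [exact: xi_adapted|apply: cadaptedJ; exact: xi_adapted].
Qed.

(** The results on series and fourth moments are about real variables; [prj] stands for the real or
    the imaginary part. *)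
Section real_parts.
Context (prj : C -> R) (prj_le : forall z, prj z ^+ 2 <= absq z).
Context (prjM : forall l j k, all_moments P (fun w => prj (pair_dev l j k w))).
Context (prjA : forall l j k, adapted X (row l) (fun w => prj (pair_dev l j k w))).
Context (prjE : forall l j k, Ex P (fun w => prj (pair_dev l j k w)) = 0).

Let Y j k l w := y l * prj (pair_dev l j k w).

Let mY j k l : all_moments P (Y j k l).
Proof. exact: all_momentsZ. Qed.

Let aY j k l : adapted X (row l) (Y j k l).
Proof. by apply: measurable_funM; [exact: measurable_cst|exact: prjA]. Qed.

Let EY j k l : Ex P (Y j k l) = 0.
Proof. by rewrite /Y ExZ// prjE mulr0. Qed.

Let k4 : 16 * c + 8 <= kappa ^+ 2.
Proof.
rewrite -subr_ge0 (_ : _ - _ = 256 * c ^+ 2 + 272 * c + 73); last by rewrite /kappa; ring.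
by have := sqr_ge0 c; move: c0; lra.
Qed.

Let VY j k l : Ex P (fun w => Y j k l w ^+ 2) <= v l.
Proof.
rewrite /Y; under eq_fun do rewrite exprMn.
rewrite ExZ; last exact: all_momentsX.
rewrite /v mulrC ler_wpM2r ?sqr_ge0//.
have m2 := call_moments_absq (pair_devM l j k).
apply: (@le_trans _ _ (Ex P (fun w => 1 + absq (pair_dev l j k w) ^+ 2))).
  apply: Ex_le; first exact: all_momentsX.
  - by apply: all_momentsD; [exact: all_moments_cst|exact: all_momentsX].
  - by move=> w; have := prj_le (pair_dev l j k w); have := sqr_ge0 (absq (pair_dev l j k w) - 1); nra.
rewrite ExD ?Ex_cst; [|exact: all_moments_cst|exact: all_momentsX].
by have := pair_dev_fourth l j k; rewrite /kappa; lra.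
Qed.

Let FY j k l : Ex P (fun w => Y j k l w ^+ 4) <= v l ^+ 2.
Proof.
rewrite /Y; under eq_fun do rewrite exprMn.
rewrite ExZ; last exact: all_momentsX.
have -> : v l ^+ 2 = y l ^+ 4 * kappa ^+ 2 by rewrite /v; ring.
apply: ler_wpM2l; first by rewrite (_ : 4 = 2 * 2)%N// exprM sqr_ge0.
apply: le_trans k4; apply: le_trans (pair_dev_fourth l j k); apply: Ex_le.
- exact: all_momentsX.
- by apply: all_momentsX; apply: call_moments_absq; exact: pair_devM.
- move=> w; rewrite (_ : 4 = 2 * 2)%N// exprM lerXn2r// nnegrE ?sqr_ge0//.
  exact: absq_ge0.
Qed.

Let v_sum n : \sum_(0 <= l < n) v l <= kappa * B.
Proof. by rewrite -mulr_sumr ler_wpM2l// /kappa; move: c0; lra. Qed.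

Lemma noise_part_cvg j k :
  {ae P, forall w, cvgn (series (fun l => y l * prj (pair_dev l j k w)))}.
Proof.
exact: (kolmogorov_cvg X_meas X_indep row_disj (mY j k) (@aY j k) (EY j k) (VY j k) v_sum).
Qed.

Lemma noise_part_moments m K j k : let V := kappa * \sum_(m <= l < m + K) y l ^+ 2 in
  Ex P (fun w => (\sum_(m <= l < m + K) y l * prj (pair_dev l j k w)) ^+ 2) <= V /\
  Ex P (fun w => (\sum_(m <= l < m + K) y l * prj (pair_dev l j k w)) ^+ 4) <= 3 * V ^+ 2.
Proof.
have [_ h2 h4] := range_moments X_meas X_indep row_disj (mY j k) (@aY j k) (EY j k)
  (VY j k) (FY j k) m K.
by move: h2 h4; rewrite /v -mulr_sumr.
Qed.

End real_parts.

Let Re_le z : cRe z ^+ 2 <= absq z. Proof. by rewrite lerDl sqr_ge0. Qed.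
Let Im_le z : cIm z ^+ 2 <= absq z. Proof. by rewrite lerDr sqr_ge0. Qed.
Let ReA l j k : adapted X (row l) (fun w => cRe (pair_dev l j k w)).
Proof. by have [] : cadapted X (row l) (pair_dev l j k) by exact: pair_dev_adapted. Qed.
Let ImA l j k : adapted X (row l) (fun w => cIm (pair_dev l j k w)).
Proof. by have [] : cadapted X (row l) (pair_dev l j k) by exact: pair_dev_adapted. Qed.
Let ReE l j k : Ex P (fun w => cRe (pair_dev l j k w)) = 0.
Proof. exact: (congr1 cRe (pair_dev_centered l j k)). Qed.
Let ImE l j k : Ex P (fun w => cIm (pair_dev l j k w)) = 0.
Proof. exact: (congr1 cIm (pair_dev_centered l j k)). Qed.

Lemma noiseE m K j k w : noise m K j k w =
  ((\sum_(m <= l < m + K) y l * cRe (pair_dev l j k w)) +i*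
   (\sum_(m <= l < m + K) y l * cIm (pair_dev l j k w)))%C.
Proof.
rewrite /noise; elim/big_rec3: _ => // l a b z _ ->.
by case: (pair_dev l j k w) => p q; simpc; congr (_ +i* _)%C; ring.
Qed.

Lemma noise_cvg : {ae P, forall w, forall j k, exists z : C,
  ccvg (fun K => noise 0 K j k w) z}.
Proof.
apply: ae_foralln => j; apply: ae_foralln => k.
have h1 := noise_part_cvg Re_le (fun l j k => (pair_devM l j k).1) ReA ReE j k.
have h2 := noise_part_cvg Im_le (fun l j k => (pair_devM l j k).2) ImA ImE j k.
apply: filterS2 h1 h2 => w /cvg_ex[a wa] /cvg_ex[b wb]; exists (a +i* b)%C.
by split; under eq_fun do rewrite noiseE /= add0n.
Qed.

Lemma noiseM m K j k : call_moments P (noise m K j k).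
Proof. by apply: call_moments_sum => l; apply: call_momentsZ; exact: pair_devM. Qed.

(** The two parts are added; (p^2 + q^2)^2 <= 2 p^4 + 2 q^4 produces the 12 from the two bounds 3
    V^2. *)
Lemma noise_moments m K j k : let V := kappa * \sum_(m <= l < m + K) y l ^+ 2 in
  Ex P (fun w => absq (noise m K j k w)) <= 2 * V /\
  Ex P (fun w => absq (noise m K j k w) ^+ 2) <= 12 * V ^+ 2.
Proof.
have [a2 a4] := noise_part_moments Re_le (fun l j k => (pair_devM l j k).1) ReA ReE m K j k.
have [b2 b4] := noise_part_moments Im_le (fun l j k => (pair_devM l j k).2) ImA ImE m K j k.
move=> V; have aR (j' k' : nat) : all_moments P (fun w => \sum_(m <= l < m + K) y l * cRe (pair_dev l j' k' w)).
  by apply: all_moments_sum => l; apply: all_momentsZ; exact: (pair_devM l j' k').1.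
have aI (j' k' : nat) : all_moments P (fun w => \sum_(m <= l < m + K) y l * cIm (pair_dev l j' k' w)).
  by apply: all_moments_sum => l; apply: all_momentsZ; exact: (pair_devM l j' k').2.
rewrite -/V in a2 a4 b2 b4; clearbody V; split.
  under eq_fun do rewrite noiseE /absq /=.
  rewrite ExD; [|exact: all_momentsX..].
  by rewrite mulr_natl mulr2n; exact: lerD.
apply: (@le_trans _ _ (Ex P (fun w =>
   2 * (\sum_(m <= l < m + K) y l * cRe (pair_dev l j k w)) ^+ 4 +
   2 * (\sum_(m <= l < m + K) y l * cIm (pair_dev l j k w)) ^+ 4))).
  apply: Ex_le.
  - by apply: all_momentsX; apply: call_moments_absq; exact: noiseM.
  - by apply: all_momentsD; apply: all_momentsZ; exact: all_momentsX.
  - move=> w; rewrite noiseE /absq /=.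
    move: (\sum_(_ <= _ < _) _) (\sum_(_ <= _ < _) _) => p q.
    by rewrite -subr_ge0 (_ : _ - _ = (p ^+ 2 - q ^+ 2) ^+ 2) ?sqr_ge0//; ring.
rewrite ExD; [|by apply: all_momentsZ; exact: all_momentsX..].
by rewrite !ExZ; [move: a4 b4; lra|exact: all_momentsX..].
Qed.

End spiked_noise.

(** * Laws of large numbers for the spikes and the rows of the noise *)

Section noise_laws.
Context d (T : measurableType d) (R : realType) (P : probability T R).
Local Notation C := R[i].
Local Notation cRe := (@complex.Re R).
Local Notation cIm := (@complex.Im R).
Context (xi : nat -> nat -> T -> C).
Let X (lj : nat * nat) := xi lj.1 lj.2.
Context (X_meas : forall lj, complex_rv (X lj)).
Context (X_indep : mutually_independent P (fun lj => sigma_rv (X lj))).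
Context (xiM : forall l j, call_moments P (xi l j)).
Context (xiE : forall l j, cEx P (xi l j) = 0).
Context (xiV : forall l j, Ex P (fun w => absq (xi l j w)) = 1).
Context (c : R) (c0 : 0 <= c) (xiB : forall l j, Ex P (fun w => absq (xi l j w) ^+ 4) <= c).
Context (y : nat -> R) (B : R) (y_sum : forall n, \sum_(0 <= l < n) y l ^+ 2 <= B).

(** Averages now run over the coordinate index, so independence is organized by columns, each
    gathering one coordinate of all the spikes. *)
Let col j : set (nat * nat) := [set lj | lj.2 = j].
Let kappa : R := 16 * c + 9.
Local Notation noise := (noise xi y).

Definition gram_error a b k w : C := conjc (xi a k w) * xi b k w - (a == b)%:R.

Lemma gram_errorM a b k : call_moments P (gram_error a b k).
Proof.
apply: call_momentsB; last exact: call_moments_cst.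
by apply: call_momentsM => //; exact: call_momentsJ.
Qed.

Lemma gram_error_centered a b k : cEx P (gram_error a b k) = 0.
Proof.
have -> : gram_error a b k = (fun w => xi b k w * conjc (xi a k w) + (- (a == b)%:R)).
  by apply/funext => w; rewrite /gram_error mulrC.
rewrite cExD ?cEx_cst; [|by apply: call_momentsM => //; exact: call_momentsJ|exact: call_moments_cst].
have [<-|ab] := eqVneq a b; first by rewrite cEx_mulJ xiV subrr.
by rewrite (xi_prod X_meas X_indep xiM xiE) ?subrr// xpair_eqE eqxx andbT eq_sym.
Qed.

Lemma gram_error_adapted a b k : cadapted X (col k) (gram_error a b k).
Proof.
apply: cadaptedD; last exact: cadapted_cst.
by apply: cadaptedM; [apply: cadaptedJ|]; exact: xi_adapted.
Qed.

Let sq_le (u : R) : u ^+ 2 <= 1 + u ^+ 4.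
Proof. by rewrite (_ : u ^+ 4 = (u ^+ 2) ^+ 2) -?exprM//; have := sqr_ge0 (u ^+ 2 - 1); nra. Qed.

Let xiB2 l j : Ex P (fun w => absq (xi l j w) ^+ 2) <= 1 + c.
Proof.
have m := call_moments_absq (xiM l j).
apply: (@le_trans _ _ (Ex P (fun w => 1 + absq (xi l j w) ^+ 4))).
  by apply: Ex_le => //; [exact: all_momentsX|apply: all_momentsD;
    [exact: all_moments_cst|exact: all_momentsX]].
by rewrite ExD ?Ex_cst ?lerD2l//; [exact: all_moments_cst|exact: all_momentsX].
Qed.

Lemma gram_error_var a b k : Ex P (fun w => absq (gram_error a b k w)) <= 4 * c + 6.
Proof.
have m l := call_moments_absq (xiM l k).
apply: (@le_trans _ _ (Ex P (fun w =>
    2 * (absq (xi a k w) ^+ 2 + absq (xi b k w) ^+ 2) + 2))).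
  apply: Ex_le; first by apply: call_moments_absq; exact: gram_errorM.
    apply: all_momentsD; last exact: all_moments_cst.
    by apply: all_momentsZ; apply: all_momentsD; exact: all_momentsX.
  move=> w; apply: le_trans (absqD_le _ _) _; rewrite absqM absqJ absqN; apply: lerD.
    rewrite ler_wpM2l//; move: (absq (xi a k w)) (absq (xi b k w)) => p q.
    by rewrite -subr_ge0; have := sqr_ge0 (p - q); have := sqr_ge0 p; have := sqr_ge0 q; nra.
  by case: (a == b); rewrite /absq /=; lra.
rewrite ExD ?Ex_cst; [|by apply: all_momentsZ; apply: all_momentsD; exact: all_momentsX|exact: all_moments_cst].
rewrite ExZ; last by apply: all_momentsD; exact: all_momentsX.
rewrite ExD; [|exact: all_momentsX..].
by have := xiB2 a k; have := xiB2 b k; lra.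
Qed.

Let col_disj j k : j != k -> col j `&` col k = set0.
Proof. by move=> jk; apply/seteqP; split => // x [/= xj xk]; move: jk; rewrite -xj -xk eqxx. Qed.

Lemma gram_ae : {ae P, forall w, forall a b,
  ccvg (fun n => ((n%:R^-1)%:C)%C * \sum_(k < n) conjc (xi a k w) * xi b k w) (a == b)%:R}.
Proof.
apply: ae_foralln => a; apply: ae_foralln => b.
have orth (K k k' : nat) : k != k' ->
    cRe (cEx P (fun w => gram_error a b k w * conjc (gram_error a b k' w))) = 0.
  move=> kk'; rewrite (@cEx_adapted _ _ _ _ _ _ X_meas X_indep (col k) (col k')).
  - by rewrite gram_error_centered mul0r.
  - exact: col_disj.
  - exact: gram_errorM.
  - by apply: call_momentsJ; exact: gram_errorM.
  - exact: gram_error_adapted.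
  - by apply: cadaptedJ; exact: gram_error_adapted.
have := l2_slln (W := fun _ => gram_error a b) (fun _ k => gram_errorM a b k)
  (fun _ k => gram_error_var a b k) orth.
apply: filterS => w /(_ (fun k => gram_error a b k w) (fun k => ccvg_cst _)) h.
have h2 := ccvgD h (ccvg_cst (a == b)%:R); rewrite add0r in h2.
apply: near_eq_ccvg h2; near=> n.
have n0 : n%:R != 0 :> R by rewrite pnatr_eq0 -lt0n; near: n; exists 1%N.
rewrite /gram_error sumrB mulrBr sumr_const card_ord.
have -> : ((n%:R^-1)%:C)%C * ((a == b)%:R *+ n) = (a == b)%:R :> C.
  rewrite -[X in _ * X]mulr_natl mulrA -(rmorph_nat (real_complex R)) -rmorphM /= mulVf//.
  by rewrite rmorph1 mul1r.
by rewrite subrK.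
Unshelve. all: by end_near. Qed.

(** Second moment of [noise m K a k] conditionally on column [a], for [k] other than [a]. It makes
    [row_defect] conditionally centered; an explicit expansion takes the place of conditional
    expectations. *)
Let row_energy m K a w : C := \sum_(m <= l < m + K) (((y l ^+ 2)%:C)%C * (conjc (xi l a w) * xi l a w)).
Let row_defect m K a k w : C := conjc (noise m K a k w) * noise m K a k w - row_energy m K a w.

Let row_coef a l l' w : C := ((y l * y l')%:C)%C * (conjc (xi l a w) * xi l' a w).

Let conjM (u v : C) : conjc (u * v) = conjc u * conjc v.
Proof. by rewrite rmorphM. Qed.

Let realM (u v : R) : ((u * v)%:C = u%:C * v%:C)%C.
Proof. exact: rmorphM. Qed.

(* Off the diagonal the defect is a combination of the centered variables of
   column [k], with coefficients depending on column [a] only. *)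
Let row_defectE m K a k w : k != a -> row_defect m K a k w =
  \sum_(m <= l < m + K) \sum_(m <= l' < m + K) row_coef a l l' w * gram_error l' l k w.
Proof.
move=> ka; rewrite /row_defect.
have -> : noise m K a k w = \sum_(m <= l < m + K) ((y l)%:C)%C * (xi l a w * conjc (xi l k w)).
  by apply: eq_bigr => l _; rewrite /= /pair_dev (eqtype.eq_sym a k) (negbTE ka) subr0.
rewrite rmorph_sum big_distrlr /= /row_energy -sumrB; apply: eq_big_nat => l lmK.
rewrite (bigD1_seq l) ?mem_index_iota ?iota_uniq//= ?iota_uniq// [RHS](bigD1_seq l) ?mem_index_iota ?iota_uniq//=.
rewrite addrAC; congr (_ + _).
  rewrite /row_coef /gram_error eqxx conjc_scale conjM conjcK expr2 realM /=.
  ring.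
apply: eq_bigr => l' l'l; rewrite /row_coef /gram_error (negbTE l'l) subr0.
rewrite conjc_scale conjM conjcK realM; ring.
Qed.

Let row_coefM a l l' : call_moments P (row_coef a l l').
Proof.
by apply: call_momentsZ; apply: call_momentsM => //; exact: call_momentsJ.
Qed.

Let row_coef_adapted a l l' A : col a `<=` A -> cadapted X A (row_coef a l l').
Proof.
move=> aA; apply: cadaptedM; first exact: cadapted_cst.
by apply: cadaptedM; [apply: cadaptedJ|]; apply: xi_adapted; exact: aA.
Qed.

Let noiseM' m K j k : call_moments P (noise m K j k).
Proof. exact: noiseM. Qed.

Lemma noise_adapted m K j k A : col j `<=` A -> col k `<=` A -> cadapted X A (noise m K j k).
Proof.
move=> jA kA; apply: cadapted_sum => l; apply: cadaptedM; first exact: cadapted_cst.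
by apply: pair_dev_adapted; [exact: jA|exact: kA].
Qed.

Let row_energyM m K a : call_moments P (row_energy m K a).
Proof.
apply: call_moments_sum => l; apply: call_momentsZ.
by apply: call_momentsM => //; exact: call_momentsJ.
Qed.

Let row_defectM m K a k : call_moments P (row_defect m K a k).
Proof.
by apply: call_momentsB => //; apply: call_momentsM => //; exact: call_momentsJ.
Qed.

Let row_defect_adapted m K a k A : col a `<=` A -> col k `<=` A ->
  cadapted X A (row_defect m K a k).
Proof.
move=> aA kA.
have -> : row_defect m K a k = (fun w => conjc (noise m K a k w) * noise m K a k w +
    (-1) * row_energy m K a w) by apply/funext => w; rewrite mulN1r.
apply: cadaptedD.
  by apply: cadaptedM; [apply: cadaptedJ|]; exact: noise_adapted.
apply: cadaptedM; first exact: cadapted_cst.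
apply: cadapted_sum => l; apply: cadaptedM; first exact: cadapted_cst.
by apply: cadaptedM; [apply: cadaptedJ|]; apply: xi_adapted; exact: aA.
Qed.

(** Only the first factor is expanded: each term is a centered [gram_error] of column [k] times a
    factor depending on columns [a] and [k']. *)
Let row_defect_orth m K a k k' : k != a -> k' != a -> k != k' ->
  cEx P (fun w => row_defect m K a k w * conjc (row_defect m K a k' w)) = 0.
Proof.
move=> ka k'a kk'.
have fM l l' : call_moments P (fun w => row_coef a l l' w * conjc (row_defect m K a k' w)).
  by apply: call_momentsM => //; exact: call_momentsJ.
have -> : (fun w => row_defect m K a k w * conjc (row_defect m K a k' w)) =
   (fun w => \sum_(m <= l < m + K) \sum_(m <= l' < m + K)
     (row_coef a l l' w * conjc (row_defect m K a k' w)) * gram_error l' l k w).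
  apply/funext => w; rewrite (row_defectE _ _ _ ka) mulr_suml; apply: eq_bigr => l _.
  by rewrite mulr_suml; apply: eq_bigr => l' _; rewrite mulrAC.
have gM l l' : call_moments P (fun w =>
    (row_coef a l l' w * conjc (row_defect m K a k' w)) * gram_error l' l k w).
  by apply: call_momentsM => //; exact: gram_errorM.
rewrite cEx_sum => [|l]; last exact: call_moments_sum.
rewrite big1// => l _; rewrite cEx_sum// big1// => l' _.
rewrite (@cEx_adapted _ _ _ _ _ _ X_meas X_indep (col a `|` col k') (col k))//.
- by rewrite gram_error_centered mulr0.
- by rewrite setIUl !col_disj ?setU0// eq_sym.
- exact: gram_errorM.
- apply: cadaptedM; first by apply: row_coef_adapted => x; left.
  by apply: cadaptedJ; apply: row_defect_adapted => x; [left|right].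
- exact: gram_error_adapted.
Qed.

Let y_range m K : \sum_(m <= l < m + K) y l ^+ 2 <= B.
Proof.
apply: le_trans (y_sum (m + K)%N); rewrite [leRHS](big_cat_nat (n := m)) ?leq_addr//=.
by rewrite lerDr; apply: sumr_ge0 => l _; exact: sqr_ge0.
Qed.

Let range_ge0 m K : 0 <= \sum_(m <= l < m + K) y l ^+ 2.
Proof. by apply: sumr_ge0 => l _; exact: sqr_ge0. Qed.

Let kappa0 : 0 <= kappa. Proof. by rewrite /kappa; move: c0; lra. Qed.

Let row_energyE m K a w : row_energy m K a w =
  ((\sum_(m <= l < m + K) y l ^+ 2 * absq (xi l a w))%:C)%C.
Proof.
by rewrite rmorph_sum; apply: eq_bigr => l _; rewrite -absqE -realM.
Qed.

Let row_defect_real m K a k w : row_defect m K a k w =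
  ((absq (noise m K a k w) - \sum_(m <= l < m + K) y l ^+ 2 * absq (xi l a w))%:C)%C.
Proof. by rewrite /row_defect row_energyE -absqE rmorphB. Qed.

Let energyM m K a : all_moments P (fun w => \sum_(m <= l < m + K) y l ^+ 2 * absq (xi l a w)).
Proof.
by apply: all_moments_sum => l; apply: all_momentsZ; exact: call_moments_absq.
Qed.

Let energy_var m K a :
  Ex P (fun w => (\sum_(m <= l < m + K) y l ^+ 2 * absq (xi l a w)) ^+ 2) <=
  2 * (1 + c) * B ^+ 2.
Proof.
have E w : (\sum_(m <= l < m + K) y l ^+ 2 * absq (xi l a w)) ^+ 2 =
   \sum_(m <= l < m + K) \sum_(m <= l' < m + K)
     y l ^+ 2 * (y l' ^+ 2 * (absq (xi l a w) * absq (xi l' a w))).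
  rewrite expr2 big_distrlr /=; apply: eq_bigr => l _; apply: eq_bigr => l' _; ring.
have m2 l l' : all_moments P (fun w => absq (xi l a w) * absq (xi l' a w)).
  by apply: all_momentsM; exact: call_moments_absq.
have h l l' : Ex P (fun w => absq (xi l a w) * absq (xi l' a w)) <= 2 * (1 + c).
  apply: (@le_trans _ _ (Ex P (fun w => absq (xi l a w) ^+ 2 + absq (xi l' a w) ^+ 2))).
    apply: Ex_le => //; first by apply: all_momentsD; apply: all_momentsX; exact: call_moments_absq.
    move=> w; move: (absq (xi l a w)) (absq (xi l' a w)) => p q.
    by have := sqr_ge0 (p - q); have := sqr_ge0 p; have := sqr_ge0 q; nra.
  rewrite ExD; [|by apply: all_momentsX; exact: call_moments_absq..].
  by have := xiB2 l a; have := xiB2 l' a; lra.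
have mm l l' : all_moments P (fun w => y l ^+ 2 * (y l' ^+ 2 * (absq (xi l a w) * absq (xi l' a w)))).
  by apply: all_momentsZ; exact: all_momentsZ.
under eq_fun do rewrite E.
rewrite Ex_sum => [|l]; last exact: all_moments_sum.
apply: (@le_trans _ _ (\sum_(m <= l < m + K) \sum_(m <= l' < m + K)
   y l ^+ 2 * y l' ^+ 2 * (2 * (1 + c)))).
  apply: ler_sum => l _; rewrite Ex_sum//; apply: ler_sum => l' _.
  by rewrite !ExZ//; [rewrite mulrA ler_wpM2l// mulr_ge0// sqr_ge0|exact: all_momentsZ].
under eq_bigr do rewrite -mulr_suml -mulr_sumr.
rewrite -!mulr_suml mulrC; apply: ler_wpM2l; first by rewrite mulr_ge0//; move: c0; lra.
by rewrite -expr2 lerXn2r// ?nnegrE//; exact: le_trans (range_ge0 0 0) (y_range 0 0).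
Qed.

(** Law of large numbers along row [a]: the average of the |V_k|^2 tends to [tau], the energy of the
    series from index [m] on. The diagonal entry is replaced by 0, since it does not involve two
    independent columns. *)
Lemma row_noise_ae m a : {ae P, forall w, forall (V : nat -> C) (tau : R),
  (forall k, ccvg (fun K => noise m K a k w) (V k)) ->
  \sum_(m <= l < m + K) y l ^+ 2 * absq (xi l a w) @[K --> \oo] --> tau ->
  ccvg (fun n => ((n%:R^-1)%:C)%C *
    \sum_(k < n) (((if k == a :> nat then 0 else absq (V k) - tau) : R)%:C)%C) 0}.
Proof.
pose W K k w : C := if k == a then 0 else row_defect m K a k w.
have mW K k : call_moments P (W K k).
  by rewrite /W; case: (k == a) => //; exact: call_moments_cst.
have orth K k k' : k != k' -> cRe (cEx P (fun w => W K k w * conjc (W K k' w))) = 0.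
  move=> kk'; rewrite /W; have [_|ka] := eqVneq k a.
    by under eq_fun do rewrite mul0r; rewrite cEx_cst.
  have [_|k'a] := eqVneq k' a.
    by under eq_fun do rewrite conjc0 mulr0; rewrite cEx_cst.
  by rewrite row_defect_orth.
have V0 := kappa0; have B0 : 0 <= B := le_trans (range_ge0 0 0) (y_range 0 0).
pose q : R := 24 * (kappa * B) ^+ 2 + 2 * (2 * (1 + c) * B ^+ 2).
have q0 : 0 <= q.
  by rewrite addr_ge0 ?mulr_ge0 ?sqr_ge0//; move: c0; lra.
have Wq K k : Ex P (fun w => absq (W K k w)) <= q.
  rewrite /W; have [_|ka] := eqVneq k a; first by rewrite absq0 Ex_cst.
  under eq_fun do rewrite row_defect_real absqR.
  have mn : all_moments P (fun w => absq (noise m K a k w)) by exact: call_moments_absq.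
  apply: (@le_trans _ _ (Ex P (fun w => 2 * absq (noise m K a k w) ^+ 2 +
      2 * (\sum_(m <= l < m + K) y l ^+ 2 * absq (xi l a w)) ^+ 2))).
    apply: Ex_le.
    - by apply: all_momentsX; exact: all_momentsB.
    - by apply: all_momentsD; apply: all_momentsZ; exact: all_momentsX.
    - move=> w; move: (absq _) (\sum_(_ <= _ < _) _) => u v.
      by have := sqr_ge0 (u + v); nra.
  rewrite ExD; [|by apply: all_momentsZ; exact: all_momentsX..].
  rewrite !ExZ; [|exact: all_momentsX..].
  have [_ n2] := noise_moments X_meas X_indep xiM xiE xiV c0 xiB y m K a k.
  apply: lerD; last by rewrite ler_wpM2l// energy_var.
  have -> : 24 * (kappa * B) ^+ 2 = 2 * (12 * (kappa * B) ^+ 2) by ring.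
  rewrite ler_wpM2l//; apply: le_trans n2 _; rewrite ler_wpM2l// lerXn2r// ?nnegrE ?mulr_ge0//.
  by rewrite ler_wpM2l.
have := l2_slln mW Wq orth; apply: filterS => w hw V tau cV ctau.
apply: (hw (fun k => ((if k == a then 0 else absq (V k) - tau)%:C)%C)) => k; rewrite /W; have [_|ka] := eqVneq k a; first exact: ccvg_cst.
under eq_fun do rewrite row_defect_real.
by apply: ccvgR; apply: cvgB => //; apply: ccvg_absq.
Qed.

End noise_laws.

(** * Sums over all pairs of indices *)

Section pair_sums.
Context d (T : measurableType d) (R : realType) (P : probability T R).
Context (Z : nat -> nat -> nat -> T -> R) (v s : R).
Context (Z_ge0 : forall K j k w, 0 <= Z K j k w).
Context (ZM : forall K j k, all_moments P (Z K j k)).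
Context (Z_mean : forall K j k, Ex P (Z K j k) <= v).
Context (Z_sq : forall K j k, Ex P (fun w => Z K j k w ^+ 2) <= s).
Context (Z_uncor : forall K j k j' k', j != j' -> j != k' -> k != j' -> k != k' ->
  Ex P (fun w => Z K j k w * Z K j' k' w) = Ex P (Z K j k) * Ex P (Z K j' k')).

Lemma sum_pair_card n (a : 'I_n) :
  \sum_(p : 'I_n * 'I_n) (a == p.1)%:R = n%:R :> R /\
  \sum_(p : 'I_n * 'I_n) (a == p.2)%:R = n%:R :> R.
Proof.
have h : \sum_(j < n) (a == j)%:R = 1 :> R.
  by rewrite (bigD1 a)//= eqxx big1 ?addr0// => j ja; rewrite eq_sym (negbTE ja).
split.
  rewrite -(pair_bigA _ (fun j k : 'I_n => (a == j)%:R)) /= exchange_big /=.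
  by under eq_bigr do rewrite h; rewrite sumr_const card_ord.
rewrite -(pair_bigA _ (fun j k : 'I_n => (a == k)%:R)) /=.
by under eq_bigr do rewrite h; rewrite sumr_const card_ord.
Qed.

Let s0 : 0 <= s.
Proof. by apply: le_trans (Z_sq 0 0 0); apply: Ex_ge0 => w; exact: sqr_ge0. Qed.

Let Y K j k w := Z K j k w - Ex P (Z K j k).

Let mY K j k : all_moments P (Y K j k).
Proof. by apply: all_momentsB => //; exact: all_moments_cst. Qed.

Let Y_sq K j k : Ex P (fun w => Y K j k w ^+ 2) <= s.
Proof.
apply: le_trans (Z_sq K j k).
set mu := Ex P (Z K j k).
have E w : Y K j k w ^+ 2 = Z K j k w ^+ 2 + ((- (2 * mu)) * Z K j k w + mu ^+ 2).
  by rewrite /Y -/mu; ring.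
under eq_fun do rewrite E.
have m1 : all_moments P (fun w => - (2 * mu) * Z K j k w) by exact: all_momentsZ.
have m2 : all_moments P (fun=> mu ^+ 2 : R) by exact: all_moments_cst.
rewrite ExD; [|exact: all_momentsX|exact: all_momentsD].
rewrite ExD// ExZ// Ex_cst -/mu.
by have := sqr_ge0 mu; lra.
Qed.

Let Y_cov K j k j' k' : Ex P (fun w => Y K j k w * Y K j' k' w) <=
  s * ((j == j')%:R + (j == k')%:R + ((k == j')%:R + (k == k')%:R)).
Proof.
have [h|] := boolP [|| j == j', j == k', k == j' | k == k'].
  apply: (@le_trans _ _ (s * 1)).
    apply: (@le_trans _ _ (Ex P (fun w => 2^-1 * (Y K j k w ^+ 2 + Y K j' k' w ^+ 2)))).
      apply: Ex_le; first exact: all_momentsM.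
        by apply: all_momentsZ; apply: all_momentsD; exact: all_momentsX.
      move=> w; move: (Y K j k w) (Y K j' k' w) => a b.
      by have := sqr_ge0 (a - b); nra.
    rewrite ExZ; last by apply: all_momentsD; exact: all_momentsX.
    rewrite ExD; [|exact: all_momentsX..].
    by have := Y_sq K j k; have := Y_sq K j' k'; lra.
  apply: ler_wpM2l => //; rewrite -!natrD ler1n.
  by move: h; do 4 case: eqP.
rewrite !negb_or => /and4P[h1 h2 h3 h4].
rewrite (negbTE h1) (negbTE h2) (negbTE h3) (negbTE h4) !addr0 mulr0.
have E w : Y K j k w * Y K j' k' w = Z K j k w * Z K j' k' w -
   (Ex P (Z K j k) * Z K j' k' w + (Ex P (Z K j' k') * Z K j k w -
    Ex P (Z K j k) * Ex P (Z K j' k'))) by rewrite /Y; ring.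
under eq_fun do rewrite E.
have m1 j1 k1 (a : R) : all_moments P (fun w => a * Z K j1 k1 w) by exact: all_momentsZ.
have m2 (a : R) : all_moments P (fun=> a) by exact: all_moments_cst.
rewrite ExB; [|exact: all_momentsM|apply: all_momentsD => //; exact: all_momentsB].
rewrite ExD//; last exact: all_momentsB.
rewrite ExB// !ExZ// Ex_cst Z_uncor//; lra.
Qed.

Let Q K n w := \sum_(p : 'I_n * 'I_n) Z K p.1 p.2 w.

(* Only O(n^3) of the n^4 pairs of entries are correlated. *)
Let Q_var K n : Ex P (fun w => (\sum_(p : 'I_n * 'I_n) Y K p.1 p.2 w) ^+ 2) <=
  4 * s * n%:R ^+ 3.
Proof.
under eq_fun do rewrite expr2 big_distrlr /=.
rewrite Ex_sum; last by move=> p; apply: all_moments_sum => p'; exact: all_momentsM.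
apply: (@le_trans _ _ (\sum_(p : 'I_n * 'I_n) \sum_(p' : 'I_n * 'I_n)
  s * ((p.1 == p'.1)%:R + (p.1 == p'.2)%:R + ((p.2 == p'.1)%:R + (p.2 == p'.2)%:R)))).
  apply: ler_sum => p _; rewrite Ex_sum; last by move=> p'; exact: all_momentsM.
  by apply: ler_sum => p' _; exact: Y_cov.
have E (p : 'I_n * 'I_n) : \sum_(p' : 'I_n * 'I_n)
  s * ((p.1 == p'.1)%:R + (p.1 == p'.2)%:R + ((p.2 == p'.1)%:R + (p.2 == p'.2)%:R)) =
  s * (n%:R + n%:R + (n%:R + n%:R)) :> R.
  rewrite -mulr_sumr !big_split /=.
  have [-> ->] := sum_pair_card p.1.
  by have [-> ->] := sum_pair_card p.2.
under eq_bigr do rewrite E.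
rewrite sumr_const card_prod card_ord -[leLHS]mulr_natr natrM le_eqVlt; apply/orP; left.
by apply/eqP; ring.
Qed.

(** Positive part. The means of [Z K j k] vary with [K] and are only bounded by [v]; the positive
    part of the excess over [v] is dominated by the centered sum, yet passes to the limit in [K],
    being continuous and free of these means. *)
Let pos (u : R) := (`|u| + u) / 2.

Let pos_le (u u' : R) : u <= u' -> pos u <= `|u'|.
Proof.
move=> h; rewrite /pos ler_pdivrMr// mulrC.
by have [?|?] := ger0P u; have [?|?] := ger0P u'; lra.
Qed.

Let pos_ge0 u : 0 <= pos u.
Proof. by rewrite /pos divr_ge0//; have [?|?] := ger0P u; lra. Qed.

Let le_pos u : u <= pos u.
Proof. by rewrite /pos; have [?|?] := ger0P u; lra. Qed.

(** The variance bound is summable along squares, and sums of nonnegative terms are monotone in n: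
    for (q+1)^2 <= n < (q+2)^2, the factor 16 comes from (q+2)^4 <= 16 (q+1)^4 <= 16 n^2. *)
Lemma pair_sum_le : {ae P, forall w, forall V : nat -> nat -> R,
  (forall j k, Z K j k w @[K --> \oo] --> V j k) ->
  forall e, 0 < e -> \forall n \near \oo,
    \sum_(j < n) \sum_(k < n) V j k <= 16 * (v + e) * n%:R ^+ 2}.
Proof.
pose h (V : nat -> nat -> R) q := (pos (\sum_(p : 'I_(q.+1 ^ 2) * 'I_(q.+1 ^ 2)) V p.1 p.2
   - v * q.+1%:R ^+ 4)) ^+ 2 / q.+1%:R ^+ 8.
have h_le q K w : h (fun j k => Z K j k w) q <=
    (\sum_(p : 'I_(q.+1 ^ 2) * 'I_(q.+1 ^ 2)) Y K p.1 p.2 w) ^+ 2 / q.+1%:R ^+ 8.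
  rewrite /h ler_wpM2r ?invr_ge0 ?exprn_ge0//.
  rewrite -[leRHS]real_normK ?num_real// lerXn2r// ?nnegrE//; apply: pos_le.
  rewrite /Y sumrB lerD2l lerN2.
  apply: (@le_trans _ _ (\sum_(p : 'I_(q.+1 ^ 2) * 'I_(q.+1 ^ 2)) v)).
    by apply: ler_sum => p _; exact: Z_mean.
  rewrite sumr_const card_prod card_ord -[leLHS]mulr_natr natrM natrX le_eqVlt; apply/orP; left.
  by apply/eqP; ring.
have h0 V q : 0 <= h V q by rewrite divr_ge0 ?exprn_ge0 ?sqr_ge0.
have mYs q K : all_moments P (fun w =>
    (\sum_(p : 'I_(q.+1 ^ 2) * 'I_(q.+1 ^ 2)) Y K p.1 p.2 w) ^+ 2 / q.+1%:R ^+ 8).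
  under eq_fun do rewrite mulrC.
  by apply: all_momentsZ; apply: all_momentsX; exact: all_moments_sum.
have mf q K : all_moments P (fun w => h (fun j k => Z K j k w) q).
  apply: all_moments_dominated (mYs q K) _.
    rewrite /h; apply: measurable_funM; last exact: measurable_cst.
    apply: measurable_funX; apply: measurable_funM; last exact: measurable_cst.
    have mS : measurable_fun [set: T] (fun w =>
       \sum_(p : 'I_(q.+1 ^ 2) * 'I_(q.+1 ^ 2)) Z K p.1 p.2 w - v * q.+1%:R ^+ 4).
      apply: measurable_funB; last exact: measurable_cst.
      exact: (all_moments_sum _ (fun p : 'I_(q.+1 ^ 2) * 'I_(q.+1 ^ 2) => ZM K p.1 p.2)).1.
    apply: measurable_funD => //; apply: measurableT_comp => //; exact: normr_measurable.
  by move=> w; rewrite !ger0_norm// ?h_le//; exact: le_trans (h0 _ _) (h_le _ _ _).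
have Eh q K : Ex P (fun w => h (fun j k => Z K j k w) q) <= 4 * s * (q.+1%:R ^+ 2)^-1.
  apply: le_trans (Ex_le (mf q K) (mYs q K) (h_le q K)) _.
  under eq_fun do rewrite mulrC.
  rewrite ExZ; last by apply: all_momentsX; exact: all_moments_sum.
  apply: le_trans (ler_wpM2l _ (Q_var K (q.+1 ^ 2))) _; first by rewrite invr_ge0 exprn_ge0.
  rewrite natrX le_eqVlt; apply/orP; left; apply/eqP; field.
  by rewrite nat1r pnatr_eq0.
have uB n : \sum_(q < n) 4 * s * (q.+1%:R ^+ 2)^-1 <= 4 * s * 2.
  by rewrite -mulr_sumr ler_wpM2l ?mulr_ge0// sum_inv_sqr.
have := fatou_cvg0 mf (fun q K w => h0 _ q) Eh uB.
apply: filterS => w hw V WV e e0.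
have V0 j k : 0 <= V j k.
  by rewrite -(cvg_lim (@Rhausdorff R) (WV j k)); apply: limr_ge; [exact: cvgP (WV j k)|exact: nearW].
have {}hw : h V q @[q --> \oo] --> (0 : R).
  apply: hw => q; apply: cvgM; last exact: cvg_cst.
  set S := \sum_p _.
  have cS : \sum_(p : 'I_(q.+1 ^ 2) * 'I_(q.+1 ^ 2)) Z K p.1 p.2 w - v * q.+1%:R ^+ 4
      @[K --> \oo] --> S - v * q.+1%:R ^+ 4.
    apply: cvgB; last exact: cvg_cst.
    rewrite /S -(pair_bigA _ (fun j k : 'I__ => V j k)) /=.
    under eq_fun do rewrite -(pair_bigA _ (fun j k : 'I__ => Z _ j k w)) /=.
    apply: (@cvg_sum_ord _ _ (fun j K => \sum_(k < _) Z K j k w) (fun j => \sum_(k < _) V j k)) => j.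
    exact: (@cvg_sum_ord _ _ (fun k K => Z K j k w) (V j)).
  rewrite !expr2; apply: cvgM; (apply: cvgM; last exact: cvg_cst); apply: cvgD => //; exact: cvg_norm.
have [q1 _ hq] : \forall q \near \oo, `|h V q| <= e ^+ 2.
  by move/cvgr0Pnorm_le: hw; apply; rewrite exprn_gt0.
exists (q1.+1 ^ 2)%N => // n /= nq.
have n0 : (0 < n)%N by apply: leq_trans nq; rewrite expn_gt0.
have [q /andP[qn nq2]] := sqrt_bracket n0.
have q1q : (q1 <= q.+1)%N.
  by have := leq_ltn_trans nq nq2; rewrite ltn_sqr; lia.
have := hq _ q1q; rewrite ger0_norm// /h ler_pdivrMr ?exprn_gt0// => hS.
have : pos (\sum_(p : 'I_(q.+2 ^ 2) * 'I_(q.+2 ^ 2)) V p.1 p.2 - v * q.+2%:R ^+ 4) <=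
    e * q.+2%:R ^+ 4.
  rewrite -(@ler_pXn2r _ 2)// ?nnegrE//; last by rewrite mulr_ge0 ?exprn_ge0// ltW.
  by apply: le_trans hS _; rewrite exprMn -exprM.
move/(le_trans (le_pos _)); rewrite lerBlDr -mulrDl addrC => hS2.
have h1 : \sum_(j < n) \sum_(k < n) V j k <=
    \sum_(p : 'I_(q.+2 ^ 2) * 'I_(q.+2 ^ 2)) V p.1 p.2.
  rewrite -(pair_bigA _ (fun j k : 'I__ => V j k)) /=.
  rewrite -(subnKC (ltnW nq2)) big_split_ord /=.
  apply: (@le_trans _ _ (\sum_(j < n) \sum_(k < n + (q.+2 ^ 2 - n)) V j k)).
    apply: ler_sum => j _; rewrite big_split_ord /= lerDl.
    by apply: sumr_ge0 => k _.
  by rewrite lerDl; apply: sumr_ge0 => j _; apply: sumr_ge0.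
apply: le_trans h1 _; apply: le_trans hS2 _.
have v0 : 0 <= v by apply: le_trans (Z_mean 0 0 0); exact: Ex_ge0.
rewrite (_ : 16 * (v + e) * n%:R ^+ 2 = (v + e) * (16 * n%:R ^+ 2)); last by ring.
apply: ler_wpM2l; first by rewrite addr_ge0// ltW.
rewrite -!natrX -natrM ler_nat; apply: (@leq_trans (16 * (q.+1 ^ 2) ^ 2)).
  rewrite -expnM (_ : 16 = 2 ^ 4)%N// -expnMn leq_exp2r//; lia.
by rewrite leq_mul2l /= leq_exp2r.
Qed.

End pair_sums.

Section noise_bounds.
Context d (T : measurableType d) (R : realType) (P : probability T R).
Local Notation C := R[i].
Local Notation cRe := (@complex.Re R).
Local Notation cIm := (@complex.Im R).
Context (xi : nat -> nat -> T -> C).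
Let X (lj : nat * nat) := xi lj.1 lj.2.
Context (X_meas : forall lj, complex_rv (X lj)).
Context (X_indep : mutually_independent P (fun lj => sigma_rv (X lj))).
Context (xiM : forall l j, call_moments P (xi l j)).
Context (xiE : forall l j, cEx P (xi l j) = 0).
Context (xiV : forall l j, Ex P (fun w => absq (xi l j w)) = 1).
Context (c : R) (c0 : 0 <= c) (xiB : forall l j, Ex P (fun w => absq (xi l j w) ^+ 4) <= c).
Context (y : nat -> R).

Let kappa : R := 16 * c + 9.

Lemma cadapted_absq A (f : T -> C) : cadapted X A f -> adapted X A (fun w => absq (f w)).
Proof.
by move=> [f1 f2]; apply: measurable_funD; exact: measurable_funX.
Qed.

(** Entries without a common index depend on disjoint columns, which gives the lack of correlation
    required by [pair_sum_le]. *)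
Lemma noise_frobenius_ae m (S : R) : (forall K, \sum_(m <= l < m + K) y l ^+ 2 <= S) ->
  {ae P, forall w, forall V : nat -> nat -> C,
    (forall j k, ccvg (fun K => noise xi y m K j k w) (V j k)) ->
    forall e, 0 < e -> \forall n \near \oo,
      \sum_(j < n) \sum_(k < n) absq (V j k) <= 16 * (2 * (kappa * S) + e) * n%:R ^+ 2}.
Proof.
move=> yS.
have kappa0 : 0 <= kappa by rewrite /kappa; move: c0; lra.
have y0 K : 0 <= \sum_(m <= l < m + K) y l ^+ 2 by apply: sumr_ge0 => l _; exact: sqr_ge0.
have S0 : 0 <= S := le_trans (y0 0%N) (yS 0%N).
have mn K j k : call_moments P (noise xi y m K j k) by exact: noiseM.
have mean K j k : Ex P (fun w => absq (noise xi y m K j k w)) <= 2 * (kappa * S).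
  have [h _] := noise_moments X_meas X_indep xiM xiE xiV c0 xiB y m K j k.
  by apply: le_trans h _; rewrite ler_wpM2l// ler_wpM2l.
have sq K j k : Ex P (fun w => absq (noise xi y m K j k w) ^+ 2) <= 12 * (kappa * S) ^+ 2.
  have [_ h] := noise_moments X_meas X_indep xiM xiE xiV c0 xiB y m K j k.
  apply: le_trans h _; rewrite ler_wpM2l// lerXn2r// ?nnegrE ?mulr_ge0//.
  by rewrite ler_wpM2l.
pose D j k : set (nat * nat) := [set lj | lj.2 = j \/ lj.2 = k].
have uncor K j k j' k' : j != j' -> j != k' -> k != j' -> k != k' ->
    Ex P (fun w => absq (noise xi y m K j k w) * absq (noise xi y m K j' k' w)) =
    Ex P (fun w => absq (noise xi y m K j k w)) * Ex P (fun w => absq (noise xi y m K j' k' w)).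
  move=> /eqP h1 /eqP h2 /eqP h3 /eqP h4.
  apply: (@Ex_adapted _ _ _ _ _ _ X_meas X_indep (D j k) (D j' k')).
  - by apply/seteqP; split => // -[l i] []; rewrite /D /= => -[->|->] [].
  - exact: call_moments_absq.
  - exact: call_moments_absq.
  - by apply: cadapted_absq; apply: noise_adapted => x; [left|right].
  - by apply: cadapted_absq; apply: noise_adapted => x; [left|right].
have := pair_sum_le (fun K j k w => absq_ge0 _) (fun K j k => call_moments_absq (mn K j k)) mean sq uncor.
by apply: filterS => w hw V cV; apply: (hw (fun j k => absq (V j k))) => j k; exact: ccvg_absq.
Qed.

Context (B : R) (y_sum : forall n, \sum_(0 <= l < n) y l ^+ 2 <= B).

(** The centered series is the diagonal noise with weights y_l^2, which are square summable because
    y_l^2 <= B, so [noise_cvg] applies to it; the convergent sum of the y_l^2 undoes the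
    centering. *)
Lemma row_energy_cvg : {ae P, forall w, forall a,
  cvgn (series (fun l => y l ^+ 2 * absq (xi l a w)))}.
Proof.
have y2 l : y l ^+ 2 <= B.
  apply: le_trans (y_sum l.+1); rewrite big_nat_recr//= lerDr.
  by apply: sumr_ge0 => i _; exact: sqr_ge0.
have y4 n : \sum_(0 <= l < n) (y l ^+ 2) ^+ 2 <= B * B.
  apply: (@le_trans _ _ (\sum_(0 <= l < n) B * y l ^+ 2)).
    by apply: ler_sum => l _; rewrite expr2 ler_wpM2r// sqr_ge0.
  rewrite -mulr_sumr ler_wpM2l//; exact: le_trans (sqr_ge0 (y 0)) (y2 0%N).
have cy : cvgn (series (fun l => y l ^+ 2)).
  apply: nondecreasing_is_cvgn.
    by apply: nondecreasing_series => n _ _; exact: sqr_ge0.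
  by exists B => _ [n _ <-]; exact: y_sum.
have := noise_cvg X_meas X_indep xiM xiE xiV c0 xiB y4.
apply: filterS => w hw a; have [z [zr _]] := hw a a.
have h : (series (fun l => y l ^+ 2 * absq (xi l a w))) =
   (fun K => complex.Re (noise xi (fun l => y l ^+ 2) 0 K a a w)) \+ series (fun l => y l ^+ 2).
  apply/funext => K; rewrite /series /= noiseE /= add0n -big_split /=.
  apply: eq_bigr => l _; rewrite /pair_dev eqxx.
  by case: (xi l a w) => p q; rewrite /absq /=; ring.
rewrite h; apply: is_cvgD => //; exact: cvgP zr.
Qed.

End noise_bounds.

(** * Wigner matrices *)

Section wigner.
Context d (T : measurableType d) (R : realType) (P : probability T R).
Local Notation C := R[i].
Local Notation cRe := (@complex.Re R).
Local Notation cIm := (@complex.Im R).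
Context (G : nat -> nat -> T -> C) (G_herm : forall j k w, G k j w = conjc (G j k w)).
Let edges := {jk : nat * nat | (jk.1 <= jk.2)%N}.
Let X (e : edges) := G (val e).1 (val e).2.
Context (X_meas : forall e, complex_rv (X e)).
Context (X_indep : mutually_independent P (fun e => sigma_rv (X e))).
Context (GM : forall j k, call_moments P (G j k)).
Context (GE : forall j k, cEx P (G j k) = 0).
Context (c : R) (c0 : 0 <= c) (GB : forall j k, Ex P (fun w => absq (G j k w) ^+ 4) <= c).

Fact edge_subproof j k : ((minn j k, maxn j k).1 <= (minn j k, maxn j k).2)%N.
Proof. by rewrite /= geq_min leq_max leqnn. Qed.

(** The unordered pair, represented by its ordered version: [G j k] and [G k j] are functions of the
    same independent variable. *)
Let edge j k : edges := exist _ (minn j k, maxn j k) (edge_subproof j k).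

Let edgeP j k j' k' : edge j k = edge j' k' -> (j = j' /\ k = k') \/ (j = k' /\ k = j').
Proof. by move=> /(congr1 val) /= [h1 h2]; move: h1 h2; lia. Qed.

Let edgeC j k : edge j k = edge k j.
Proof. by apply: val_inj; rewrite /= minnC maxnC. Qed.

Lemma wigner_adapted j k (A : set edges) : A (edge j k) -> cadapted X A (G j k).
Proof.
wlog jk : j k / (j <= k)%N.
  move=> h; have [jk|/ltnW kj] := leqP j k; first exact: h.
  rewrite edgeC => A'; have -> : G j k = (fun w => conjc (G k j w)).
    by apply/funext => w; rewrite -G_herm.
  by apply: cadaptedJ; exact: h.
move=> Ae; have -> : G j k = X (edge j k).
  by rewrite /X /= (minn_idPl jk) (maxn_idPr jk).
exact: cadapted_gen.
Qed.

Let absq2 j k : Ex P (fun w => absq (G j k w) ^+ 2) <= 1 + c.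
Proof.
have m := call_moments_absq (GM j k).
apply: (@le_trans _ _ (Ex P (fun w => 1 + absq (G j k w) ^+ 4))).
  apply: Ex_le; first exact: all_momentsX.
    by apply: all_momentsD; [exact: all_moments_cst|exact: all_momentsX].
  move=> w; move: (absq _) => u; rewrite (_ : u ^+ 4 = (u ^+ 2) ^+ 2) -?exprM//.
  by have := sqr_ge0 (u ^+ 2 - 1); nra.
by rewrite ExD ?Ex_cst ?lerD2l//; [exact: all_moments_cst|exact: all_momentsX].
Qed.

Let absq1 j k : Ex P (fun w => absq (G j k w)) <= 2 + c.
Proof.
have m := call_moments_absq (GM j k).
apply: (@le_trans _ _ (Ex P (fun w => 1 + absq (G j k w) ^+ 2))).
  apply: Ex_le => //.
    by apply: all_momentsD; [exact: all_moments_cst|exact: all_momentsX].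
  by move=> w; move: (absq _) => u; have := sqr_ge0 (u - 1); nra.
rewrite ExD ?Ex_cst//; [|exact: all_moments_cst|exact: all_momentsX].
by have := absq2 j k; lra.
Qed.

(** An entry whose edge differs from the three others is independent of them, and its zero mean
    factors out. *)
Lemma wigner_isolated j k j1 k1 j2 k2 j3 k3 :
  edge j k <> edge j1 k1 -> edge j k <> edge j2 k2 -> edge j k <> edge j3 k3 ->
  cEx P (fun w => G j k w * (G j1 k1 w * conjc (G j2 k2 w * G j3 k3 w))) = 0.
Proof.
move=> h1 h2 h3; rewrite (@cEx_adapted _ _ _ _ _ _ X_meas X_indep [set edge j k]
  (~` [set edge j k])).
- by rewrite GE mul0r.
- exact: setICr.
- exact: GM.
- by apply: call_momentsM => //; apply: call_momentsJ; exact: call_momentsM.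
- exact: wigner_adapted.
- apply: cadaptedM; first by apply: wigner_adapted => /= e; apply: h1.
  apply: cadaptedJ; apply: cadaptedM; apply: wigner_adapted => /= e; [exact: h2|exact: h3].
Qed.

(** General term in the expansion of the squared modulus of the entry (j, k) of G^2. *)
Let quad j i i' k w := G j i w * G i k w * conjc (G j i' w * G i' k w).

(* Some entry occurs only once in the product: [G i k] in general, and the
   diagonal entry [G j i] when [(i, k)] and [(j, i')] are the same edge. *)
Let quad_eq0 (j i i' k : nat) : i != i' -> j != k -> cEx P (quad j i i' k) = 0.
Proof.
move=> /eqP ii' /eqP jk; have [e|/eqP e] := eqVneq (edge i k) (edge j i').
  have [[-> kE]|[]] := edgeP e; last by move=> ? kE; case: jk.
  have -> : quad j j i' k = (fun w => G j j w * (G j k w * conjc (G j i' w * G i' k w))).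
    by apply/funext => w; rewrite /quad !mulrA.
  by apply: wigner_isolated => /edgeP; lia.
have -> : quad j i i' k = (fun w => G i k w * (G j i w * conjc (G j i' w * G i' k w))).
  by apply/funext => w; rewrite /quad mulrCA mulrA mulrC mulrA.
apply: wigner_isolated => //; move=> /edgeP; lia.
Qed.

Let quadM j i i' k : call_moments P (quad j i i' k).
Proof.
by apply: call_momentsM; [exact: call_momentsM|apply: call_momentsJ; exact: call_momentsM].
Qed.

Let quad_le j i i' k : cRe (cEx P (quad j i i' k)) <= 1 + c.
Proof.
pose S w := 4^-1 * ((absq (G j i w) ^+ 2 + absq (G i k w) ^+ 2) +
   (absq (G j i' w) ^+ 2 + absq (G i' k w) ^+ 2)).
have m j' k' : all_moments P (fun w => absq (G j' k' w) ^+ 2).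
  by apply: all_momentsX; exact: call_moments_absq.
have m2 j' k' j'' k'' : all_moments P (fun w => absq (G j' k' w) ^+ 2 + absq (G j'' k'' w) ^+ 2).
  exact: all_momentsD.
rewrite Re_cEx; apply: (@le_trans _ _ (Ex P S)).
  apply: Ex_le; first exact: (quadM j i i' k).1.
    by apply: all_momentsZ; exact: all_momentsD.
  move=> w; rewrite /quad /S.
  have h (u v : C) : cRe (u * conjc v) <= (absq u + absq v) / 2.
    case: u v => a b [a' b']; rewrite /absq /=.
    by have := sqr_ge0 (a - a'); have := sqr_ge0 (b - b'); nra.
  apply: le_trans (h _ _) _; rewrite !absqM.
  move: (absq _) (absq _) (absq _) (absq _) => p q p' q'.
  by have := sqr_ge0 (p - q); have := sqr_ge0 (p' - q'); nra.
rewrite /S ExZ; last exact: all_momentsD.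
rewrite ExD// !ExD//.
by have := absq2 j i; have := absq2 i k; have := absq2 j i'; have := absq2 i' k; lra.
Qed.

Let sq_frob n w := \sum_(j < n) \sum_(k < n) absq (\sum_(i < n) G j i w * G i k w).

Let sq_entryM n j k : call_moments P (fun w => \sum_(i < n) G j i w * G i k w).
Proof. by apply: call_moments_sum => i; exact: call_momentsM. Qed.

Let sq_frobM n : all_moments P (sq_frob n).
Proof.
apply: all_moments_sum => j; apply: all_moments_sum => k.
exact: call_moments_absq (sq_entryM _ _ _).
Qed.

(** The surviving terms have i = i', n of them for each of the n^2 pairs (j, k), or j = k, n^2 for
    each of the n diagonal pairs. *)
Let sq_frob_le n : Ex P (sq_frob n) <= 2 * (1 + c) * n%:R ^+ 3.
Proof.
have c1 : 0 <= 1 + c by move: c0; lra.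
have E j k : Ex P (fun w => absq (\sum_(i < n) G j i w * G i k w)) <=
    \sum_(i < n) \sum_(i' < n) (1 + c) * ((i == i')%:R + (j == k)%:R).
  rewrite Ex_absq_sum; last by move=> i; exact: call_momentsM.
  apply: ler_sum => i _; apply: ler_sum => i' _; rewrite -/(quad j i i' k).
  have [ii'|ii'] := eqVneq i i'.
    by apply: le_trans (quad_le _ _ _ _) _; rewrite ler_peMr// lerDl.
  have [jk|jk] := eqVneq j k.
    by apply: le_trans (quad_le _ _ _ _) _; rewrite ler_peMr// lerDr.
  by rewrite quad_eq0// addr0 mulr0.
have h (i : 'I_n) : \sum_(i' < n) (i == i')%:R = 1 :> R.
  by rewrite (bigD1 i)//= eqxx big1 ?addr0// => j ja; rewrite eq_sym (negbTE ja).
rewrite Ex_sum; last first.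
  by move=> j; apply: all_moments_sum => k; exact: call_moments_absq (sq_entryM _ _ _).
apply: (@le_trans _ _ (\sum_(j < n) \sum_(k < n) (1 + c) * (n%:R + (j == k)%:R * n%:R ^+ 2))).
  apply: ler_sum => j _; rewrite Ex_sum; last first.
    by move=> k; exact: call_moments_absq (sq_entryM _ _ _).
  apply: ler_sum => k _; apply: le_trans (E j k) _.
  under eq_bigr do rewrite -mulr_sumr big_split /= h sumr_const card_ord.
  rewrite sumr_const card_ord -[leLHS]mulr_natr -mulrA ler_wpM2l// le_eqVlt.
  apply/orP; left; apply/eqP; rewrite val_eqE -mulr_natr; ring.
under eq_bigr do rewrite -mulr_sumr big_split /= sumr_const card_ord -mulr_suml h.
rewrite sumr_const card_ord -[leLHS]mulr_natr -[_ *+ n]mulr_natr le_eqVlt.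
by apply/orP; left; apply/eqP; ring.
Qed.

(* [|G v|^4 <= |v|^2 |G^2 v|^2 <= |G^2|_F^2 |v|^4] where the squared Frobenius norm
   has mean O(n^3), hence is O(n^4) times a null sequence along squares; other [n]
   are handled by extending [v] by zero. *)
Lemma wigner_op_ae : {ae P, forall w, forall e, 0 < e -> \forall n \near \oo,
  forall v : 'I_n -> C,
    \sum_(j < n) absq (\sum_(k < n) G j k w * v k) <= e * n%:R ^+ 2 * \sum_(k < n) absq (v k)}.
Proof.
(* [K] is a dummy here; the denominator is the fourth power of n = (q+1)^2. *)
pose f q (K : nat) w := sq_frob (q.+1 ^ 2) w / q.+1%:R ^+ 8.
have mf q K : all_moments P (f q K).
  by rewrite /f; under eq_fun do rewrite mulrC; exact: all_momentsZ.
have frob0 n w : 0 <= sq_frob n w.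
  by apply: sumr_ge0 => j _; apply: sumr_ge0 => k _; exact: absq_ge0.
have f0 q K w : 0 <= f q K w by rewrite divr_ge0 ?exprn_ge0.
have c1 : 0 <= 1 + c by move: c0; lra.
have Ef q K : Ex P (f q K) <= 2 * (1 + c) * (q.+1%:R ^+ 2)^-1.
  rewrite /f; under eq_fun do rewrite mulrC.
  rewrite ExZ//; apply: le_trans (ler_wpM2l _ (sq_frob_le (q.+1 ^ 2))) _.
    by rewrite invr_ge0 exprn_ge0.
  rewrite natrX le_eqVlt; apply/orP; left; apply/eqP; field.
  by rewrite nat1r pnatr_eq0.
have uB n : \sum_(q < n) 2 * (1 + c) * (q.+1%:R ^+ 2)^-1 <= 2 * (1 + c) * 2.
  by rewrite -mulr_sumr ler_wpM2l ?mulr_ge0// sum_inv_sqr.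
have := fatou_cvg0 mf f0 Ef uB; apply: filterS => w /(_ (fun q => f q 0%N w)) hw e e0.
have {}hw : f q 0%N w @[q --> \oo] --> (0 : R) by apply: hw => q; exact: cvg_cst.
(* The 16 pays for the extension from n to (q+2)^2, as (q+2)^4 <= 16 n^2. *)
pose e' := e / 16; have e'0 : 0 < e' by rewrite divr_gt0.
have [q1 _ hq] : \forall q \near \oo, `|f q 0%N w| <= e' ^+ 2.
  by move/cvgr0Pnorm_le: hw; apply; rewrite exprn_gt0.
exists (q1.+1 ^ 2)%N => // n /= nq v.
have n0 : (0 < n)%N by apply: leq_trans nq; rewrite expn_gt0.
have [q /andP[qn nq2]] := sqrt_bracket n0.
have q1q : (q1 <= q.+1)%N.
  by have := leq_ltn_trans nq nq2; rewrite ltn_sqr; lia.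
have := hq _ q1q; rewrite ger0_norm// /f ler_pdivrMr ?exprn_gt0// => hS.
set N := (q.+2 ^ 2)%N in hS nq2.
pose u (k : nat) : C := if insub k is Some i then v i else 0.
have uE (k : 'I_n) : u k = v k by rewrite /u valK.
have u0 k : (n <= k)%N -> u k = 0 by move=> nk; rewrite /u insubF// ltnNge nk.
have sumN (F : nat -> C) : \sum_(k < N) F k * u k = \sum_(k < n) F k * v k.
  rewrite -(subnKC (ltnW nq2)) big_split_ord /= [X in _ + X]big1 ?addr0 => [|k _].
    by apply: eq_bigr => k _; rewrite uE.
  by rewrite u0 ?mulr0// leq_addr.
have nrmN : \sum_(k < N) absq (u k) = \sum_(k < n) absq (v k).
  rewrite -(subnKC (ltnW nq2)) big_split_ord /= [X in _ + X]big1 ?addr0 => [|k _].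
    by apply: eq_bigr => k _; rewrite uE.
  by rewrite u0 ?absq0// leq_addr.
pose A : 'M[C]_N := \matrix_(j, k) G j k w; pose U : 'cV[C]_N := \col_k u k.
have AU j : (A *m U) j ord0 = \sum_(k < N) G j k w * u k.
  by rewrite mxE; apply: eq_bigr => k _; rewrite !mxE.
have A2 : nrm2 (A *m (A *m U)) <= sq_frob N w * nrm2 U.
  rewrite mulmxA /sq_frob /nrm2 mulr_suml; apply: ler_sum => j _.
  rewrite mxE; apply: le_trans (absq_sum_le _ _) _; rewrite ler_wpM2r ?nrm2_ge0//.
  apply: ler_sum => k _; rewrite mxE le_eqVlt; apply/orP; left; apply/eqP; congr absq.
  by apply: eq_bigr => i _; rewrite !mxE.
have AA : nrm2 (A *m U) = cRe (dotc U (A *m (A *m U))).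
  rewrite nrm2_eqRe; congr cRe; rewrite /dotc.
  under eq_bigr => j _ do rewrite [X in conjc X]mxE rmorph_sum mulr_suml.
  rewrite exchange_big /=; apply: eq_bigr => k _.
  rewrite [(A *m (A *m U)) _ _]mxE mulr_sumr; apply: eq_bigr => j _.
  have -> : A k j = conjc (A j k) by rewrite !mxE -G_herm.
  by rewrite rmorphM /= mulrA [conjc (U _ _) * _]mulrC.
have A4 : nrm2 (A *m U) ^+ 2 <= nrm2 U * nrm2 (A *m (A *m U)).
  by apply: le_trans (cauchy_schwarz _ _); rewrite AA lerDl sqr_ge0.
have UE : nrm2 U = \sum_(k < n) absq (v k).
  by rewrite -nrmN; apply: eq_bigr => k _; rewrite mxE.
have A5 : nrm2 (A *m U) <= e' * q.+2%:R ^+ 4 * nrm2 U.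
  rewrite -(@ler_pXn2r _ 2)// ?nnegrE ?nrm2_ge0//; last first.
    by rewrite mulr_ge0 ?nrm2_ge0// mulr_ge0 ?exprn_ge0// ltW.
  apply: le_trans A4 _; apply: (@le_trans _ _ (nrm2 U * (e' ^+ 2 * q.+2%:R ^+ 8 * nrm2 U))).
    rewrite ler_wpM2l ?nrm2_ge0//; apply: le_trans A2 _.
    by rewrite ler_wpM2r ?nrm2_ge0.
  by rewrite le_eqVlt; apply/orP; left; apply/eqP; ring.
apply: (@le_trans _ _ (nrm2 (A *m U))).
  rewrite /nrm2; under [leRHS]eq_bigr do rewrite AU (sumN (fun k => G _ k w)).
  rewrite -(subnKC (ltnW nq2)) big_split_ord /= lerDl.
  by apply: sumr_ge0 => j _; exact: absq_ge0.
apply: le_trans A5 _; rewrite -UE ler_wpM2r ?nrm2_ge0//.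
rewrite (_ : e * n%:R ^+ 2 = e' * (16 * n%:R ^+ 2)); last by rewrite /e'; field.
rewrite ler_wpM2l ?(ltW e'0)// -!natrX -natrM ler_nat.
apply: (@leq_trans (16 * (q.+1 ^ 2) ^ 2)).
  rewrite -expnM (_ : 16 = 2 ^ 4)%N// -expnMn leq_exp2r//; lia.
by rewrite leq_mul2l /= leq_exp2r.
Qed.

(** The entries of a row are carried by distinct edges, so their squared moduli obey a law of large
    numbers; [3 + c] is the bound [2 + c] on the means plus a margin of 1. *)
Lemma wigner_row_ae : {ae P, forall w, forall a, exists B : R, \forall n \near \oo,
  \sum_(k < n) absq (G a k w) <= B * n%:R}.
Proof.
apply: ae_foralln => a.
pose mu k := Ex P (fun w => absq (G a k w)).
pose W (K k : nat) w : C := ((absq (G a k w) - mu k)%:C)%C.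
have mY k : all_moments P (fun w => absq (G a k w) - mu k).
  by apply: all_momentsB; [exact: call_moments_absq|exact: all_moments_cst].
have mW K k : call_moments P (W K k) by split => //=; exact: all_moments_cst.
have EW K k : cEx P (W K k) = 0.
  rewrite /cEx /= Ex_cst ExB ?Ex_cst ?subrr//; [exact: call_moments_absq|exact: all_moments_cst].
have aW K k : cadapted X [set edge a k] (W K k).
  split => /=; last exact: measurable_cst.
  have [h1 h2] : cadapted X [set edge a k] (G a k) by exact: wigner_adapted.
  apply: measurable_funB; last exact: measurable_cst.
  by apply: measurable_funD; exact: measurable_funX.
have orth K k k' : k != k' -> cRe (cEx P (fun w => W K k w * conjc (W K k' w))) = 0.
  move=> /eqP kk'; rewrite (@cEx_adapted _ _ _ _ _ _ X_meas X_indep [set edge a k] [set edge a k']).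
  - by rewrite EW mul0r.
  - by apply/seteqP; split => // x /= [-> /edgeP]; lia.
  - exact: mW.
  - exact: call_momentsJ.
  - exact: aW.
  - exact: cadaptedJ.
have WB K k : Ex P (fun w => absq (W K k w)) <= 1 + c.
  apply: le_trans (absq2 a k); rewrite /W; under eq_fun do rewrite absqR.
  have E w : (absq (G a k w) - mu k) ^+ 2 = absq (G a k w) ^+ 2 +
      (- (2 * mu k) * absq (G a k w) + mu k ^+ 2) by ring.
  under eq_fun do rewrite E.
  have m1 := call_moments_absq (GM a k).
  have m3 : all_moments P (fun=> mu k ^+ 2) by exact: all_moments_cst.
  have m4 : all_moments P (fun w => - (2 * mu k) * absq (G a k w)) by exact: all_momentsZ.
  rewrite ExD; [|exact: all_momentsX|exact: all_momentsD].
  rewrite ExD// ExZ// Ex_cst.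
  by rewrite -/(mu k); have := sqr_ge0 (mu k); lra.
have := l2_slln mW WB orth; apply: filterS => w.
move=> /(_ (fun k => W 0%N k w) (fun k => ccvg_cst _)) [h _].
exists (3 + c).
have h1 : \forall n \near \oo,
   cRe (((n%:R^-1)%:C)%C * \sum_(k < n) W 0%N k w) <= 1.
  by apply: (cvgr_le _ h); rewrite /= ltr01.
apply: filter_app h1; near=> n => h1.
have n0 : 0 < n%:R :> R by rewrite ltr0n; near: n; exists 1%N.
move: h1; rewrite cRe_real Re_sum /= mulrC ler_pdivrMr// mul1r sumrB lerBlDr.
move=> /le_trans; apply.
have : \sum_(k < n) mu k <= \sum_(k < n) (2 + c) by apply: ler_sum => k _; exact: absq1.
rewrite sumr_const card_ord -[leRHS]mulr_natr; lra.
Unshelve. all: by end_near. Qed.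

Context (xi : nat -> nat -> T -> C).
Let Xi (lj : nat * nat) := xi lj.1 lj.2.
Context (Xi_meas : forall lj, complex_rv (Xi lj)).
Context (Xi_indep : mutually_independent P (fun lj => sigma_rv (Xi lj))).
Context (xiM : forall l j, call_moments P (xi l j)).
Context (xiE : forall l j, cEx P (xi l j) = 0).
Context (b : R) (b0 : 0 <= b) (xiB : forall l j, Ex P (fun w => absq (xi l j w) ^+ 4) <= b).
Context (xi_G_indep : independent_families P (fun lj : nat * nat => xi lj.1 lj.2)
  (fun jk : nat * nat => G jk.1 jk.2)).

Let GG (jk : nat * nat) := G jk.1 jk.2.

Lemma Ex_families f g : all_moments P f -> all_moments P g ->
  adapted Xi setT f -> adapted GG setT g -> Ex P (fun w => f w * g w) = Ex P f * Ex P g.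
Proof.
move=> mf mg af ag; apply: Ex_indep => // S S' mS mS'.
have hf := adapted_preimage af mS; have hg := adapted_preimage ag mS'.
exact: xi_G_indep.
Qed.

Lemma cEx_families Y Z : call_moments P Y -> call_moments P Z ->
  cadapted Xi setT Y -> cadapted GG setT Z -> cEx P (fun w => Y w * Z w) = cEx P Y * cEx P Z.
Proof.
move=> [y1 y2] [z1 z2] [ay1 ay2] [az1 az2]; rewrite {1}/cEx.
under eq_fun do rewrite cReM; under [in X in (_ +i* X)%C]eq_fun do rewrite cImM.
rewrite ExB; [|exact: all_momentsM..]; rewrite ExD; [|exact: all_momentsM..].
by rewrite !Ex_families.
Qed.

(** Orthogonality of the summands comes from the xi alone: the product of two entries of G factors
    out by independence of the two families. *)
Lemma wigner_spike_ae : {ae P, forall w, forall a l,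
  ccvg (fun n => ((n%:R^-1)%:C)%C * \sum_(k < n) G a k w * xi l k w) 0}.
Proof.
apply: ae_foralln => a; apply: ae_foralln => l.
pose W (K k : nat) w := G a k w * xi l k w.
have mW K k : call_moments P (W K k) by exact: call_momentsM.
have orth K k k' : k != k' -> cRe (cEx P (fun w => W K k w * conjc (W K k' w))) = 0.
  move=> kk'; have -> : (fun w => W K k w * conjc (W K k' w)) = (fun w =>
      (xi l k w * conjc (xi l k' w)) * (G a k w * conjc (G a k' w))).
    by apply/funext => w; rewrite /W rmorphM /= mulrACA mulrC.
  have aX k0 : cadapted Xi setT (xi l k0) by exact: (@cadapted_gen _ _ _ _ Xi setT (l, k0)).
  have aG k0 : cadapted GG setT (G a k0) by exact: (@cadapted_gen _ _ _ _ GG setT (a, k0)).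
  rewrite cEx_families.
  - by rewrite (xi_prod Xi_meas Xi_indep xiM xiE) ?mul0r// xpair_eqE eqxx.
  - by apply: call_momentsM => //; exact: call_momentsJ.
  - by apply: call_momentsM => //; exact: call_momentsJ.
  - by apply: cadaptedM => //; exact: cadaptedJ.
  - by apply: cadaptedM => //; exact: cadaptedJ.
have WB K k : Ex P (fun w => absq (W K k w)) <= 2 + c + b.
  have mG := call_moments_absq (GM a k); have mX := call_moments_absq (xiM l k).
  apply: (@le_trans _ _ (Ex P (fun w => absq (G a k w) ^+ 2 + (1 + absq (xi l k w) ^+ 4)))).
    apply: Ex_le; first exact: call_moments_absq.
      apply: all_momentsD; first exact: all_momentsX.
      by apply: all_momentsD; [exact: all_moments_cst|exact: all_momentsX].
    move=> w; rewrite /W absqM; move: (absq (G a k w)) (absq (xi l k w)) => u v.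
    rewrite (_ : v ^+ 4 = (v ^+ 2) ^+ 2) -?exprM//.
    by have := sqr_ge0 (u - v); have := sqr_ge0 (v ^+ 2 - 1); have := sqr_ge0 u; nra.
  have m1 : all_moments P (fun=> 1 : R) by exact: all_moments_cst.
  rewrite ExD; [|exact: all_momentsX|by apply: all_momentsD => //; exact: all_momentsX].
  rewrite ExD ?Ex_cst//; last exact: all_momentsX.
  by have := absq2 a k; have := xiB l k; lra.
have := l2_slln mW WB orth; apply: filterS => w.
by move=> /(_ (fun k => W 0%N k w) (fun k => ccvg_cst _)).
Qed.

End wigner.

(** * The model at a fixed realization *)

Section spiked_model.
Context {R : realType}.
Local Notation C := R[i].
Local Notation cRe := (@complex.Re R).

Lemma ccvg_shift (u : nat -> C) (z : C) L : ccvg u z -> ccvg (fun K => u (L + K)%N) z.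
Proof.
move=> [u1 u2]; split.
  by move: u1; rewrite -(cvg_shiftn L); under eq_fun do rewrite addnC.
by move: u2; rewrite -(cvg_shiftn L); under eq_fun do rewrite addnC.
Qed.

Lemma sum_delta n (a : 'I_n) (v : 'I_n -> C) :
  \sum_(k < n) (val a == val k)%:R * v k = v a.
Proof.
rewrite (bigD1 a)//= eqxx mul1r big1 ?addr0// => k ka.
by rewrite val_eqE eq_sym (negbTE ka) mul0r.
Qed.

Context (gamma1 s c : R) (y : nat -> R) (g xi z : nat -> nat -> C).

Definition tail m K j k : C :=
  \sum_(m <= l < m + K) ((y l)%:C)%C * (xi l j * conjc (xi l k) - (j == k)%:R).
Definition entry j k : C :=
  (gamma1%:C)%C * (j == k)%:R + (s%:C)%C * g j k + z j k.

Context (y_tail : forall e, 0 < e -> exists L, forall K, \sum_(L <= l < L + K) y l ^+ 2 <= e).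
Context (g_herm : forall j k, g k j = conjc (g j k)).
Context (z_cvg : forall j k, ccvg (fun K => tail 0 K j k) (z j k)).
Context (gram_cvg : forall a b, ccvg (fun n => gram xi n a b) ((a == b)%:R)).
Context (g_op : forall e, 0 < e -> \forall n \near \oo, forall v : 'I_n -> C,
  \sum_(j < n) absq (\sum_(k < n) g j k * v k) <= e * n%:R ^+ 2 * \sum_(k < n) absq (v k)).
Context (g_row : forall a, exists B : R, \forall n \near \oo,
  \sum_(k < n) absq (g a k) <= B * n%:R).
Context (g_spike : forall a l, ccvg (fun n => ((n%:R^-1)%:C)%C * \sum_(k < n) g a k * xi l k) 0).
(** Thresholds 1/(i+1) instead of arbitrary reals, so that countably many almost sure events
    suffice. *)
Context (tail_op : forall m (i : nat), (forall K, \sum_(m <= l < m + K) y l ^+ 2 <= i.+1%:R^-1) ->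
  forall V : nat -> nat -> C, (forall j k, ccvg (fun K => tail m K j k) (V j k)) ->
  \forall n \near \oo, \sum_(j < n) \sum_(k < n) absq (V j k) <= c * i.+1%:R^-1 * n%:R ^+ 2).
Context (tail_row : forall m a (V : nat -> C) (tau : R),
  (forall k, ccvg (fun K => tail m K a k) (V k)) ->
  \sum_(m <= l < m + K) y l ^+ 2 * absq (xi l a) @[K --> \oo] --> tau ->
  ccvg (fun n => ((n%:R^-1)%:C)%C *
    \sum_(k < n) (((if k == a :> nat then 0 else absq (V k) - tau) : R)%:C)%C) 0).
Context (energy_cvg : forall a, cvgn (series (fun l => y l ^+ 2 * absq (xi l a)))).

Lemma spiked_herm j k : entry k j = conjc (entry j k).
Proof.
have conjD (p q : C) : conjc (p + q) = conjc p + conjc q by rewrite rmorphD.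
have tailJ K : conjc (tail 0 K j k) = tail 0 K k j.
  rewrite /tail rmorph_sum; apply: eq_bigr => l _ /=; rewrite conjc_scale rmorphB rmorphM /=.
  by rewrite conjcK [conjc _ * _]mulrC [k == j]eq_sym rmorph_nat.
have zJ : z k j = conjc (z j k).
  have [r1 i1] := ccvgJ (z_cvg j k); have [r2 i2] := z_cvg k j.
  apply/eqP; rewrite eq_complex; apply/andP; split; apply/eqP.
    rewrite -(cvg_lim (@Rhausdorff R) r2) -(cvg_lim (@Rhausdorff R) r1).
    by under eq_fun do rewrite -tailJ.
  rewrite -(cvg_lim (@Rhausdorff R) i2) -(cvg_lim (@Rhausdorff R) i1).
    by under eq_fun do rewrite -tailJ.
by rewrite /entry !conjD !conjc_scale -g_herm zJ rmorph_nat eq_sym.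
Qed.

Let rem L j k : C := z j k - tail 0 L j k.

Let rem_cvg L j k : ccvg (fun K => tail L K j k) (rem L j k).
Proof.
have h := ccvgB (ccvg_shift L (z_cvg j k)) (ccvg_cst (tail 0 L j k)).
apply: eq_ccvg h => K; rewrite /tail !add0n (big_cat_nat (n := L)) ?leq_addr//=.
by rewrite addrAC subrr add0r.
Qed.

(** The identity parts of the first [L] terms join gamma1 in a scalar, which is fixed with [L] and
    thus negligible against n. *)
Let entryE L j k : entry j k = ((gamma1 - \sum_(l < L) y l)%:C)%C * (j == k)%:R +
  (s%:C)%C * g j k + \sum_(l < L) ((y l)%:C)%C * (xi l j * conjc (xi l k)) + rem L j k.
Proof.
rewrite /entry /rem /tail add0n big_mkord.
under [X in _ = _ + (_ - X)]eq_bigr do rewrite mulrBr.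
rewrite sumrB -mulr_suml rmorphB rmorph_sum /=; ring.
Qed.

Lemma spiked_op e : 0 < e -> exists L0, forall L, (L0 <= L)%N ->
  \forall n \near \oo, forall v : 'cV[C]_n,
    nrm2 (trunc_mx entry n *m v - spike_sum xi y L v) <= e ^+ 2 * n%:R ^+ 2 * nrm2 v.
Proof.
(* By |p + q + r|^2 <= 2 |p|^2 + 4 |q|^2 + 4 |r|^2, three errors of relative size d add up to 10 d,
   below 16 d. *)
move=> e0; pose d := e ^+ 2 / 16; have d0 : 0 < d by rewrite divr_gt0// exprn_gt0.
have [i hi] : exists i, c * i.+1%:R^-1 <= d.
  have h : c * harmonic i @[i --> \oo] --> c * 0 by apply: cvgM; [exact: cvg_cst|exact: cvg_harmonic].
  rewrite mulr0 in h; have [i _ hi] : \forall i \near \oo, c * harmonic i <= d by apply: (cvgr_le _ h).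
  by exists i; exact: (hi i (leqnn i)).
have i0 : 0 < i.+1%:R^-1 :> R by rewrite invr_gt0 ltr0n.
have [L0 hL0] := y_tail i0; exists L0 => L L0L.
have hL K : \sum_(L <= l < L + K) y l ^+ 2 <= i.+1%:R^-1.
  apply: le_trans (hL0 (L - L0 + K)%N).
  rewrite addnA subnKC// [leRHS](big_cat_nat (n := L)) ?leq_addr//= lerDr.
  by apply: sumr_ge0 => l _; exact: sqr_ge0.
have h1 : \forall n \near \oo, \sum_(j < n) \sum_(k < n) absq (rem L j k) <=
    c * i.+1%:R^-1 * n%:R ^+ 2 := tail_op hL (rem_cvg L).
(* The added 1 covers [s = 0]. *)
pose d' := d / (s ^+ 2 + 1).
have s1 : 0 < s ^+ 2 + 1 by rewrite ltr_wpDl ?sqr_ge0.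
have d'0 : 0 < d' by rewrite divr_gt0.
have h2 := g_op d'0.
pose t := gamma1 - \sum_(l < L) y l.
have h3 : \forall n \near \oo, t ^+ 2 <= d * n%:R ^+ 2.
  have [N hN] : exists N : nat, t ^+ 2 / d <= N%:R.
    by exists (Num.truncn (t ^+ 2 / d)).+1; rewrite ltW// truncnS_gt.
  exists N.+1 => // n /= Nn; rewrite -ler_pdivrMl// mulrC; apply: le_trans hN _.
  by rewrite -natrX ler_nat; apply: leq_trans (ltnW Nn) _; rewrite -mulnn leq_pmulr// (leq_trans _ Nn).
near=> n.
have k1 : \sum_(j < n) \sum_(k < n) absq (rem L j k) <= c * i.+1%:R^-1 * n%:R ^+ 2 by near: n.
have k2 : forall v : 'I_n -> C, \sum_(j < n) absq (\sum_(k < n) g j k * v k) <=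
    d' * n%:R ^+ 2 * \sum_(k < n) absq (v k) by near: n.
have k3 : t ^+ 2 <= d * n%:R ^+ 2 by near: n.
move=> v.
have E (j : 'I_n) : (trunc_mx entry n *m v - spike_sum xi y L v) j ord0 =
   (t%:C)%C * v j ord0 + ((s%:C)%C * (\sum_(k < n) g j k * v k ord0) +
     \sum_(k < n) rem L j k * v k ord0).
  rewrite !mxE summxE.
  have -> : \sum_(l < L) ((((y l)%:C)%C * dotc (spike xi n l) v) *: spike xi n l) j ord0 =
    \sum_(k < n) \sum_(l < L) ((y l)%:C)%C * (xi l j * conjc (xi l k)) * v k ord0.
    rewrite exchange_big /=; apply: eq_bigr => l _; rewrite !mxE /dotc mulr_sumr mulr_suml.
    by apply: eq_bigr => k _; rewrite mxE; ring.
  rewrite -[v j ord0](sum_delta j (fun k => v k ord0)) !mulr_sumr -!big_split -sumrB /=.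
  apply: eq_bigr => k _; rewrite mxE (entryE L) -/t -mulr_suml.
  move: (\sum_(_ < _) _) (t%:C)%C (s%:C)%C => p q r; ring.
have a3 (p q r : C) : absq (p + (q + r)) <= 2 * absq p + (4 * absq q + 4 * absq r).
  apply: le_trans (absqD_le _ _) _; have := absqD_le q r; lra.
apply: (@le_trans _ _ (\sum_(j < n) (2 * absq ((t%:C)%C * v j ord0) +
  (4 * absq ((s%:C)%C * (\sum_(k < n) g j k * v k ord0)) +
   4 * absq (\sum_(k < n) rem L j k * v k ord0))))).
  by apply: ler_sum => j _; rewrite E a3.
rewrite !big_split -!mulr_sumr /=.
under eq_bigr do rewrite absqM absqR.
under [X in _ + (4 * X + _)]eq_bigr do rewrite absqM absqR.
rewrite -!mulr_sumr -/(nrm2 v).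
have v0 := nrm2_ge0 v.
have b1 : t ^+ 2 * nrm2 v <= d * n%:R ^+ 2 * nrm2 v by rewrite ler_wpM2r.
have b2 : s ^+ 2 * \sum_(j < n) absq (\sum_(k < n) g j k * v k ord0) <= d * n%:R ^+ 2 * nrm2 v.
  apply: (@le_trans _ _ ((s ^+ 2 + 1) * (d' * n%:R ^+ 2 * nrm2 v))).
    apply: ler_pM; rewrite ?sqr_ge0//.
      by apply: sumr_ge0 => j _; exact: absq_ge0.
    by rewrite lerDl.
  have sd : (s ^+ 2 + 1) * d' = d by rewrite mulrC /d' divfK ?gt_eqF.
  by rewrite -[leRHS]mulrA -sd; move: (n%:R ^+ 2) (nrm2 v) => p q; rewrite !mulrA.
have b3 : \sum_(j < n) absq (\sum_(k < n) rem L j k * v k ord0) <= d * n%:R ^+ 2 * nrm2 v.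
  apply: (@le_trans _ _ ((\sum_(j < n) \sum_(k < n) absq (rem L j k)) * nrm2 v)).
    by rewrite mulr_suml; apply: ler_sum => j _; exact: absq_sum_le.
  rewrite ler_wpM2r//; apply: le_trans k1 _.
  by rewrite ler_wpM2r// exprn_ge0.
have -> : e ^+ 2 * n%:R ^+ 2 * nrm2 v = 16 * (d * n%:R ^+ 2 * nrm2 v).
  by rewrite /d; field.
have x0 : 0 <= d * n%:R ^+ 2 * nrm2 v by rewrite mulr_ge0// mulr_ge0 ?exprn_ge0// ltW.
move: x0 b1 b2 b3; move: (d * n%:R ^+ 2 * nrm2 v) => p.
move: (t ^+ 2 * _) (s ^+ 2 * _) => q r; move: (\sum_(_ < _) _) => u; lra.
Unshelve. all: by end_near. Qed.

Let energy_ge0 L K a : 0 <= \sum_(L <= l < L + K) y l ^+ 2 * absq (xi l a).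
Proof. by apply: sumr_ge0 => l _; rewrite mulr_ge0 ?sqr_ge0 ?absq_ge0. Qed.

(** The single entry k = a, excluded from [tail_row], is absorbed by the linear growth of the
    margin. *)
Let rem_row L a tau e : 0 < e ->
  \sum_(L <= l < L + K) y l ^+ 2 * absq (xi l a) @[K --> \oo] --> tau ->
  \forall n \near \oo, \sum_(k < n) absq (rem L a k) <= (tau + e) * n%:R.
Proof.
move=> e0 ctau.
have tau0 : 0 <= tau.
  rewrite -(cvg_lim (@Rhausdorff R) ctau); apply: limr_ge; first exact: cvgP ctau.
  by apply: nearW => K; exact: energy_ge0.
have [h _] := tail_row (rem_cvg L a) ctau.
have e2 : 0 < e / 2 by rewrite divr_gt0.
have h1 : \forall n \near \oo, cRe (((n%:R^-1)%:C)%C * \sum_(k < n)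
   (((if k == a :> nat then 0 else absq (rem L a k) - tau) : R)%:C)%C) <= e / 2.
  by apply: (cvgr_le _ h).
have [N hN] : exists N : nat, absq (rem L a a) / (e / 2) <= N%:R.
  by exists (Num.truncn (absq (rem L a a) / (e / 2))).+1; rewrite ltW// truncnS_gt.
apply: filter_app h1; exists N.+1 => // n /= Nn h1.
have n0 : 0 < n%:R :> R by rewrite ltr0n (leq_trans _ Nn).
move: h1; rewrite cRe_real Re_sum /= mulrC ler_pdivrMr// => h1.
have h2 : absq (rem L a a) <= e / 2 * n%:R.
  rewrite -ler_pdivrMl// mulrC; apply: le_trans hN _; rewrite ler_nat; exact: ltnW.
apply: (@le_trans _ _ (\sum_(k < n) (if k == a :> nat then 0 else absq (rem L a k) - tau) +
   \sum_(k < n) (tau + (k == a :> nat)%:R * absq (rem L a a)))).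
  rewrite -big_split; apply: ler_sum => k _ /=.
  by case: eqP => [->|_]; rewrite ?mul1r ?mul0r ?addr0 ?add0r ?subrK// lerDr.
rewrite big_split /= sumr_const card_ord -[tau *+ n]mulr_natr -mulr_suml.
have h3 : \sum_(k < n) (k == a :> nat)%:R <= 1 :> R.
  have [an|na] := ltnP a n.
    rewrite (bigD1 (Ordinal an))//= eqxx big1 ?addr0// => k ka.
    by rewrite -val_eqE /= in ka; rewrite (negbTE ka).
  rewrite big1// => k _; case: eqP => // ka.
  by have := ltn_ord k; rewrite ka ltnNge na.
have h4 : (\sum_(k < n) (k == a :> nat)%:R) * absq (rem L a a) <= absq (rem L a a).
  by rewrite ler_piMl// absq_ge0.
move: (\sum_(k < n) _) (_ * absq _) h1 h4 h2 => p q h1 h4 h2.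
by rewrite mulrDl; lra.
Qed.

Let energy_tail a e : 0 < e -> exists L0, forall L, (L0 <= L)%N -> exists2 tau,
  \sum_(L <= l < L + K) y l ^+ 2 * absq (xi l a) @[K --> \oo] --> tau & tau <= e.
Proof.
move=> e0; have /cvg_ex[/= t ct] := @energy_cvg a.
have shift L : \sum_(L <= l < L + K) y l ^+ 2 * absq (xi l a) @[K --> \oo] -->
    t - \sum_(0 <= l < L) y l ^+ 2 * absq (xi l a).
  rewrite (_ : (fun K => _) = (fun K => series (fun l => y l ^+ 2 * absq (xi l a)) (K + L)%N
    - \sum_(0 <= l < L) y l ^+ 2 * absq (xi l a))).
    apply: cvgB; last exact: cvg_cst.
    by rewrite (cvg_shiftn L (series (fun l => y l ^+ 2 * absq (xi l a)))).
  apply/funext => K; rewrite /series /= (big_cat_nat (n := L) (leq0n _) (leq_addl _ _)) /=.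
  by rewrite addrAC subrr add0r addnC.
have : \forall L \near \oo, t - e <= series (fun l => y l ^+ 2 * absq (xi l a)) L.
  by apply: (cvgr_ge _ ct); rewrite ltrBlDr ltrDl.
move=> [L0 _ h]; exists L0 => L /h /=; rewrite /series /= => hL.
by exists (t - \sum_(0 <= l < L) y l ^+ 2 * absq (xi l a)); [exact: shift|lra].
Qed.

Let inv_cvg0 : (n%:R^-1 : R) @[n --> \oo] --> (0 : R).
Proof. by rewrite -(cvg_shiftS (fun n => n%:R^-1 : R)); exact: cvg_harmonic. Qed.

Lemma spiked_row_bounded a : exists B : R, \forall n \near \oo,
  \sum_(k < n) absq (entry a k) <= B * n%:R.
Proof.
have [B hB] := g_row a.
have /cvg_ex[/= t ct] := @energy_cvg a.
(* The remainder after no spike at all is the whole series [z]. *)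
have hz : \forall n \near \oo, \sum_(k < n) absq (rem 0 a k) <= (t + 1) * n%:R.
  by apply: rem_row => //; under eq_fun do rewrite add0n.
exists (2 * gamma1 ^+ 2 + (4 * (s ^+ 2 * B) + 4 * (t + 1))).
apply: filter_app hz; apply: filter_app hB; near=> n => hB hz.
have a3 (p q r : C) : absq (p + q + r) <= 2 * absq p + (4 * absq q + 4 * absq r).
  rewrite -addrA; apply: le_trans (absqD_le _ _) _; have := absqD_le q r; lra.
apply: (@le_trans _ _ (\sum_(k < n) (2 * gamma1 ^+ 2 + (4 * (s ^+ 2 * absq (g a k)) +
   4 * absq (rem 0 a k))))).
  apply: ler_sum => k _; rewrite /entry; apply: le_trans (a3 _ _ _) _.
  have -> : rem 0 a k = z a k by rewrite /rem /tail big_geq// subr0.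
  rewrite !absqM !absqR !lerD2r ler_wpM2l// ler_piMr ?sqr_ge0//.
  by case: (a == k); rewrite /absq /=; lra.
rewrite !big_split /= sumr_const card_ord -!mulr_sumr -[_ *+ n]mulr_natr.
have s2 := ler_wpM2l (sqr_ge0 s) hB.
rewrite !mulrDl; lra.
Unshelve. all: by end_near. Qed.

(** The first [L] spikes produce the limit through the Gram matrix; the remainder is treated by
    Cauchy-Schwarz and [rem_row], whose level [tau] is small once [L] is large. *)
Lemma spiked_row_cvg l a :
  ccvg (fun n => ((n%:R^-1)%:C)%C * \sum_(k < n) entry a k * xi l k)
       (((y l)%:C)%C * xi l a).
Proof.
apply: absq_ccvg; apply/cvgr0Pnorm_le => e e0.
(* The remainder contributes 4 d and the main part d; doubled by [absqD_le], they add up to 10 d. *)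
pose d := e / 10; have d0 : 0 < d by rewrite divr_gt0.
have [L0 hL0] := energy_tail a d0.
pose L := maxn L0 l.+1; have [tau ctau taud] := hL0 L (leq_maxl _ _).
have lL : (l < L)%N by rewrite /L leq_max leqnn orbT.
pose main n := (((gamma1 - \sum_(l < L) y l) / n%:R)%:C)%C * xi l a +
  ((s%:C)%C * (((n%:R^-1)%:C)%C * \sum_(k < n) g a k * xi l k) +
   \sum_(l' < L) ((y l')%:C)%C * xi l' a * gram xi n l' l).
have main_cvg : ccvg main (((y l)%:C)%C * xi l a).
  have -> : ((y l)%:C)%C * xi l a = (0%:C)%C * xi l a + ((s%:C)%C * 0 +
     \sum_(l' < L) ((y l')%:C)%C * xi l' a * (l' == l :> nat)%:R).
    rewrite mulr0 mul0r !add0r (bigD1 (Ordinal lL))//= eqxx mulr1 big1 ?addr0// => l' h.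
    by rewrite -val_eqE /= in h; rewrite (negbTE h) mulr0.
  apply: ccvgD.
    apply: ccvgM; last exact: ccvg_cst.
    have h : (gamma1 - \sum_(l < L) y l) / n%:R @[n --> \oo] --> (gamma1 - \sum_(l < L) y l) * 0.
      by apply: (cvgM _ inv_cvg0); exact: cvg_cst.
    by rewrite mulr0 in h; exact: ccvgR h.
  apply: ccvgD; first by apply: ccvgM; [exact: ccvg_cst|exact: g_spike].
  apply: (@ccvg_sum _ L (fun l' n => ((y l')%:C)%C * xi l' a * gram xi n l' l)
    (fun l' => ((y l')%:C)%C * xi l' a * (l' == l)%:R)) => l' _.
  by apply: ccvgM; [exact: ccvg_cst|exact: gram_cvg].
have h1 := rem_row d0 ctau.
have h2 : \forall n \near \oo, \sum_(k < n) absq (xi l k) <= 2 * n%:R.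
  have [h _] := gram_cvg l l; rewrite eqxx /= in h.
  have : \forall n \near \oo, cRe (gram xi n l l) <= 2 by apply: (cvgr_le _ h); lra.
  move=> h'; apply: filter_app h'; exists 1%N => // n /= n1.
  have n0 : 0 < n%:R :> R by rewrite ltr0n.
  rewrite /gram cRe_real -nrm2_eqRe mulrC ler_pdivrMr//; apply: le_trans.
  by rewrite /nrm2; under [leRHS]eq_bigr do rewrite mxE.
have h3 : \forall n \near \oo, absq (main n - ((y l)%:C)%C * xi l a) <= d.
  have := ccvg_absq (ccvgB main_cvg (ccvg_cst (((y l)%:C)%C * xi l a))).
  by rewrite subrr absq0 => h; apply: (cvgr_le _ h).
apply: filter_app h3; apply: filter_app h2; apply: filter_app h1.
exists a.+1 => // n /= an h1 h2 h3.
have n0 : 0 < n%:R :> R by rewrite ltr0n (leq_trans _ an).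
rewrite ger0_norm ?absq_ge0//.
pose q := ((n%:R^-1)%:C)%C * \sum_(k < n) rem L a k * xi l k.
have -> : ((n%:R^-1)%:C)%C * \sum_(k < n) entry a k * xi l k - ((y l)%:C)%C * xi l a =
    (main n - ((y l)%:C)%C * xi l a) + q.
  rewrite addrAC; congr (_ - _); rewrite /main /q.
  have -> : xi l a = \sum_(k < n) (a == k)%:R * xi l k.
    exact: (esym (sum_delta (Ordinal an) (fun k => xi l k))).
  have -> : \sum_(l' < L) ((y l')%:C)%C * xi l' a * gram xi n l' l = ((n%:R^-1)%:C)%C *
     \sum_(k < n) (\sum_(l' < L) ((y l')%:C)%C * (xi l' a * conjc (xi l' k))) * xi l k.
    rewrite mulr_sumr; under [RHS]eq_bigr do rewrite mulr_suml mulr_sumr.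
    rewrite exchange_big /=; apply: eq_bigr => l' _; rewrite /gram /dotc mulrCA mulr_sumr.
    rewrite mulr_sumr; apply: eq_bigr => k _; rewrite !mxE; ring.
  rewrite rmorphM /= [(gamma1 - _)%:C%C * _]mulrC -!mulrA.
  rewrite [(s%:C)%C * _]mulrCA -!mulrDr; congr (_ * _).
  rewrite !mulr_sumr -!big_split; apply: eq_bigr => k _ /=.
  by rewrite (entryE L) !mulrDl -!mulrA !addrA.
have hq : absq q <= 4 * d.
  rewrite absqM absqR.
  apply: (@le_trans _ _ (n%:R^-1 ^+ 2 * ((d + d) * n%:R * (2 * n%:R)))).
    rewrite ler_wpM2l ?sqr_ge0//; apply: le_trans (absq_sum_le _ _) _.
    apply: ler_pM => //; try by apply: sumr_ge0 => k _; exact: absq_ge0.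
    by apply: le_trans h1 _; rewrite ler_wpM2r ?lerD2r// ltW.
  rewrite le_eqVlt; apply/orP; left; apply/eqP; field; exact: lt0r_neq0.
apply: le_trans (absqD_le _ _) _; rewrite /d in hq h3; lra.
Qed.

End spiked_model.

(** * From a good realization to its eigenvalues and eigenvectors *)

Section spiked_asymptotics.
Context {R : realType}.
Local Notation C := R[i].
Local Notation cRe := (@complex.Re R).

Definition zero_ext (N : option nat) (x : nat -> R) l := if in_seq N l then x l else 0.

(** Everything required of a realization; the last two conditions, on rows, serve the eigenvectors.
    The predicate is stable under a change of sign of [m] and [y], which yields the smallest
    eigenvalues. *)
Definition spiked_asymptotics (m xi : nat -> nat -> C) (y : nat -> R) : Prop :=
  [/\ forall j k, m k j = conjc (m j k),
      forall a b, ccvg (fun n => gram xi n a b) ((a == b)%:R),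
      forall e : R, 0 < e -> exists L0, forall L, (L0 <= L)%N ->
        \forall n \near \oo, forall v : 'cV[C]_n,
          nrm2 (trunc_mx m n *m v - spike_sum xi y L v) <= e ^+ 2 * n%:R ^+ 2 * nrm2 v,
      forall a, exists B : R, \forall n \near \oo, \sum_(k < n) absq (m a k) <= B * n%:R &
      forall l a, ccvg (fun n => ((n%:R^-1)%:C)%C * \sum_(k < n) m a k * xi l k)
        (((y l)%:C)%C * xi l a)].

Lemma trunc_mxN (m : nat -> nat -> C) n : trunc_mx (fun j k => - m j k) n = - trunc_mx m n.
Proof. by apply/matrixP => j k; rewrite !mxE. Qed.

Lemma spiked_asymptoticsN m xi y : spiked_asymptotics m xi y ->
  spiked_asymptotics (fun j k => - m j k) xi (fun l => - y l).
Proof.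
move=> [h1 h2 h3 h4 h5]; split => //.
- by move=> j k; rewrite h1 rmorphN.
- move=> e /h3[L0 hL]; exists L0 => L /hL; apply: filterS => n hn v; move: (hn v).
  have -> : spike_sum xi (fun l => - y l) L v = - spike_sum xi y L v.
    rewrite /spike_sum -sumrN; apply: eq_bigr => l _.
    by rewrite -scaleNr rmorphN mulNr.
  rewrite trunc_mxN mulNmx -opprD /nrm2.
  by under [X in _ -> X <= _]eq_bigr do rewrite mxE absqN.
- move=> a; have [B hB] := h4 a; exists B; move: hB; apply: filterS => n.
  by under [X in _ -> X <= _]eq_bigr do rewrite absqN.
- move=> l a; rewrite rmorphN mulNr; apply: eq_ccvg (ccvgN (h5 l a)) => n.
  by rewrite -mulrN -sumrN; congr (_ * _); apply: eq_bigr => k _; rewrite mulNr.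
Qed.

Lemma zero_extN N x l : zero_ext N (fun l => - x l) l = - zero_ext N x l.
Proof. by rewrite /zero_ext; case: in_seq; rewrite ?oppr0. Qed.

Lemma is_rth_pointN N (x : nat -> R) r l :
  is_rth_point <=%R N x r l -> is_rth_point >=%R N (fun l => - x l) r l.
Proof.
move=> [s [h1 h2 h3 h4 h5]]; exists s; split => //.
  by move: h4; rewrite !sorted_map; apply: sub_sorted => a b /=; rewrite lerN2.
by move=> i iN it /=; rewrite lerN2; exact: h5.
Qed.

(** [s] serves the upper bound, having fewer than [r] indices yet containing every point above
    [x l]; [rcons s l] serves the lower bound. *)
Lemma rth_point_largest N (x : nat -> R) r l : is_rth_point >=%R N x r l ->
  exists s, [/\ (size s < r)%N, forall i, in_seq N i -> x l < x i -> i \in s,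
    size (rcons s l) = r, uniq (rcons s l) &
    forall i, i \in rcons s l -> in_seq N i && (x l <= x i)].
Proof.
move=> [s [h1 h2 h3 h4 h5]]; exists s; split => //.
- by rewrite -h1 size_rcons.
- move=> i iN li; have [|it] := boolP (i \in rcons s l).
    by rewrite mem_rcons inE => /orP[/eqP il|//]; rewrite il ltxx in li.
  by have := h5 i iN it; rewrite /= leNgt li.
- move=> i it; rewrite (allP h3 _ it) /=.
  move: h4; rewrite map_rcons -rev_sorted rev_rcons /= path_sortedE; last first.
    by move=> a b c /= ab bc; exact: le_trans ab bc.
  move=> /andP[/allP h _]; move: it; rewrite mem_rcons inE => /orP[/eqP->//|i_s].
  by apply: h; rewrite mem_rev map_f.
Qed.

(** The first [r] indices of the sorted list realize the r-th point. Used by contraposition: without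
    a positive r-th point, fewer than [r] points exceed a positive level. *)
Lemma rth_point_exists N (x : nat -> R) (t : R) (s : seq nat) (r : nat) :
  uniq s -> (forall i, (i \in s) = in_seq N i && (t < x i)) -> (0 < r <= size s)%N ->
  exists2 l, is_rth_point >=%R N x r l & t < x l.
Proof.
move=> us hs /andP[r0 rs].
pose le := relpre x >=%R.
have le_tot : total le by move=> a b /=; exact: real_comparable (num_real _) (num_real _).
have le_trans' : transitive le by move=> a b c /= ab bc; exact: le_trans bc ab.
pose u := sort le s.
have us' : uniq u by rewrite sort_uniq.
have su : size u = size s by rewrite size_sort.
have sorted_u : sorted le u by exact: sort_sorted.
case E : (rev (take r u)) => [|l w].
  by move/(congr1 size): E; rewrite size_rev size_takel ?su//= => r00; rewrite r00 in r0.
have tE : take r u = rcons (rev w) l by rewrite -[take r u]revK E rev_cons.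
have mem_u i : i \in take r u -> in_seq N i && (t < x i).
  by move=> /mem_take; rewrite mem_sort hs.
have lt : l \in take r u by rewrite tE mem_rcons mem_head.
exists l; last by case/andP: (mem_u _ lt).
exists (rev w); rewrite -tE; split.
- by rewrite size_takel// su.
- exact: take_uniq.
- by apply/allP => i /mem_u /andP[].
- by rewrite sorted_map; exact: take_sorted.
- move=> i iN it; have [|] := boolP (i \in s); last first.
    rewrite hs iN /= -leNgt => xt; apply: le_trans xt _.
    by case/andP: (mem_u _ lt) => _ /ltW.
  rewrite -(mem_sort le) -/u -(cat_take_drop r u) mem_cat (negbTE it) /= => id.
  move: sorted_u; rewrite sorted_pairwise// -(cat_take_drop r u) pairwise_cat.
  by move=> /and3P[/allrelP h _ _]; exact: h.
Qed.

Section largest.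
Context (N : option nat) (x : nat -> R) (m xi : nat -> nat -> C).
Context (x_cvg0 : zero_ext N x n @[n --> \oo] --> (0 : R)).
Context (good : spiked_asymptotics m xi (zero_ext N x)).
Local Notation eigen r n := (rth_eigenvalue >=%R (trunc_mx m n) r).

Let zero_extE l : 0 < zero_ext N x l -> in_seq N l.
Proof. by rewrite /zero_ext; case: in_seq => //; rewrite ltxx. Qed.

Lemma largest_eigenvalue_cvg r l : is_rth_point >=%R N x r l -> 0 < x l ->
  eigen r n / n%:R @[n --> \oo] --> x l.
Proof.
move=> /rth_point_largest[s [sr s_top st ut t_ge]] xl0; have [h1 h2 h3 _ _] := good.
apply/cvgrPdist_le => e e0.
have up : \forall n \near \oo, eigen r n / n%:R <= x l + e.
  apply: (eigen_upper h1 h2 h3 sr _ xl0 e0) => i li.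
  have iN := zero_extE (lt_trans xl0 li).
  by apply: s_top => //; move: li; rewrite /zero_ext iN.
have lo : \forall n \near \oo, x l - e <= eigen r n / n%:R.
  rewrite -st; apply: (eigen_lower h1 h2 h3 _ ut _ xl0 e0); first by rewrite size_rcons.
  by move=> i /t_ge /andP[iN]; rewrite /zero_ext iN.
by apply: filter_app lo; apply: filterS up => n up lo; rewrite ler_norml; lra.
Qed.

(** The hypothesis also covers the absence of an r-th point, as for an infinite sequence of negative
    numbers tending to 0, which has no largest point. *)
Lemma largest_eigenvalue_cvg0 r : (0 < r)%N ->
  (forall l, is_rth_point >=%R N x r l -> x l < 0) ->
  eigen r n / n%:R @[n --> \oo] --> (0 : R).
Proof.
move=> r0 neg; have [h1 h2 h3 _ _] := good.
apply/cvgrPdist_le => e e0; have e20 : 0 < e / 2 by rewrite divr_gt0.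
have lo := eigen_lower0 h1 h3 r0 e0.
have [n0 _ hn0] : \forall l \near \oo, zero_ext N x l < e / 2 by apply: (cvgr_lt _ x_cvg0).
(* Since the zero extension tends to 0, finitely many indices contain all the points above e / 2. *)
pose s := [seq l <- iota 0 n0 | e / 2 < zero_ext N x l].
have sE i : (i \in s) = in_seq N i && (e / 2 < x i).
  rewrite mem_filter mem_iota /= add0n /zero_ext; have [iN|iN] := boolP (in_seq N i).
    have [_|//] := ltnP i n0; rewrite ?andbT// => ni.
    by have := hn0 i ni; rewrite /zero_ext iN /= => /ltW; rewrite leNgt => /negbTE ->.
  by rewrite ltNge ltW.
have us : uniq s by rewrite filter_uniq// iota_uniq.
have sr : (size s < r)%N.
  rewrite ltnNge; apply/negP => rs.
  have [|l /neg xl lt] := rth_point_exists us sE (r := r); first by rewrite r0.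
  by have := lt_trans lt xl; rewrite ltNge ltW.
have up : \forall n \near \oo, eigen r n / n%:R <= e / 2 + e / 2.
  apply: (eigen_upper h1 h2 h3 sr _ e20 e20) => i li.
  by rewrite sE; have iN := zero_extE (lt_trans e20 li); rewrite iN; move: li; rewrite /zero_ext iN.
by apply: filter_app lo; apply: filterS up => n up lo; rewrite ler_norml; lra.
Qed.

Lemma nrm2_hnorm n (v : 'cV[C]_n) : hnorm v = sqrtC n%:R -> nrm2 v = n%:R.
Proof.
move=> /(congr1 (fun z => z ^+ 2)); rewrite /hnorm !sqrtCK => /(congr1 cRe).
rewrite Re_sum -(rmorph_nat (real_complex R)) /= => <-.
by apply: eq_bigr => i _; exact: (esym (normsq_absq _)).
Qed.

Lemma largest_eigenvector_cvg r l (V : forall n, 'cV[C]_n) a :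
  is_rth_point >=%R N x r l -> (forall l', in_seq N l' -> x l' = x l -> l' = l) ->
  0 < x l -> xi l 0%N != 0 ->
  (forall n, (r <= n)%N -> normalized_eigenvector (trunc_mx m n) (eigen r n) (V n)) ->
  nth_coord (V n) a @[n --> \oo] --> xi l a * (`|xi l 0%N| / xi l 0%N).
Proof.
move=> xl single xl0 xi0 hV; have [h1 h2 h3 h4 h5] := good.
have lN : in_seq N l.
  have [s [_ _ _ _ h]] := rth_point_largest xl.
  by have /h/andP[] : l \in rcons s l by rewrite mem_rcons mem_head.
have yl : zero_ext N x l = x l by rewrite /zero_ext lN.
have ev (Q : forall n, 'cV[C]_n -> Prop) : (forall n, (r <= n)%N -> Q n (V n)) ->
    \forall n \near \oo, Q n (V n) by move=> h; exists r.
apply: ccvg_cvg; apply: (@eigen_coord_cvg _ m xi (zero_ext N x) h2 h3 h4 l (h5 l) xi0 _ _ x_cvg0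
  (fun n => eigen r n)).
- by rewrite yl gt_eqF.
(* Outside the sequence the extension is 0, which differs from the positive [x l]. *)
- move=> l'; rewrite yl /zero_ext; case: ifP => [l'N|_ e]; first exact: single.
  by rewrite -e ltxx in xl0.
- by rewrite yl; exact: largest_eigenvalue_cvg.
- by apply: (ev (fun n v => trunc_mx m n *m v = _)) => n /hV[].
- by apply: (ev (fun n v => nrm2 v = n%:R)) => n /hV[_ _ /nrm2_hnorm].
- by exists r => // n /hV[].
Qed.

End largest.

Section smallest.
Context (N : option nat) (x : nat -> R) (m xi : nat -> nat -> C).
Context (x_cvg0 : zero_ext N x n @[n --> \oo] --> (0 : R)).
Context (good : spiked_asymptotics m xi (zero_ext N x)).
Local Notation eigen r n := (rth_eigenvalue <=%R (trunc_mx m n) r).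

Let x' l := - x l.
Let m' j k := - m j k.

Let extN : zero_ext N x' = (fun l => - zero_ext N x l).
Proof. by apply/funext => l; exact: zero_extN. Qed.

Let x'_cvg0 : zero_ext N x' n @[n --> \oo] --> (0 : R).
Proof. by rewrite extN -[X in _ --> X]oppr0; exact: cvgN. Qed.

Let good' : spiked_asymptotics m' xi (zero_ext N x').
Proof. by rewrite extN; exact: spiked_asymptoticsN. Qed.

Let eigenN r n : eigen r n = - rth_eigenvalue >=%R (trunc_mx m' n) r.
Proof.
rewrite trunc_mxN; apply: rth_eigenvalueN.
by have [h _ _ _ _] := good; exact: trunc_mx_herm.
Qed.

Lemma smallest_eigenvalue_cvg r l : is_rth_point <=%R N x r l -> x l < 0 ->
  eigen r n / n%:R @[n --> \oo] --> x l.
Proof.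
move=> /is_rth_pointN xl xl0.
have x'0 : 0 < x' l by rewrite oppr_gt0.
rewrite -[x l]opprK; under eq_fun do rewrite eigenN mulNr.
exact: cvgN (largest_eigenvalue_cvg good' xl x'0).
Qed.

Lemma is_rth_pointNK r l : is_rth_point >=%R N x' r l -> is_rth_point <=%R N x r l.
Proof.
move=> [s [h1 h2 h3 h4 h5]]; exists s; split => //.
  by move: h4; rewrite !sorted_map; apply: sub_sorted => a b /=; rewrite lerN2.
by move=> i iN it; have := h5 i iN it; rewrite /= lerN2.
Qed.

Lemma smallest_eigenvalue_cvg0 r : (0 < r)%N ->
  (forall l, is_rth_point <=%R N x r l -> 0 < x l) ->
  eigen r n / n%:R @[n --> \oo] --> (0 : R).
Proof.
move=> r0 pos; rewrite -[0 : R]oppr0; under eq_fun do rewrite eigenN mulNr.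
apply: cvgN (largest_eigenvalue_cvg0 x'_cvg0 good' r0 _) => l /is_rth_pointNK /pos.
by rewrite oppr_lt0.
Qed.

Lemma smallest_eigenvector_cvg r l (V : forall n, 'cV[C]_n) a :
  is_rth_point <=%R N x r l -> (forall l', in_seq N l' -> x l' = x l -> l' = l) ->
  x l < 0 -> xi l 0%N != 0 ->
  (forall n, (r <= n)%N -> normalized_eigenvector (trunc_mx m n) (eigen r n) (V n)) ->
  nth_coord (V n) a @[n --> \oo] --> xi l a * (`|xi l 0%N| / xi l 0%N).
Proof.
move=> /is_rth_pointN xl single xl0 xi0 hV.
apply: (@largest_eigenvector_cvg N x' m' xi x'_cvg0 good' r l V a xl) => //.
- by move=> l' l'N /oppr_inj; exact: single.
- by rewrite oppr_gt0.
- move=> n rn; have [v0 Av hv ph] := hV n rn; split => //.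
  by rewrite trunc_mxN mulNmx Av eigenN trunc_mxN rmorphN scaleNr opprK.
Qed.

End smallest.
End spiked_asymptotics.

(** * The Gaussian model *)

Section square_summable_spikes.
Context {R : realType} (N : option nat) (x : nat -> R) (x_sq : square_summable N x).
Local Notation y := (zero_ext N x).

Let sumE : series (fun l => y l ^+ 2) = series (fun l => if in_seq N l then x l ^+ 2 else 0).
Proof.
congr series; apply/funext => l; rewrite /zero_ext.
by case: in_seq; rewrite ?expr0n.
Qed.

Let S := limn (series (fun l => y l ^+ 2)).

Let S_cvg : series (fun l => y l ^+ 2) n @[n --> \oo] --> S.
Proof. by rewrite /S sumE. Qed.

Lemma zero_ext_sum n : \sum_(0 <= l < n) y l ^+ 2 <= S.
Proof.
apply: (@nondecreasing_cvgn_le _ (series (fun l => y l ^+ 2))); last exact: cvgP S_cvg.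
by apply: nondecreasing_series => k _ _; exact: sqr_ge0.
Qed.

Lemma zero_ext_tail e : 0 < e -> exists L, forall K, \sum_(L <= l < L + K) y l ^+ 2 <= e.
Proof.
move=> e0; have : \forall L \near \oo, S - e <= series (fun l => y l ^+ 2) L.
  by apply: (cvgr_ge _ S_cvg); rewrite ltrBlDr ltrDl.
move=> [L _ /(_ L (leqnn _))]; rewrite /series /= => hL; exists L => K.
have := zero_ext_sum (L + K); rewrite (big_cat_nat (n := L)) ?leq_addr//=; lra.
Qed.

Lemma zero_ext_cvg0 : y n @[n --> \oo] --> (0 : R).
Proof.
have /cvgr0Pnorm_le h : y n ^+ 2 @[n --> \oo] --> (0 : R).
  by apply: cvg_series_cvg_0; exact: cvgP S_cvg.
apply/cvgr0Pnorm_le => e e0; have := h (e ^+ 2); rewrite exprn_gt0// => /(_ isT).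
apply: filterS => n; by rewrite normrX ler_pXn2r// nnegrE ltW.
Qed.

End square_summable_spikes.

Section gaussian_model.
Context d (T : measurableType d) (R : realType) (P : probability T R).
Local Notation C := R[i].
Local Notation cRe := (@complex.Re R).
Local Notation cIm := (@complex.Im R).

Lemma call_moments_complex_rv (Z : T -> C) : call_moments P Z -> complex_rv Z.
Proof. by move=> [[mR _] [mI _]]; exact: measurable_fun_pair. Qed.

(** Meant for the imaginary parts of diagonal entries: the Dirac mass counts as Gaussian, so that
    diagonal and off-diagonal entries share one moment bound. *)
Lemma real_gaussian0 : real_gaussian P (fun=> 0).
Proof.
split; first exact: measurable_cst.
exists 0, 0; split => // A mA; rewrite /gaussian_law eqxx diracE.
have [A0|A0] := boolP (0 \in A).
  have -> : (fun=> 0) @^-1` A = [set: T] by apply/seteqP; split => // w _ /=; rewrite inE in A0.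
  exact: probability_setT.
have -> : (fun=> 0) @^-1` A = set0 :> set T.
  by apply/seteqP; split => // w /= A0'; move: A0; rewrite mem_set.
exact: measure0.
Qed.

Lemma Ex_absq1 (Z : T -> C) : (\int[P]_w (absq (Z w))%:E = 1)%E ->
  Ex P (fun w => absq (Z w)) = 1.
Proof. by rewrite /Ex => ->. Qed.

Lemma complex_gaussian_moments : exists2 c : R, 0 <= c & forall Z : T -> C,
  complex_gaussian P Z -> has_expectation P (fun w => `|Z w| ^+ 2) 1 ->
  call_moments P Z /\ Ex P (fun w => absq (Z w) ^+ 4) <= c.
Proof.
have [c c0 h] := gaussian_entry_moment P 4; exists c => // Z gZ Z2.
have [gR gI] := complex_gaussian_parts gZ.
by apply: h => //; exact: has_expectation_normsq.
Qed.

(** Hermitian symmetry makes the diagonal real and transfers the bounds above the diagonal to the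
    entries below it. *)
Lemma GUE_moments (G : nat -> nat -> T -> C) : is_GUE P G -> exists2 c : R, 0 <= c &
  forall j k, [/\ call_moments P (G j k), cEx P (G j k) = 0 &
    Ex P (fun w => absq (G j k w) ^+ 4) <= c].
Proof.
move=> [G_herm _ G_diag G_off].
have [c c0 h] := gaussian_entry_moment P 4; exists c => //.
have off j k : (j < k)%N -> [/\ call_moments P (G j k), cEx P (G j k) = 0 &
    Ex P (fun w => absq (G j k w) ^+ 4) <= c].
  move=> /G_off[gG _ /has_expectation0 G0 /has_expectation_normsq G2].
  have [gR gI] := complex_gaussian_parts gG.
  by have [] := h _ gR gI G2.
move=> j k; have [jk|kj|<-] := ltngtP j k; first exact: off.
  have [m0 e0 q0] := off _ _ kj.
  have E : G j k = (fun w => conjc (G k j w)) by apply/funext => w; rewrite -G_herm.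
  rewrite E; split; first exact: call_momentsJ.
    by rewrite cExJ// e0 conjc0.
  by under eq_fun do rewrite absqJ.
have [gR /has_expectation0 G0 [G2 _]] := G_diag j.
have Im0 w : cIm (G j j w) = 0.
  by have := congr1 cIm (G_herm j j w); rewrite cImJ => e; lra.
have gI : real_gaussian P (fun w => cIm (G j j w)).
  by under eq_fun do rewrite Im0; exact: real_gaussian0.
have G2' : (\int[P]_w (absq (G j j w))%:E = 1)%E.
  rewrite -[RHS]G2 unlock; apply: eq_integral => w _; congr EFin.
  by rewrite expr2 cReM /absq Im0; ring.
by have [] := h _ gR gI G2'.
Qed.

Context (gamma1 gamma2 : R) (N : option nat) (x : nat -> R).
Context (G xi : nat -> nat -> T -> C).
Context (x_sq : square_summable N x) (G_GUE : is_GUE P G).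
Context (xi_iid : iid_complex_gaussians P xi).
Context (xi_G_indep : independent_families P
  (fun lj : nat * nat => xi lj.1 lj.2) (fun jk : nat * nat => G jk.1 jk.2)).

Lemma spike_neq0 l : {ae P, forall w, xi l 0%N w != 0}.
Proof.
have [_ _ h] := xi_iid; have [gZ Z0 _ Z2] := h l 0%N.
apply: gaussian_entry_neq0 => //; first exact: has_expectation0.
exact: has_expectation_normsq.
Qed.

Lemma spiked_asymptotics_ae : {ae P, forall w, spiked_asymptotics
  (fun j k => spiked_entry gamma1 gamma2 N x G xi j k w) (fun l j => xi l j w) (zero_ext N x)}.
Proof.
have [xi_indep _ xi_law] := xi_iid; have [G_herm G_indep _ _] := G_GUE.
have [c c0 hc] := complex_gaussian_moments; have [b b0 hb] := GUE_moments G_GUE.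
have xiM l j : call_moments P (xi l j).
  by have [gZ _ _ Z2] := xi_law l j; have [] := hc _ gZ Z2.
have xiB l j : Ex P (fun w => absq (xi l j w) ^+ 4) <= c.
  by have [gZ _ _ Z2] := xi_law l j; have [] := hc _ gZ Z2.
have xiE l j : cEx P (xi l j) = 0.
  by have [_ /has_expectation0 Z0 _ _] := xi_law l j.
have xiV l j : Ex P (fun w => absq (xi l j w)) = 1.
  by have [_ _ _ /has_expectation_normsq Z2] := xi_law l j; exact: Ex_absq1.
have xi_meas (lj : nat * nat) : complex_rv (xi lj.1 lj.2) by exact: call_moments_complex_rv.
have GM j k : call_moments P (G j k) by have [] := hb j k.
have GE j k : cEx P (G j k) = 0 by have [] := hb j k.
have GB j k : Ex P (fun w => absq (G j k w) ^+ 4) <= b by have [] := hb j k.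
have G_meas (e : {jk : nat * nat | (jk.1 <= jk.2)%N}) : complex_rv (G (val e).1 (val e).2).
  exact: call_moments_complex_rv.
have y_sum := zero_ext_sum x_sq.
(* [q] comes from [noise_frobenius_ae] with the tail bound and the margin both equal to 1/(i+1). *)
pose y := zero_ext N x; pose q : R := 16 * (2 * (16 * c + 9) + 1).
have h_cvg := noise_cvg xi_meas xi_indep xiM xiE xiV c0 xiB y_sum.
have h_energy := row_energy_cvg xi_meas xi_indep xiM xiE xiV c0 xiB y_sum.
have h_gram := gram_ae xi_meas xi_indep xiM xiE xiV xiB.
have h_row : {ae P, forall w, forall m a, forall (V : nat -> C) (tau : R),
    (forall k, ccvg (fun K => noise xi y m K a k w) (V k)) ->
    \sum_(m <= l < m + K) y l ^+ 2 * absq (xi l a w) @[K --> \oo] --> tau ->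
    ccvg (fun n => ((n%:R^-1)%:C)%C *
      \sum_(k < n) (((if k == a :> nat then 0 else absq (V k) - tau) : R)%:C)%C) 0}.
  apply: ae_foralln => m; apply: ae_foralln => a.
  exact: (row_noise_ae xi_meas xi_indep xiM xiE xiV c0 xiB y_sum).
have h_frob : {ae P, forall w, forall m (i : nat),
    (forall K, \sum_(m <= l < m + K) y l ^+ 2 <= i.+1%:R^-1) ->
    forall V : nat -> nat -> C, (forall j k, ccvg (fun K => noise xi y m K j k w) (V j k)) ->
    \forall n \near \oo, \sum_(j < n) \sum_(k < n) absq (V j k) <= q * i.+1%:R^-1 * n%:R ^+ 2}.
  apply: ae_foralln => m; apply: ae_foralln => i.
  (* The condition on the tail does not involve w, so it is decided before any almost sure event is
     taken. *)
  have [h|h] := pselect (forall K, \sum_(m <= l < m + K) y l ^+ 2 <= i.+1%:R^-1); last first.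
    by apply: aeW => w.
  have := noise_frobenius_ae xi_meas xi_indep xiM xiE xiV c0 xiB h.
  apply: filterS => w hw _ V hV; have i0 : 0 < i.+1%:R^-1 :> R by rewrite invr_gt0 ltr0n.
  apply: filterS (hw V hV _ i0) => n /le_trans; apply.
  rewrite le_eqVlt; apply/orP; left; apply/eqP; rewrite /q; ring.
have g_op := wigner_op_ae G_herm G_meas G_indep GM GE b0 GB.
have g_row := wigner_row_ae G_herm G_meas G_indep GM b0 GB.
have g_spike := wigner_spike_ae GM GB xi_meas xi_indep xiM xiE xiB xi_G_indep.
apply: filter_app g_spike; apply: filter_app g_row; apply: filter_app g_op.
apply: filter_app h_frob; apply: filter_app h_row; apply: filter_app h_gram.
apply: filter_app h_energy; apply: filterS h_cvg => w w_cvg w_energy w_gram w_row w_frob w_op w_grow w_spike.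
(* [limn] is meaningful only where the series converges; there it is identified with the limit
   provided by [noise_cvg]. *)
pose z j k : C := limn (series (fun l => if in_seq N l
  then ((x l)%:C)%C * (xi l j w * conjc (xi l k w) - (j == k)%:R) else 0)).
pose g j k := G j k w; pose u l j := xi l j w.
have z_cvg j k : ccvg (fun K => tail y u 0 K j k) (z j k).
  have [z' hz'] := w_cvg j k.
  suff -> : z j k = z' by exact: hz'.
  apply: (cvg_lim (@norm_hausdorff _ _)).
  have -> : series (fun l => if in_seq N l
      then ((x l)%:C)%C * (xi l j w * conjc (xi l k w) - (j == k)%:R) else 0) =
      (fun K => noise xi y 0 K j k w).
    apply/funext => K; rewrite /series /noise /= add0n; apply: eq_bigr => l _.
    by rewrite /y /zero_ext; case: in_seq; rewrite ?mul0r.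
  exact: ccvg_cvg.
have gram_cvg a e : ccvg (fun n => gram u n a e) (a == e)%:R.
  apply: eq_ccvg (w_gram a e) => n; congr (_ * _).
  by apply: eq_bigr => k _; rewrite !mxE.
have y_tail := zero_ext_tail x_sq.
have g_herm j k : g k j = conjc (g j k) by exact: G_herm.
have -> : (fun j k => spiked_entry gamma1 gamma2 N x G xi j k w) =
  entry gamma1 (Num.sqrt gamma2) g z by [].
split => //.
- exact: spiked_herm _ _ g_herm z_cvg.
- exact: (spiked_op _ _ y_tail z_cvg w_op w_frob).
- exact: spiked_row_bounded _ _ z_cvg w_grow w_row w_energy.
- exact: spiked_row_cvg _ _ z_cvg gram_cvg w_spike w_row w_energy.
Qed.

End gaussian_model.

Unset Implicit Arguments.

Theorem proposition1p5 (R : realType) (d : measure_display)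
  (T : measurableType d) (P : probability T R)
  (gamma1 gamma2 : R) (N : option nat) (x : nat -> R)
  (G xi : nat -> nat -> T -> R[i])
  (gamma2_ge0 : 0 <= gamma2)
  (x_neq0 : forall l : nat, in_seq N l -> x l != 0)
  (x_sq : square_summable N x)
  (G_GUE : is_GUE P G)
  (xi_iid : iid_complex_gaussians P xi)
  (xi_G_indep : independent_families P
     (fun lj : nat * nat => xi lj.1 lj.2) (fun jk : nat * nat => G jk.1 jk.2)) :
  let M := fun n w => spiked_mx gamma1 gamma2 N x G xi n w in
  (* (1), largest eigenvalues *)
  (forall r : nat, (0 < r)%N ->
     (forall l : nat, is_rth_point >=%R N x r l -> 0 < x l ->
        {ae P, forall w,
          rth_eigenvalue >=%R (M n w) r / n%:R @[n --> \oo] --> x l}) /\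
     ((forall l : nat, is_rth_point >=%R N x r l -> x l < 0) ->
        {ae P, forall w,
          rth_eigenvalue >=%R (M n w) r / n%:R @[n --> \oo] --> (0 : R)})) /\
  (* (1), smallest eigenvalues *)
  (forall r : nat, (0 < r)%N ->
     (forall l : nat, is_rth_point <=%R N x r l -> x l < 0 ->
        {ae P, forall w,
          rth_eigenvalue <=%R (M n w) r / n%:R @[n --> \oo] --> x l}) /\
     ((forall l : nat, is_rth_point <=%R N x r l -> 0 < x l) ->
        {ae P, forall w,
          rth_eigenvalue <=%R (M n w) r / n%:R @[n --> \oo] --> (0 : R)})) /\
  (* (2), largest eigenvalues *)
  (forall r l : nat, (0 < r)%N -> is_rth_point >=%R N x r l ->
     (forall l' : nat, in_seq N l' -> x l' = x l -> l' = l) ->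
     0 < x l ->
     forall V : forall n : nat, T -> 'cV[R[i]]_n,
     {ae P, forall w, forall n : nat, (r <= n)%N ->
        normalized_eigenvector (M n w) (rth_eigenvalue >=%R (M n w) r) (V n w)} ->
     forall a : nat,
     {ae P, forall w, nth_coord (V n w) a @[n --> \oo] -->
        xi l a w * (`|xi l 0%N w| / xi l 0%N w)}) /\
  (* (2), smallest eigenvalues *)
  (forall r l : nat, (0 < r)%N -> is_rth_point <=%R N x r l ->
     (forall l' : nat, in_seq N l' -> x l' = x l -> l' = l) ->
     x l < 0 ->
     forall V : forall n : nat, T -> 'cV[R[i]]_n,
     {ae P, forall w, forall n : nat, (r <= n)%N ->
        normalized_eigenvector (M n w) (rth_eigenvalue <=%R (M n w) r) (V n w)} ->
     forall a : nat,
     {ae P, forall w, nth_coord (V n w) a @[n --> \oo] -->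
        xi l a w * (`|xi l 0%N w| / xi l 0%N w)}).
Proof.
move=> M.
have y0 := zero_ext_cvg0 x_sq.
have good := spiked_asymptotics_ae gamma1 gamma2 x_sq G_GUE xi_iid xi_G_indep.
split; [|split; [|split]].
- move=> r r0; split=> [l lr xl|neg]; apply: filterS good => w gw.
    exact: (largest_eigenvalue_cvg gw lr xl).
  exact: (largest_eigenvalue_cvg0 y0 gw r0 neg).
- move=> r r0; split=> [l lr xl|pos]; apply: filterS good => w gw.
    exact: (smallest_eigenvalue_cvg gw lr xl).
  exact: (smallest_eigenvalue_cvg0 y0 gw r0 pos).
- move=> r l r0 lr single xl V hV a.
  have := spike_neq0 xi_iid l; apply: filter_app; apply: filter_app hV.
  apply: filterS good => w gw hV xi0.
  exact: (@largest_eigenvector_cvg _ _ _ _ (fun l j => xi l j w) y0 gw r l (fun n => V n w) a).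
- move=> r l r0 lr single xl V hV a.
  have := spike_neq0 xi_iid l; apply: filter_app; apply: filter_app hV.
  apply: filterS good => w gw hV xi0.
  exact: (@smallest_eigenvector_cvg _ _ _ _ (fun l j => xi l j w) y0 gw r l (fun n => V n w) a).
Qed.
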